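(* For any field $F$, there is an isomorphism \[ \mathrm{AS}(F(\!(t)\!))\cong\mathrm{AS}(F)\times\mathrm{FQ}^{\wedge}_2\{\sigma,\tau\}\cong\mathrm{AS}(F)\times\widehat{\mathbb{Z}} \] of profinite involutory quandles, where $F(\!(t)\!)$ is the field of formal Laurent series over $F$, where $\mathrm{FQ}^{\wedge}_2\{\sigma,\tau\}$ is the free profinite involutory quandle on a set $\{\sigma,\tau\}$ with two elements, which, as a profinite space, is homeomorphic to $\widehat{\mathbb{Z}}$, and where the quandle structure on $\widehat{\mathbb{Z}}$ is given by $a\rhd b=2a-b$ for $a,b\in\widehat{\mathbb{Z}}$.
   Context: A rack is a set $R$ with a binary operation $\rhd$ such that for all $x\in R$ the map $y\mapsto x\rhd y$ is a bijection and $x\rhd(y\rhd z)=(x\rhd y)\rhd(x\rhd z)$ for all $x,y,z$. A quandle is a rack with $x\rhd x=x$ for all $x$. It is involutory if $x\rhd(x\rhd y)=y$ for all $x,y$. A profinite involutory quandle is a profinite space (totally disconnected compact Hausdorff) with an involutory quandle structure such that $\rhd$ is continuous. Morphisms are continuous maps compatible with $\rhd$. Products carry the componentwise operation and the product topology. For a group $G$ with identity $e$, $\mathrm{Inv}(G)=\{s\in G\mid s^2=e\neq s\}$, an involutory quandle under conjugation $g\rhd x=gxg^{-1}$. For a field $F$, $\mathrm{Gal}(F)$ is its absolute Galois group, and the Artin--Schreier quandle is $\mathrm{AS}(F)=\mathrm{Inv}(\mathrm{Gal}(F))$ with conjugation and the subspace topology; it is a profinite involutory quandle (possibly empty). For a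 profinite space $S$, $\mathrm{F}^{\wedge}_2(S)$ is the profinite group with a continuous map $S\to\mathrm{F}^{\wedge}_2(S)$ such that continuous homomorphisms $\mathrm{F}^{\wedge}_2(S)\to G$ into a profinite group $G$ correspond, by restriction, to continuous maps $S\to G$ all of whose values square to the identity. The free profinite involutory quandle on $S$ is $\mathrm{FQ}^{\wedge}_2(S)=\mathrm{Inv}(\mathrm{F}^{\wedge}_2(S))$ with conjugation and the subspace topology. $\widehat{\mathbb{Z}}$ is the profinite completion of $\mathbb{Z}$. *)

(* Defs.v *)
From HB Require Import structures.
From mathcomp Require Import all_boot all_order all_algebra.
From mathcomp Require Import separable zify.
From mathcomp Require Import all_classical topology.

Set Implicit Arguments.
Unset Strict Implicit.
Unset Printing Implicit Defensive.

Import Order.TTheory GRing.Theory Num.Theory.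
Local Open Scope classical_set_scope.
Local Open Scope ring_scope.

HB.mixin Record isRack Q := {
  rhd : Q -> Q -> Q ;
  rhd_bij : forall x, bijective (rhd x) ;
  rhdDr : forall x y z, rhd x (rhd y z) = rhd (rhd x y) (rhd x z)
}.

#[short(type="rackType")]
HB.structure Definition Rack := {Q of isRack Q}.

HB.mixin Record Rack_isQuandle Q of Rack Q := {
  rhdxx : forall x : Q, rhd x x = x
}.

#[short(type="quandleType")]
HB.structure Definition Quandle := {Q of Rack_isQuandle Q & Rack Q}.

HB.mixin Record Quandle_isInvolutory Q of Quandle Q := {
  rhdK : forall x : Q, involutive (rhd x)
}.

#[short(type="involutoryQuandleType")]
HB.structure Definition InvolutoryQuandle :=
  {Q of Quandle_isInvolutory Q & Quandle Q}.

HB.factory Record isInvolutoryQuandle Q := {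
  rhd : Q -> Q -> Q ;
  rhdDr : forall x y z, rhd x (rhd y z) = rhd (rhd x y) (rhd x z) ;
  rhdxx : forall x, rhd x x = x ;
  rhdK : forall x, involutive (rhd x)
}.

HB.builders Context Q of isInvolutoryQuandle Q.
HB.instance Definition _ := isRack.Build Q (fun x => inv_bij (rhdK x)) rhdDr.
HB.instance Definition _ := Rack_isQuandle.Build Q rhdxx.
HB.instance Definition _ := Quandle_isInvolutory.Build Q rhdK.
HB.end.

(** An involutory quandle and a topology on the same carrier; the
    compatibility of the two is part of [profinite_quandle] below. *)
#[short(type="topInvolutoryQuandleType")]
HB.structure Definition TopInvolutoryQuandle :=
  {Q of InvolutoryQuandle Q & Topological Q}.

Definition profinite_space (T : topologicalType) : Prop :=
  [/\ compact [set: T], hausdorff_space T & totally_disconnected [set: T]].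

Definition profinite_quandle (Q : topInvolutoryQuandleType) : Prop :=
  profinite_space Q /\ continuous (fun p : Q * Q => rhd p.1 p.2).

Definition quandle_morphism (Q Q' : topInvolutoryQuandleType) (f : Q -> Q') :=
  continuous f /\ {morph f : x y / rhd x y}.

Definition profinite_quandle_iso (Q Q' : topInvolutoryQuandleType) : Prop :=
  [/\ profinite_quandle Q, profinite_quandle Q' &
      exists (f : Q -> Q') (g : Q' -> Q),
        [/\ quandle_morphism f, quandle_morphism g, cancel f g & cancel g f]].

Section ProductQuandle.
Variables Q Q' : involutoryQuandleType.

Definition prod_rhd (x y : Q * Q') := (rhd x.1 y.1, rhd x.2 y.2).

Lemma prod_rhdDr x y z :
  prod_rhd x (prod_rhd y z) = prod_rhd (prod_rhd x y) (prod_rhd x z).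
Proof. by congr pair => /=; rewrite rhdDr. Qed.

Lemma prod_rhdxx x : prod_rhd x x = x.
Proof. by case: x => a b; rewrite /prod_rhd /= !rhdxx. Qed.

Lemma prod_rhdK x : involutive (prod_rhd x).
Proof. by move=> [a b]; rewrite /prod_rhd /= !rhdK. Qed.

HB.instance Definition _ :=
  isInvolutoryQuandle.Build (Q * Q')%type prod_rhdDr prod_rhdxx prod_rhdK.
End ProductQuandle.

HB.instance Definition _ (Q Q' : topInvolutoryQuandleType) :=
  Topological.on (Q * Q')%type.

(** A group and a topology on the same carrier; the compatibility of the two
    is part of [profinite_group] below. *)
#[short(type="topGroupType")]
HB.structure Definition TopGroup := {G of Group G & Topological G}.

Definition profinite_group (G : topGroupType) : Prop :=
  [/\ profinite_space G, continuous (fun p : G * G => (p.1 * p.2)%g) &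
      continuous (fun x : G => x^-1%g)].

Section Invol.
Variable G : topGroupType.
Local Open Scope group_scope.

Definition Invol_set : set G := [set s | s * s = 1 /\ s <> 1].

Definition Invol : Type := set_type Invol_set.

HB.instance Definition _ := Topological.copy Invol (set_type Invol_set).

Lemma Invol_conj_subproof (g x : Invol) :
  Invol_set (set_val g * set_val x * (set_val g)^-1).
Proof.
have [xx x1] := set_valP x; split.
  by rewrite !mulgA mulgVK -(mulgA _ (set_val x) (set_val x)) xx mulg1 mulgV.
move=> /(congr1 (fun y => (set_val g)^-1 * y * set_val g)).
by rewrite !mulgA mulVg mul1g mulgVK mulg1 mulVg.
Qed.

Definition Invol_rhd (g x : Invol) : Invol :=
  SigSub (mem_set (Invol_conj_subproof g x)).

Lemma Invol_rhdDr x y z :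
  Invol_rhd x (Invol_rhd y z) = Invol_rhd (Invol_rhd x y) (Invol_rhd x z).
Proof. by apply: val_inj; rewrite /= !invgM !invgK !mulgA !mulgVK. Qed.

Lemma Invol_rhdxx x : Invol_rhd x x = x.
Proof. by apply: val_inj; rewrite /= mulgK. Qed.

Lemma Invol_rhdK x : involutive (Invol_rhd x).
Proof.
have [xx _] := set_valP x.
move=> y; apply: val_inj; rewrite /= !mulgA xx mul1g.
by rewrite -mulgA -invgM xx invg1 mulg1.
Qed.

HB.instance Definition _ :=
  isInvolutoryQuandle.Build Invol Invol_rhdDr Invol_rhdxx Invol_rhdK.
End Invol.

(** [P] with [iota : S -> P] is the profinite group freely generated by
    elements of order dividing two indexed by [S]; the free profinite
    involutory quandle on [S] is then [Invol P]. *)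
Definition is_free_profinite2 (S : topologicalType) (P : topGroupType)
    (iota : S -> P) : Prop :=
  [/\ profinite_group P,
      continuous iota,
      forall s, (iota s * iota s = 1)%g &
      forall H : topGroupType, profinite_group H ->
      forall f : S -> H, continuous f -> (forall s, (f s * f s = 1)%g) ->
      exists! phi : P -> H,
        [/\ continuous phi, {morph phi : x y / (x * y)%g} &
            forall s, phi (iota s) = f s]].

Record is_separable_closure (F K : fieldType) (iota : {rmorphism F -> K}) :
    Prop := {
  sepclosure_separable : forall x : K, exists p : {poly F},
    [/\ p \is monic, irreducible_poly p, separable_poly p &
        root (map_poly iota p) x] ;
  sepclosure_closed : forall p : {poly K},
    separable_poly p -> (1 < size p)%N -> exists x, root p x
}.

Section Gal.
Variables (F K : fieldType) (iota : {rmorphism F -> K}).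

(** With the discrete topology on [K], the topology of pointwise convergence
    on automorphisms is the Krull topology: the automorphisms agreeing with
    [s] at finitely many points [x1 .. xn] form the coset
    [s Gal(K / F(x1 .. xn))]. *)
Definition Gal_set : set {ptws K -> discrete_topology K} :=
  [set s : K -> K | [/\ bijective s, {morph s : x y / x + y},
                        {morph s : x y / x * y} &
                        forall a, s (iota a) = iota a]].

Definition Gal : Type := set_type Gal_set.

HB.instance Definition _ := Topological.copy Gal (set_type Gal_set).

Definition Gal_fun (s : Gal) : K -> K := set_val s.

Lemma Gal_funP (s : Gal) :
  [/\ bijective (Gal_fun s), {morph Gal_fun s : x y / x + y},
      {morph Gal_fun s : x y / x * y} & forall a, Gal_fun s (iota a) = iota a].
Proof. exact: set_valP s. Qed.

Lemma Gal_eqP (s t : Gal) : Gal_fun s =1 Gal_fun t -> s = t.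
Proof. by move=> st; apply: val_inj; exact/funext. Qed.

Definition Gal_of (s : K -> K) (sP : Gal_set s) : Gal := SigSub (mem_set sP).

Lemma Gal_one_subproof : Gal_set id.
Proof. by split=> //; exists id. Qed.

Lemma Gal_mul_subproof (s t : Gal) : Gal_set (Gal_fun s \o Gal_fun t).
Proof.
have [sb sD sM sF] := Gal_funP s; have [tb tD tM tF] := Gal_funP t.
split=> [|x y|x y|a] /=; first exact: bij_comp.
- by rewrite tD sD.
- by rewrite tM sM.
- by rewrite tF sF.
Qed.

Lemma Gal_inv_ex (s : Gal) :
  exists t : K -> K,
    [/\ cancel (Gal_fun s) t, cancel t (Gal_fun s) & Gal_set t].
Proof.
have [[t st ts] sD sM sF] := Gal_funP s; exists t; split=> //.
split=> [|x y|x y|a]; first by exists (Gal_fun s).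
- by rewrite -{1}(ts x) -{1}(ts y) -sD st.
- by rewrite -{1}(ts x) -{1}(ts y) -sM st.
- by rewrite -{1}(sF a) st.
Qed.

Definition Gal_one : Gal := Gal_of Gal_one_subproof.

Definition Gal_mul (s t : Gal) : Gal := Gal_of (Gal_mul_subproof s t).

Definition Gal_inv (s : Gal) : Gal :=
  let: And3 _ _ tP := projT2 (cid (Gal_inv_ex s)) in Gal_of tP.

Lemma Gal_mulA : associative Gal_mul.
Proof. by move=> s t u; apply: Gal_eqP. Qed.

Lemma Gal_mul1 : left_id Gal_one Gal_mul.
Proof. by move=> s; apply: Gal_eqP. Qed.

Lemma Gal_mulr1 : right_id Gal_one Gal_mul.
Proof. by move=> s; apply: Gal_eqP. Qed.

Lemma Gal_mulV : left_inverse Gal_one Gal_inv Gal_mul.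
Proof.
move=> s; apply: Gal_eqP => x; rewrite /Gal_inv.
by case: (projT2 (cid (Gal_inv_ex s))) => st _ tP; exact: st.
Qed.

Lemma Gal_mulrV : right_inverse Gal_one Gal_inv Gal_mul.
Proof.
move=> s; apply: Gal_eqP => x; rewrite /Gal_inv.
by case: (projT2 (cid (Gal_inv_ex s))) => _ ts tP; exact: ts.
Qed.

HB.instance Definition _ :=
  isGroup.Build Gal Gal_mulA Gal_mul1 Gal_mulr1 Gal_mulV Gal_mulrV.

Definition AS := Invol Gal.
HB.instance Definition _ := TopInvolutoryQuandle.on AS.

End Gal.

Section Laurent.
Variable F : fieldType.

(** [laurent] is the field of formal sums [\sum_n f n t^n] over the integers
    [n] in which only finitely many of the [f n] with [n < 0] are nonzero. *)
Definition laurent_set : set (int -> F) :=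
  [set f | exists N : int, forall n, n < N -> f n = 0].

Definition laurent : Type := set_type laurent_set.

HB.instance Definition _ := Choice.on laurent.

Definition lcoef (f : laurent) : int -> F := set_val f.

Definition laurent_of (f : int -> F) (fP : laurent_set f) : laurent :=
  SigSub (mem_set fP).

Lemma laurent_eqP (f g : laurent) : lcoef f =1 lcoef g -> f = g.
Proof. by move=> fg; apply: val_inj; exact/funext. Qed.

Definition supp_from (a : int) (f : int -> F) := forall n, n < a -> f n = 0.

Lemma supp_from_le a b f : a <= b -> supp_from b f -> supp_from a f.
Proof. by move=> ab fb n na; apply: fb; exact: lt_le_trans ab. Qed.

Lemma lcoef_from (f : laurent) : exists a, supp_from a (lcoef f).
Proof. exact: (set_valP f). Qed.

Lemma lcoef_from2 (f g : laurent) :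
  exists a, supp_from a (lcoef f) /\ supp_from a (lcoef g).
Proof.
have [a fa] := lcoef_from f; have [b gb] := lcoef_from g.
exists (Num.min a b); split.
  by apply: supp_from_le fa; rewrite ge_min lexx.
by apply: supp_from_le gb; rewrite ge_min lexx orbT.
Qed.

(** The sum is over [int], but only finitely many terms are nonzero. *)
Definition cauchy_prod (f g : int -> F) (n : int) : F :=
  \sum_(i \in [set: int]) f i * g (n - i).

Definition laurent_trunc (f : int -> F) (a : int) (N : nat) : {poly F} :=
  \poly_(i < N) f (a + i%:Z).

Lemma cauchy_prodE a b f g N k : supp_from a f -> supp_from b g -> (k < N)%N ->
  cauchy_prod f g (a + b + k%:Z) =
    (laurent_trunc f a N * laurent_trunc g b N)`_k.
Proof.
move=> fa gb kN; rewrite coefM /cauchy_prod.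
pose h (i : nat) : int := a + i%:Z.
rewrite -(@fsbig_widen _ _ _ _ (h @` `I_k.+1)) //; last first.
  move=> i [_ hi] /=; have [ia|ai] := ltP i a; first by rewrite fa ?mul0r.
  rewrite [X in _ * X]gb ?mulr0 //.
  have [ik|] := ltP (a + b + k%:Z - i) b => //.
  by move=> ?; case: hi; exists `|i - a|%N => /=; rewrite /h; lia.
rewrite fsbig_image; last by move=> i j _ _; rewrite /h; lia.
rewrite -fsbig_ord; apply: eq_bigr => i _.
have ik := ltn_ord i; rewrite !coef_poly.
rewrite (leq_trans ik) // (leq_ltn_trans (leq_subr _ _)) //.
by congr (_ * g _); rewrite /h; lia.
Qed.

Lemma cauchy_prod_from a b f g : supp_from a f -> supp_from b g ->
  supp_from (a + b) (cauchy_prod f g).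
Proof.
move=> fa gb n nab; rewrite /cauchy_prod fsbig1 // => i _.
have [ia|ai] := ltP i a; first by rewrite fa ?mul0r.
by rewrite [X in _ * X]gb ?mulr0 //; lia.
Qed.

Lemma supp_from_eq a f g : supp_from a f -> supp_from a g ->
  (forall k : nat, f (a + k%:Z) = g (a + k%:Z)) -> f =1 g.
Proof.
move=> fa ga fg n; have [na|na] := ltP n a; first by rewrite fa ?ga.
have -> : n = a + `|n - a|%N%:Z by lia.
exact: fg.
Qed.

Lemma laurent_trunc_prod a b f g N i : supp_from a f -> supp_from b g ->
  (i < N)%N ->
  (laurent_trunc (cauchy_prod f g) (a + b) N)`_i =
    (laurent_trunc f a N * laurent_trunc g b N)`_i.
Proof.
by move=> fa gb iN; rewrite coef_poly iN; exact: cauchy_prodE.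
Qed.

Lemma coefM_trunc (p q p' q' : {poly F}) N k :
  (forall i, (i < N)%N -> p`_i = p'`_i) ->
  (forall i, (i < N)%N -> q`_i = q'`_i) -> (k < N)%N ->
  (p * q)`_k = (p' * q')`_k.
Proof.
move=> pp qq kN; rewrite !coefM; apply: eq_bigr => i _.
have ik := ltn_ord i.
rewrite pp ?qq //; first exact: leq_ltn_trans (leq_subr _ _) kN.
exact: leq_trans ik _.
Qed.

Lemma cauchy_prodA f g h a b c : supp_from a f -> supp_from b g ->
  supp_from c h ->
  cauchy_prod f (cauchy_prod g h) =1 cauchy_prod (cauchy_prod f g) h.
Proof.
move=> fa gb hc; apply: (@supp_from_eq (a + (b + c))).
- exact/cauchy_prod_from/cauchy_prod_from.
- by rewrite addrA; do 2?apply: cauchy_prod_from.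
move=> k; rewrite (@cauchy_prodE _ _ _ _ k.+1 _ fa (cauchy_prod_from gb hc)) //.
rewrite (addrA a) (@cauchy_prodE _ _ _ _ k.+1 _ (cauchy_prod_from fa gb) hc) //.
rewrite (@coefM_trunc _ _ (laurent_trunc f a k.+1)
  (laurent_trunc g b k.+1 * laurent_trunc h c k.+1) k.+1) //; last first.
  by move=> i ik; exact: laurent_trunc_prod.
rewrite mulrA; apply: (@coefM_trunc _ _ _ _ k.+1) => // i ik.
by rewrite laurent_trunc_prod.
Qed.

Lemma cauchy_prodC f g a b : supp_from a f -> supp_from b g ->
  cauchy_prod f g =1 cauchy_prod g f.
Proof.
move=> fa gb; apply: (@supp_from_eq (a + b)); first exact: cauchy_prod_from.
  by rewrite addrC; exact: cauchy_prod_from.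
move=> k; rewrite (@cauchy_prodE _ _ _ _ k.+1 _ fa gb) // mulrC addrC.
by rewrite -(@cauchy_prodE _ _ _ _ k.+1 _ gb fa) // (addrC a b) addrC.
Qed.

Lemma cauchy_prodDl f f' g a b : supp_from a f -> supp_from a f' ->
  supp_from b g ->
  cauchy_prod (f \+ f') g =1 cauchy_prod f g \+ cauchy_prod f' g.
Proof.
move=> fa fa' gb.
have ffa : supp_from a (f \+ f') by move=> n na; rewrite /= fa ?fa' ?addr0.
apply: (@supp_from_eq (a + b)); first exact: cauchy_prod_from.
  by move=> n nab; rewrite /= !(@cauchy_prod_from a b) ?addr0.
move=> k /=; rewrite !(@cauchy_prodE a b _ _ k.+1) // -coefD -mulrDl.
by apply: (@coefM_trunc _ _ _ _ k.+1) => // i ik; rewrite coefD !coef_poly ik.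
Qed.

Definition laurent1 (n : int) : F := (n == 0)%:R.

Lemma laurent1_from : supp_from 0 laurent1.
Proof. by move=> n n0; rewrite /laurent1 lt_eqF. Qed.

Lemma cauchy_prod1 f a : supp_from a f -> cauchy_prod laurent1 f =1 f.
Proof.
move=> fa; apply: (@supp_from_eq a) => //.
  by rewrite -[a]add0r; apply: cauchy_prod_from => //; exact: laurent1_from.
move=> k; rewrite -{1}[a]add0r
  (@cauchy_prodE _ _ _ _ k.+1 _ laurent1_from fa) //.
have -> : laurent_trunc laurent1 0 k.+1 = 1.
  apply/polyP => i; rewrite coef_poly coef1 add0r /laurent1.
  by case: i => [|i] //; rewrite if_same.
by rewrite mul1r coef_poly ltnSn.
Qed.

(** Coefficients of the inverse of [\sum_n u n t^n] when [u 0 != 0]. *)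
Fixpoint inv_coefs (u : nat -> F) (n : nat) : seq F :=
  if n is m.+1 then
    let s := inv_coefs u m in
    rcons s (((m == 0%N)%:R - \sum_(i < m) u i.+1 * s`_(m - i.+1)) / u 0%N)
  else [::].

Lemma size_inv_coefs u n : size (inv_coefs u n) = n.
Proof. by elim: n => //= n IH; rewrite size_rcons IH. Qed.

Definition inv_coef u n := (inv_coefs u n.+1)`_n.

Lemma inv_coefs_nth u n i : (i < n)%N -> (inv_coefs u n)`_i = inv_coef u i.
Proof.
elim: n => // n IH; rewrite ltnS leq_eqVlt => /orP[/eqP->//|i_n] /=.
by rewrite nth_rcons size_inv_coefs i_n IH.
Qed.

Lemma inv_coefP (u : nat -> F) n : u 0%N != 0 ->
  \sum_(i < n.+1) u i * inv_coef u (n - i) = (n == 0%N)%:R.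
Proof.
move=> u0; rewrite big_ord_recl subn0 /inv_coef /=.
rewrite nth_rcons size_inv_coefs ltnn eqxx mulrCA mulfV // mulr1.
rewrite -[RHS](subrK (\sum_(i < n) u i.+1 * (inv_coefs u n)`_(n - i.+1))).
congr (_ + _); apply: eq_bigr => i _; congr (_ * _).
have := ltn_ord i => ik; rewrite inv_coefs_nth; last by lia.
by congr (inv_coef u _); rewrite lift0; lia.
Qed.

Lemma laurent_lead (f : laurent) : (exists n, lcoef f n != 0) ->
  exists2 a, supp_from a (lcoef f) & lcoef f a != 0.
Proof.
move=> [n fn]; have [b fb] := lcoef_from f.
have exk : exists k : nat, lcoef f (b + k%:Z) != 0.
  exists `|n - b|%N; have [nb|nb] := ltP n b; first by rewrite fb ?eqxx in fn.
  by have -> : b + `|n - b|%N%:Z = n by lia.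
exists (b + (ex_minn exk)%:Z); case: ex_minnP => k fk kmin // m mk.
have [mb|bm] := ltP m b; first exact: fb.
apply/eqP/negPn/negP => fm.
have := kmin `|m - b|%N; have -> : b + `|m - b|%N%:Z = m by lia.
by move/(_ fm); lia.
Qed.

Lemma laurent_inv_ex (f : laurent) : (exists n, lcoef f n != 0) ->
  exists g : laurent, cauchy_prod (lcoef g) (lcoef f) =1 laurent1.
Proof.
move=> /laurent_lead[a fa fa0].
pose u (i : nat) := lcoef f (a + i%:Z).
have u0 : u 0%N != 0 by rewrite /u addr0.
pose g (n : int) := if n < - a then 0 else inv_coef u (absz (n + a)).
have ga : supp_from (- a) g by move=> n na; rewrite /g na.
have gP : laurent_set g by exists (- a).
have gf : cauchy_prod g (lcoef f) =1 laurent1.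
  apply: (@supp_from_eq 0); [|exact: laurent1_from|].
    by rewrite -(addNr a); exact: cauchy_prod_from.
  move=> k; rewrite -{1}(addNr a) (@cauchy_prodE _ _ _ _ k.+1) // mulrC coefM.
  rewrite add0r.
  rewrite /laurent1 -[RHS](inv_coefP k u0); apply: eq_bigr => i _.
  have ik := ltn_ord i; rewrite !coef_poly ik (leq_ltn_trans (leq_subr _ _)) //.
  by congr (_ * _); rewrite /g ifF; [congr inv_coef|]; lia.
by exists (laurent_of gP).
Qed.

Lemma laurent_zero_subproof : laurent_set (fun=> 0).
Proof. by exists 0. Qed.

Lemma laurent_one_subproof : laurent_set laurent1.
Proof. by exists 0; exact: laurent1_from. Qed.

Lemma laurent_opp_subproof (f : laurent) : laurent_set (fun n => - lcoef f n).
Proof. by have [a fa] := lcoef_from f; exists a => n /fa ->; rewrite oppr0. Qed.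

Lemma laurent_add_subproof (f g : laurent) :
  laurent_set (fun n => lcoef f n + lcoef g n).
Proof.
have [a [fa ga]] := lcoef_from2 f g.
by exists a => n na; rewrite fa ?ga ?addr0.
Qed.

Lemma laurent_mul_subproof (f g : laurent) :
  laurent_set (cauchy_prod (lcoef f) (lcoef g)).
Proof.
have [a fa] := lcoef_from f; have [b gb] := lcoef_from g.
by exists (a + b); exact: cauchy_prod_from.
Qed.

Definition laurent_zero := laurent_of laurent_zero_subproof.
Definition laurent_one := laurent_of laurent_one_subproof.
Definition laurent_opp f := laurent_of (laurent_opp_subproof f).
Definition laurent_add f g := laurent_of (laurent_add_subproof f g).
Definition laurent_mul f g := laurent_of (laurent_mul_subproof f g).

Lemma laurent_addA : associative laurent_add.
Proof. by move=> f g h; apply: laurent_eqP => n; exact: addrA. Qed.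

Lemma laurent_addC : commutative laurent_add.
Proof. by move=> f g; apply: laurent_eqP => n; exact: addrC. Qed.

Lemma laurent_add0 : left_id laurent_zero laurent_add.
Proof. by move=> f; apply: laurent_eqP => n; exact: add0r. Qed.

Lemma laurent_addN : left_inverse laurent_zero laurent_opp laurent_add.
Proof. by move=> f; apply: laurent_eqP => n; exact: addNr. Qed.

HB.instance Definition _ := GRing.isZmodule.Build laurent
  laurent_addA laurent_addC laurent_add0 laurent_addN.

Lemma laurent_mulA : associative laurent_mul.
Proof.
move=> f g h; apply: laurent_eqP.
have [a fa] := lcoef_from f; have [b gb] := lcoef_from g.
by have [c hc] := lcoef_from h; exact: cauchy_prodA fa gb hc.
Qed.

Lemma laurent_mulC : commutative laurent_mul.
Proof.
move=> f g; apply: laurent_eqP.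
have [a fa] := lcoef_from f; have [b gb] := lcoef_from g.
exact: cauchy_prodC fa gb.
Qed.

Lemma laurent_mul1 : left_id laurent_one laurent_mul.
Proof.
move=> f; apply: laurent_eqP; have [a fa] := lcoef_from f.
exact: cauchy_prod1 fa.
Qed.

Lemma laurent_mulDl : left_distributive laurent_mul +%R.
Proof.
move=> f g h; apply: laurent_eqP.
have [a [fa ga]] := lcoef_from2 f g; have [b hb] := lcoef_from h.
exact: cauchy_prodDl fa ga hb.
Qed.

Lemma laurent_oner_neq0 : laurent_one != 0.
Proof.
apply/eqP => /(congr1 (lcoef^~ 0)) /eqP.
by rewrite [X in X == _]/(laurent1 0) /laurent1 eqxx oner_eq0.
Qed.

HB.instance Definition _ := GRing.Zmodule_isComNzRing.Build laurent
  laurent_mulA laurent_mulC laurent_mul1 laurent_mulDl laurent_oner_neq0.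

Definition laurent_inv (f : laurent) : laurent :=
  if pselect (exists g : laurent, g * f = 1) is left gf
  then projT1 (cid gf) else 0.

Lemma laurent_mulV (f : laurent) : f != 0 -> laurent_inv f * f = 1.
Proof.
move=> f0; rewrite /laurent_inv; case: pselect => [gf|]; first by case: cid.
case; have [n fn] : exists n, lcoef f n != 0.
  apply/not_existsP => H; case/eqP: f0; apply: laurent_eqP => n.
  by apply/eqP/negPn/negP/H.
have [g gf] := laurent_inv_ex (ex_intro _ n fn).
by exists g; exact: laurent_eqP.
Qed.

Lemma laurent_inv0 : laurent_inv 0 = 0.
Proof.
rewrite /laurent_inv; case: pselect => // gf; case: cid => g /= /eqP.
by rewrite mulr0 eq_sym oner_eq0.
Qed.

HB.instance Definition _ :=
  GRing.ComNzRing_isField.Build laurent laurent_mulV laurent_inv0.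

End Laurent.

(** The inverse limit of the rings [Z/n], [n > 0], with [Z/n.+1] represented
    by ['I_n.+1], and the subspace topology of the product of these finite
    discrete spaces. *)
Definition Zhat_set :
  set (prod_topology (fun n => discrete_topology 'I_n.+1)) :=
  [set x : forall n, 'I_n.+1 |
    forall m n, (m.+1 %| n.+1)%N -> x m = inZp (x n)].

Definition Zhat : Type := set_type Zhat_set.

HB.instance Definition _ := Topological.copy Zhat (set_type Zhat_set).

Definition Zhat_fun (a : Zhat) : forall n, 'I_n.+1 := set_val a.

Lemma Zhat_eqP (a b : Zhat) : (forall n, Zhat_fun a n = Zhat_fun b n) -> a = b.
Proof. by move=> ab; apply: val_inj; exact/functional_extensionality_dep. Qed.

Lemma Zhat_funP (a : Zhat) m n :
  (m.+1 %| n.+1)%N -> Zhat_fun a m = inZp (Zhat_fun a n).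
Proof. exact: (set_valP a). Qed.

Definition Zhat_of (x : forall n, 'I_n.+1) (xP : Zhat_set x) : Zhat :=
  SigSub (mem_set xP).

Lemma Zhat_zero_subproof : Zhat_set (fun n => 0).
Proof. by move=> m n _; apply: val_inj; rewrite /= mod0n. Qed.

Lemma Zhat_opp_subproof a : Zhat_set (fun n => - Zhat_fun a n).
Proof.
move=> m n mn; rewrite (Zhat_funP a mn); apply: val_inj => /=.
rewrite modn_dvdm //; set k : nat := Zhat_fun a n.
have kn : (k < n.+1)%N by rewrite /k.
apply/eqP; rewrite -(eqn_modDr (k %% m.+1)) subnK; last first.
  by rewrite ltnW // ltn_pmod.
by rewrite modnn modnDmr subnK ?(ltnW kn) // eq_sym.
Qed.

Lemma Zhat_add_subproof a b : Zhat_set (fun n => Zhat_fun a n + Zhat_fun b n).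
Proof.
move=> m n mn; rewrite (Zhat_funP a mn) (Zhat_funP b mn); apply: val_inj => /=.
by rewrite modn_dvdm // modnDm.
Qed.

Definition Zhat_zero := Zhat_of Zhat_zero_subproof.
Definition Zhat_opp a := Zhat_of (Zhat_opp_subproof a).
Definition Zhat_add a b := Zhat_of (Zhat_add_subproof a b).

Lemma Zhat_addA : associative Zhat_add.
Proof. by move=> a b c; apply: Zhat_eqP => n; exact: addrA. Qed.

Lemma Zhat_addC : commutative Zhat_add.
Proof. by move=> a b; apply: Zhat_eqP => n; exact: addrC. Qed.

Lemma Zhat_add0 : left_id Zhat_zero Zhat_add.
Proof. by move=> a; apply: Zhat_eqP => n; exact: add0r. Qed.

Lemma Zhat_addN : left_inverse Zhat_zero Zhat_opp Zhat_add.
Proof. by move=> a; apply: Zhat_eqP => n; exact: addNr. Qed.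

HB.instance Definition _ :=
  GRing.isZmodule.Build Zhat Zhat_addA Zhat_addC Zhat_add0 Zhat_addN.

Definition Zhat_rhd (a b : Zhat) : Zhat := a *+ 2 - b.

Lemma Zhat_rhdDr a b c :
  Zhat_rhd a (Zhat_rhd b c) = Zhat_rhd (Zhat_rhd a b) (Zhat_rhd a c).
Proof.
rewrite /Zhat_rhd mulrnBl !opprB (mulr2n (a *+ 2)).
by move: (a *+ 2) (b *+ 2) => A B; rewrite [RHS]addrC !addrA subrK (addrC c).
Qed.

Lemma Zhat_rhdxx a : Zhat_rhd a a = a.
Proof. by rewrite /Zhat_rhd mulr2n addrK. Qed.

Lemma Zhat_rhdK a : involutive (Zhat_rhd a).
Proof. by move=> b; rewrite /Zhat_rhd opprB addrC subrK. Qed.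

HB.instance Definition _ :=
  isInvolutoryQuandle.Build Zhat Zhat_rhdDr Zhat_rhdxx Zhat_rhdK.

(* Main.v *)
Require Import Defs.
From HB Require Import structures.
From mathcomp Require Import all_boot all_order all_algebra.
From mathcomp Require Import separable cyclic cyclotomic zify ring.
From mathcomp Require Import all_classical topology.

Set Implicit Arguments.
Unset Strict Implicit.
Unset Printing Implicit Defensive.

Import Order.TTheory GRing.Theory Num.Theory.
Local Open Scope classical_set_scope.
Local Open Scope ring_scope.

(** Suppose that the Galois group of [F] or of [laurent F] contains an
    involution.  By Artin and Schreier the field then has characteristic zero
    ([involution_pchar0]) and every involution inverts the roots of unity
    ([involution_unity]); if there is no involution at all, both sides are
    empty.

    In characteristic zero, with [K] the separable closure of [F], the separable
    closure of [laurent F] embeds into the field [puiseux K] of Puiseux series,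
    which is algebraically closed ([puiseux_algebraically_closed], by Newton and
    Puiseux).  It contains the constants [K] and the roots of [t].  Choose roots
    [t_n] of [t] of degree [n.+1] and primitive roots of unity [z_n] of order
    [n.+1], compatible for varying [n].  An involution [s] maps constants to
    constants, which gives an involution [restriction s] in the Galois group of
    [F], and it multiplies each [t_n] by a power of [z_n]; the exponents form an
    element [angle s] of [Zhat].  The pair determines [s] ([Gal_trivial]), since
    automorphisms preserve integrality over the power series and are therefore
    continuous for the [t]-adic topology, for which the constants and the roots
    of [t] generate a dense subfield.  Conversely, any involution [c] of [K] over
    [F] and any [a] in [Zhat] give the map on Puiseux series which applies [c] to
    the coefficients and multiplies [t_n] by [z_n ^ a]; it is an involution
    because [c] inverts [z_n].  The same fact shows that conjugating by
    involutions acts on angles by [a |> b = 2 a - b].  So [AS iL] and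
    [AS iF * Zhat] are in continuous bijection, and a continuous bijection of
    compact Hausdorff spaces is a homeomorphism.

    On the group side, the free profinite product of two groups of order two is
    the semidirect product of [Zhat], generated by the product of the two
    generators, with one of these groups acting by inversion.  As [Zhat] has no
    2-torsion, its involutions are exactly the reflections [(a, true)], and
    conjugation of reflections is again [2 a - b] ([Invol_free_iso]). *)

(** * Involutions of separably closed fields *)

Definition separably_closed (K : fieldType) : Prop :=
  forall p : {poly K}, separable_poly p -> (1 < size p)%N -> exists x, root p x.

Definition algebraically_closed (K : fieldType) : Prop :=
  forall p : {poly K}, (1 < size p)%N -> exists x, root p x.

Section ArtinSchreier.
Variables (K : fieldType) (s : {rmorphism K -> K}).
Hypotheses (Kc : separably_closed K) (sK : involutive s) (s_id : ~ (s =1 id)).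

Lemma involution_moves : exists x, s x != x.
Proof.
apply/not_existsP => H; apply: s_id => x.
by apply/eqP/negPn/negP/H.
Qed.

(** In characteristic two, some [x] satisfies [s x = x + 1], so [c = x ^ 2 + x]
    is fixed.  A root [w] of the separable equation [w ^ 2 + w = c x] has a
    trace [T = w + s w] with [T ^ 2 + T = c], that is, [T = x] or [T = x + 1];
    but [T] is fixed and [x] is not. *)
Lemma involution_pchar2 : (2%:R : K) != 0.
Proof.
apply/eqP => two0.
have ch2 : 2%N \in [pchar K] by rewrite inE /= two0 eqxx.
have addxx (x : K) : x + x = 0 by rewrite -mulr2n -mulr_natl two0 mul0r.
have ne1 (u : K) : u <> u + 1.
  by move/(congr1 (+%R (- u))); rewrite addKr addNr => /esym/eqP; rewrite oner_eq0.
have [y sy] := involution_moves.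
have z0 : y + s y != 0.
  by apply: contra_neq sy => /(congr1 (+%R^~ (s y))); rewrite -addrA addxx addr0 add0r => <-.
have [x sx] : exists x, s x = x + 1.
  exists (y / (y + s y)); rewrite rmorphM fmorphV rmorphD sK (addrC (s y)) -[X in _ = _ +
    X](divff z0) -mulrDl.
  by congr (_ / _); rewrite addrA addxx add0r.
have [c cE] : exists c, c = x ^+ 2 + x by exists (x ^+ 2 + x).
have sc : s c = c.
  rewrite cE rmorphD rmorphXn sx sqrrD expr1n mulr1 -mulr_natl two0 mul0r addr0.
  by rewrite addrACA addxx addr0.
have [||w] := Kc (p := 'X^2 + 'X + (c * x)%:P).
- rewrite unlock ?derivB ?derivD ?derivC ?derivX ?derivXn -mulr_natl.
  rewrite -polyC_natr two0 polyC0 mul0r add0r addr0.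
  exact: coprimep1.
- by rewrite -addrA size_polyDl ?size_polyXn // size_XaddC.
rewrite rootE !hornerE => /eqP w0.
have wE : w ^+ 2 + w = c * x.
  by rewrite -[RHS]add0r -w0 -addrA addxx addr0.
pose T := w + s w.
have TE : T ^+ 2 + T = c.
  rewrite /T sqrrD -[w * s w *+ 2]mulr_natl two0 mul0r addr0 addrACA wE -rmorphXn -rmorphD wE.
  by rewrite rmorphM sc sx mulrDr addrA addxx add0r mulr1.
have sT : s T = T by rewrite /T rmorphD sK addrC.
have : (x + T) * (x + T + 1) = 0.
  rewrite mulrDr mulr1 -expr2 sqrrD -[x * T *+ 2]mulr_natl two0 mul0r addr0.
  by rewrite addrACA TE -cE addxx.
move=> /eqP; rewrite mulf_eq0 => /orP[]/eqP xT.
  have xE : x = T by rewrite -[RHS]add0r -xT -addrA addxx addr0.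
  by move: sx; rewrite xE sT; exact: ne1.
have xE : x = T + 1 by apply/eqP; rewrite -subr_eq0 oppr_pchar2 // addrA xT.
by move: sx; rewrite xE rmorphD rmorph1 sT; exact: ne1.
Qed.

(** In characteristic different from two, ['X^2 - a] is separable for [a != 0]. *)
Lemma sqrt_exists (a : K) : exists x, x ^+ 2 = a.
Proof.
have [->|a0] := eqVneq a 0; first by exists 0; rewrite expr0n.
have [||x] := Kc (p := 'X^2 - a%:P).
- rewrite unlock ?derivB ?derivD ?derivC ?derivX ?derivXn subr0 -mulr_natl -polyC_natr.
  apply/Bezout_eq1_coprimepP; exists (- (a^-1)%:P, (a^-1 / 2%:R)%:P * 'X) => /=.
  rewrite [X in _ + X](_ : _ = (a^-1)%:P * 'X^2); last first.
    rewrite expr1 mulrACA -polyCM -mulrA mulVf ?involution_pchar2 // mulr1.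
    by rewrite expr2.
  by rewrite mulrBr !mulNr opprK addrAC addNr add0r -polyCM mulVf.
- by rewrite size_XnsubC.
by rewrite rootE !hornerE subr_eq0 => /eqP; exists x.
Qed.

(** Take [d != 0] with [s d = - d] and a square root [x] of [d].  The norm
    [N = x * s x] is fixed and [(N / d) ^ 2 = -1], hence [i] is [N / d] up to
    sign. *)
Lemma involution_sqrtN1 (i : K) : i ^+ 2 = -1 -> s i = - i.
Proof.
move=> i2; have two0 := involution_pchar2.
have [y sy] := involution_moves; pose d := y - s y.
have d0 : d != 0 by rewrite subr_eq0 eq_sym.
have sd : s d = - d by rewrite /d rmorphB sK opprB.
have [x xd] := sqrt_exists d.
pose N := x * s x.
have sN : s N = N by rewrite /N rmorphM sK mulrC.
have N2 : N ^+ 2 = - d ^+ 2 by rewrite exprMn -rmorphXn xd sd mulrN.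
have : (N / d) ^+ 2 = i ^+ 2 by rewrite expr_div_n N2 i2 mulNr divff ?expf_neq0.
move/eqP; rewrite eqf_sqr => /orP[]/eqP Nd.
  by rewrite -Nd rmorphM fmorphV sN sd invrN mulrN.
by rewrite -[i]opprK -Nd rmorphN rmorphM fmorphV sN sd invrN mulrN.
Qed.

Lemma involution_moves_sqrtN1 (i : K) : i ^+ 2 = -1 -> s i != i.
Proof.
move=> i2; rewrite involution_sqrtN1 // -subr_eq0 -opprD oppr_eq0 -mulr2n -mulr_natl mulf_neq0
  ?involution_pchar2 //.
by apply: contra_eq_neq i2 => ->; rewrite expr0n eq_sym oppr_eq0 oner_eq0.
Qed.

(** The norm of a square root of [a + b i] has square [(a + b i) (a - b i)]. *)
Lemma sum_sqr_fixed a b : s a = a -> s b = b ->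
  exists2 c, s c = c & c ^+ 2 = a ^+ 2 + b ^+ 2.
Proof.
move=> sa sb; have [i i2] := sqrt_exists (-1).
have [z zE] := sqrt_exists (a + b * i).
exists (z * s z); first by rewrite rmorphM sK mulrC.
rewrite exprMn -rmorphXn zE rmorphD rmorphM sa sb involution_sqrtN1 // mulrN mulrC -subr_sqr.
by rewrite exprMn i2 mulrN1 opprK.
Qed.

Lemma formally_real a : s a = a -> 1 + a ^+ 2 != 0.
Proof.
move=> sa; apply/eqP => a0.
have a2 : a ^+ 2 = -1 by apply/eqP; rewrite -subr_eq0 opprK addrC a0.
by have := involution_moves_sqrtN1 a2; rewrite sa eqxx.
Qed.

Lemma sum_sqrs_fixed (f : nat -> K) n : (forall j, s (f j) = f j) ->
  exists2 c, s c = c & c ^+ 2 = \sum_(j < n) f j ^+ 2.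
Proof.
move=> sf; elim: n => [|n [c sc cE]].
  by exists 0; rewrite ?rmorph0 // big_ord0 expr0n.
by rewrite big_ord_recr /= -cE; exact: sum_sqr_fixed.
Qed.

(** A positive integer [n] is the square of a fixed element, so [1 + n] does not
    vanish: no fixed element has square [-1]. *)
Lemma involution_pchar0 : [pchar K] =i pred0.
Proof.
apply/pcharf0P => -[|n]; rewrite ?eqxx //=; apply/negbTE.
have [c sc cE] := @sum_sqrs_fixed (fun=> 1) n (fun=> rmorph1 _).
move: cE; under eq_bigr do rewrite expr1n.
rewrite sumr_const card_ord => cE.
by rewrite -add1n natrD -cE formally_real.
Qed.

(** The element [w = z * s z] is the square of a fixed element [v] and
    [w ^ n = 1].  If [w != 1], then [1 + w + ... + w ^ n.-1 = 0] would make
    [-1] a sum of squares of fixed elements. *)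
Lemma involution_unity (z : K) n : (0 < n)%N -> z ^+ n = 1 -> s z = z^-1.
Proof.
case: n => // n _ zn.
have [u uz] := sqrt_exists z; pose v := u * s u.
have sv : s v = v by rewrite /v rmorphM sK mulrC.
pose w := z * s z.
have wv : w = v ^+ 2 by rewrite /v exprMn -rmorphXn uz.
have wn : w ^+ n.+1 = 1 by rewrite exprMn -rmorphXn zn rmorph1 mulr1.
have [c sc cE] : exists2 c, s c = c & c ^+ 2 = \sum_(j < n) (v ^+ j.+1) ^+ 2.
  by apply: (@sum_sqrs_fixed (fun j => v ^+ j.+1)) => j; rewrite rmorphXn sv.
have: (w - 1) * (1 + c ^+ 2) = 0.
  rewrite -[RHS](subrr 1) -[X in _ = X - _]wn subrX1 big_ord_recl expr0 cE; congr (_ * (_ + _)).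
  by apply: eq_bigr => j _; rewrite wv -!exprM mulnC.
move/eqP; rewrite mulf_eq0 (negPf (formally_real sc)) orbF subr_eq0 => /eqP w1.
have z0 : z != 0 by apply: contra_eq_neq zn => ->; rewrite expr0n eq_sym oner_eq0.
by apply: (mulfI z0); rewrite divff.
Qed.

End ArtinSchreier.

(** * Compact zero-dimensional spaces *)

Lemma zero_dimensional_hausdorff (T : topologicalType) :
  zero_dimensional T -> hausdorff_space T.
Proof.
move=> zT x y xy; apply: contrapT => /eqP /zT[U [[oU cU] Ux nUy]].
have [] := xy U (~` U); first exact: open_nbhs_nbhs.
  by apply: open_nbhs_nbhs; split => //; exact: closed_openC.
by move=> z [].
Qed.

Lemma zero_dimensional_profinite (T : topologicalType) :
  compact [set: T] -> zero_dimensional T -> profinite_space T.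
Proof.
move=> cT zT; split => //; first exact: zero_dimensional_hausdorff.
exact: zero_dimension_totally_disconnected.
Qed.

Lemma zero_dimensional_inj (X Y : topologicalType) (f : X -> Y) :
  continuous f -> injective f -> zero_dimensional Y -> zero_dimensional X.
Proof.
move=> fc fi zY x y xy; have /zY[U [cU Ux Uy]] : f x != f y.
  by apply: contra_neq xy => /fi.
by exists (f @^-1` U); split => //; apply: preimage_clopen.
Qed.

Lemma compact_inverse_continuous (X Y : topologicalType) (f : X -> Y) g :
  compact [set: X] -> hausdorff_space Y -> continuous f ->
  cancel f g -> cancel g f -> continuous g.
Proof.
move=> cX hY fc fg gf; apply/continuous_closedP => A cA.
have -> : g @^-1` A = f @` A.
  rewrite eqEsubset; split => [y Agy|_ [x Ax <-]]; first by exists (g y).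
  by rewrite /preimage /= fg.
apply: compact_closed => //; apply: continuous_compact; first exact: continuous_subspaceT.
exact: subclosed_compact cA cX _.
Qed.

Lemma set_val_continuous (X : topologicalType) (A : set X) :
  continuous (set_val : set_type A -> X).
Proof. exact: initial_continuous. Qed.

Lemma continuous_set_type (X Y : topologicalType) (A : set Y)
    (f : X -> set_type A) : continuous (set_val \o f) -> continuous f.
Proof.
move=> /continuousP fc; apply/continuousP => _ [U oU <-].
by rewrite -comp_preimage; exact: fc.
Qed.

Lemma set_type_compact (X : topologicalType) (A : set X) :
  compact A -> compact [set: set_type A].
Proof.
move=> cA F FF _.
have [|p [Ap Fp]] := cA (set_val @ F) _.
  by apply: (@filterE _ F) => u; exact: set_valP.
exists (SigSub (mem_set Ap)); split => // B C FB [_ [[U oU <-] /= Up UC]].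
have [||_ [[u Bu <-] Uu]] := Fp (set_val @` B) U.
- by apply: (@filterS _ F _ B) => // u Bu; exists u.
- exact: open_nbhs_nbhs.
by exists u; split => //; exact: UC.
Qed.

Lemma continuous_prod (X : topologicalType) (I : Type) (T : I -> topologicalType)
    (f : X -> prod_topology T) :
  (forall i, continuous (fun x => f x i)) -> continuous f.
Proof.
move=> fc x; apply/cvg_sup => i U [_ [[V oV <-] Vx] VU].
apply: (@filterS _ (nbhs x) _ (f @^-1` ((fun g => g i) @^-1` V))).
  by move=> y Vy; exact: VU.
by apply: (fc i x V); exact: open_nbhs_nbhs.
Qed.

Lemma proj_continuousT (I : eqType) (T : I -> topologicalType) i :
  continuous (fun f : prod_topology T => f i).
Proof. exact: proj_continuous. Qed.

Lemma continuous_pair (X Y Z : topologicalType) (f : X -> Y) (g : X -> Z) :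
  continuous f -> continuous g -> continuous (fun x => (f x, g x)).
Proof. by move=> fc gc x; apply: cvg_pair; [exact: fc|exact: gc]. Qed.

Lemma continuous_locally (X Y : topologicalType) (f : X -> Y) :
  (forall x, \forall y \near x, f y = f x) -> continuous f.
Proof.
move=> fl x U Ux; apply: filterS (fl x) => y /= -> .
exact: nbhs_singleton.
Qed.

Lemma locally_continuous (X : topologicalType) (Y : choiceType)
    (f : X -> discrete_topology Y) x :
  continuous f -> \forall y \near x, f y = f x.
Proof.
move=> fc; apply: (fc x [set z | z = f x]).
by rewrite /= nbhs_principalE => z ->.
Qed.

Lemma prod_discrete_zero_dimensional (I : choiceType) (T : I -> choiceType) :
  zero_dimensional (prod_topology (fun i => discrete_topology (T i))).
Proof. by apply: zero_dimension_prod => i; exact: discrete_zero_dimension. Qed.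

Lemma prod_zero_dimensional (X Y : topologicalType) :
  zero_dimensional X -> zero_dimensional Y -> zero_dimensional (X * Y)%type.
Proof.
move=> zX zY [x y] [x' y'] /=; rewrite xpair_eqE negb_and => /orP[/zX|/zY][U [cU Ux Uy]].
  exists (fst @^-1` U); split => //; apply: preimage_clopen => //.
  by move=> ?; exact: cvg_fst.
exists (snd @^-1` U); split => //; apply: preimage_clopen => //.
by move=> ?; exact: cvg_snd.
Qed.

(** In a compact Hausdorff space the intersection of the clopen sets that
    contain a point is connected. *)
Lemma totally_disconnected_zero_dimensional (T : topologicalType) :
  profinite_space T -> zero_dimensional T.
Proof.
move=> [cT hT tdT] x y xy; apply: contrapT => noU.
pose Q := \bigcap_(D in [set D : set T | clopen D /\ D x]) D.
have Qx : Q x by move=> D [].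
have Qy : Q y.
  by move=> D [cD Dx]; apply: contrapT => nDy; apply: noU; exists D.
have cQ : closed Q by apply: closed_bigI => D [[]].
have key B B' : closed B -> closed B' -> Q = B `|` B' -> B `&` B' = set0 ->
    B x -> Q `<=` B.
  move=> cB cB' QB BB' Bx.
  (* The space is normal, so the two parts of [Q] have disjoint neighbourhoods;
     by compactness some clopen [D] around [x] lies in their union, and cutting
     it by one of them is again clopen. *)
  have [U [V [oU oV BU BV UV]]] : exists U V : set T,
      [/\ open U, open V, B `<=` U, B' `<=` V & U `&` V = set0].
    have [C CB clC] : filter_from (set_nbhs B) closure (~` B').
      apply: (compact_normal hT cT cB) => z Bz; apply: open_nbhs_nbhs; split;
        first exact: closed_openC.
      by move=> B'z; have : (B `&` B') z by []; rewrite BB'.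
    exists C^°, (~` closure C); split.
    - exact: open_interior.
    - by apply: closed_openC; exact: closed_closure.
    - by move=> z /CB; rewrite /interior /=.
    - by move=> z B'z /clC; exact.
    by rewrite eqEsubset; split => // z [/interior_subset Cz]; apply; exact: subset_closure.
  suff [D [[oD clD] Dx DUV]] : exists D : set T, [/\ clopen D, D x & D `<=` U `|` V].
    have cDU : clopen (D `&` U).
      split; first exact: openI.
      have -> : D `&` U = D `&` ~` V.
        rewrite eqEsubset; split => z [Dz Uz]; split => //.
          by move=> Vz; have : (U `&` V) z by []; rewrite UV.
        by have [] := DUV _ Dz.
      by apply: closedI => //; exact: open_closedC.
    move=> z Qz; have [_ Uz] : (D `&` U) z by apply: Qz; split => //; split => //; exact: BU.
    move: Qz; rewrite QB => -[//|/BV Vz].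
    by have : (U `&` V) z by []; rewrite UV.
  apply: contrapT => noD.
  pose F := filter_from [set D : set T | clopen D /\ D x] (fun D => D `&` ~` (U `|` V)).
  have FF : Filter F.
    apply: filter_from_filter.
      by exists setT; split => //; exact: clopenT.
    move=> D E [cD Dx] [cE Ex]; exists (D `&` E); first by split => //; exact: clopenI.
    by move=> z [[Dz Ez] nz].
  have PF : ProperFilter F.
    apply: filter_from_proper => D [cD Dx]; apply: contrapT => nD.
    apply: noD; exists D; split => // z Dz; apply: contrapT => nz.
    by apply: nD; exists z.
  have cc : compact (~` (U `|` V)).
    by apply: subclosed_compact cT _ => //; apply: open_closedC; exact: openU.
  have [|p [nUVp Fp]] := cc F PF.
    by exists setT; [split => //; exact: clopenT|move=> z []].
  have : Q p.
    move=> D [[oD cD] Dx]; apply: (cD) => W Wp.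
    have [|z [[Dz _] Wz]] := Fp (D `&` ~` (U `|` V)) W _ Wp; first by exists D => //; split.
    by exists z.
  by rewrite QB => -[/BU|/BV] ?; apply: nUVp; [left|right].
suff coQ : connected Q.
  have : connected_component [set: T] x y by exists Q.
  by rewrite tdT // => yx; rewrite yx eqxx in xy.
move=> B [b Bb] [O oO BO] [C cC BC].
have cB : closed B by rewrite BC; exact: closedI.
have cB' : closed (Q `&` ~` B).
  have -> : Q `&` ~` B = Q `&` ~` O.
    by rewrite BO setCI setIUr setICr set0U.
  by apply: closedI => //; exact: open_closedC.
have BQ : B `<=` Q by rewrite BC => z [].
have QE : Q = B `|` (Q `&` ~` B) by rewrite setUIr setUCr setIT; apply/esym/setUidPr.
have [Bx|nBx] := pselect (B x).
  rewrite eqEsubset; split => //; apply: (key _ _ cB cB' QE) => //.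
  by rewrite setICA setICr setI0.
have /(_ b) [] // : Q `<=` Q `&` ~` B.
  apply: (key _ _ cB' cB) => //; first by rewrite setUC.
  by rewrite -setIA setICl setI0.
exact: BQ.
Qed.

(** Tychonoff's theorem for finite discrete factors.  Galois groups and spaces of
    embeddings lie in such sets, with the conjugates of [x] for [R x]. *)
Lemma pointwise_finite_compact (X : eqType) (Y : choiceType) (R : X -> seq Y) :
  compact [set f : {ptws X -> discrete_topology Y} | forall x, f x \in R x].
Proof.
apply: (@tychonoff X (fun=> discrete_topology Y) (fun x => [set` R x])) => x.
by apply: finite_compact; exact: finite_seq.
Qed.

(** * Open normal subgroups of a profinite group *)

Section OpenNormal.
Variable G : topGroupType.
Hypothesis Gp : profinite_group G.
Local Open Scope group_scope.

Lemma group_zero_dimensional : zero_dimensional G.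
Proof. by case: Gp => Gs _ _; exact: totally_disconnected_zero_dimensional. Qed.

Lemma continuous_mulg (X : topologicalType) (f g : X -> G) :
  continuous f -> continuous g -> continuous (fun x => f x * g x).
Proof.
case: Gp => _ mc _ fc gc x.
apply: (@continuous_comp _ _ _ (fun x => (f x, g x)) (fun p => p.1 * p.2)).
  exact: continuous_pair.
exact: mc.
Qed.

Lemma continuous_invg (X : topologicalType) (f : X -> G) :
  continuous f -> continuous (fun x => (f x)^-1).
Proof.
case: Gp => _ _ ic fc x.
by apply: (@continuous_comp _ _ _ f (fun p => p^-1)); [exact: fc|exact: ic].
Qed.

Definition open_normal (U : set G) : Prop :=
  [/\ nbhs 1 U, forall x y, U x -> U y -> U (x * y),
      forall x, U x -> U x^-1 & forall h x, U x -> U (h * x * h^-1)].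

(** Let [D] be a clopen neighbourhood of [1] inside [V].  The elements whose
    conjugates all translate [D] into itself are closed under products and
    conjugation, and lie in [D].  They form a neighbourhood of [1] because the
    pairs (conjugating element, point of [D]) range over a compact set. *)
Lemma open_normal_basis (V : set G) :
  nbhs 1 V -> exists2 U, open_normal U & U `<=` V.
Proof.
move=> V1; have [cG hG _] : profinite_space G by case: Gp.
have [D [D1 [oD clD]] DV] :=
  @zero_dimensional_cvg _ (1 : G) hG group_zero_dimensional cG V V1.
pose P (g : G) (p : G * G) := D p.2 -> D (p.1^-1 * g * p.1 * p.2).
have nP : \forall g \near (1 : G), forall p, P g p.
  have cGG : compact [set: G * G].
    by rewrite -setXTT; exact: compact_setX.
  suff : \forall g \near (1 : G), [set: G * G] `<=` P g.
    by apply: filterS => g Pg p; exact: Pg.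
  move/compact_near_coveringP : cGG => /(_ G (nbhs (1 : G)) P); apply => -[h v] _.
  have [Dv|nDv] := pselect (D v); last first.
    exists (snd @^-1` (~` D), setT) => [|[[h' v'] g]] /=.
      split; last exact: filterT.
      apply: (@cvg_snd _ _ (nbhs h) (nbhs v)).
      by apply: open_nbhs_nbhs; split => //; exact: closed_openC.
    by move=> [nDv' _] /nDv'.
  pose f (q : (G * G) * G) := q.1.1^-1 * q.2 * q.1.1 * q.1.2.
  have fc : continuous f.
    have c11 : continuous (fun q : (G * G) * G => q.1.1).
      by move=> q; apply: (@continuous_comp _ _ _ fst fst); exact: cvg_fst.
    have c12 : continuous (fun q : (G * G) * G => q.1.2).
      by move=> q; apply: (@continuous_comp _ _ _ fst snd); [exact: cvg_fst|exact: cvg_snd].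
    have c2 : continuous (fun q : (G * G) * G => q.2) by move=> q; exact: cvg_snd.
    do 3![apply: continuous_mulg => //]; exact: continuous_invg.
  have : nbhs ((h, v), (1 : G)) (f @^-1` D).
    apply: fc; apply: open_nbhs_nbhs; split => //.
    by rewrite /f /= mulg1 mulVg mul1g.
  by apply: filterS => -[[h' v'] g] /= Dg _.
have PM x y : (forall p, P x p) -> (forall p, P y p) -> forall p, P (x * y) p.
  move=> Px Py [h v] Dv; have := Px (h, h^-1 * y * h * v) (Py (h, v) Dv).
  by rewrite /P /= !mulgA mulgK.
have PJ k x : (forall p, P x p) -> forall p, P (k * x * k^-1) p.
  move=> Px [h v] Dv; have := Px (k^-1 * h, v) Dv.
  by rewrite /P /= invgM invgK !mulgA.
exists [set g | (forall p, P g p) /\ (forall p, P g^-1 p)].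
  split.
  - apply: filterI => //.
    have [_ _ ic] := Gp; apply: (ic 1 [set x | forall p, P x p]).
    by rewrite /= invg1.
  - by move=> x y [Px Px'] [Py Py']; split; rewrite /= ?invgM; exact: PM.
  - by move=> x [Px Px']; split; rewrite /= ?invgK.
  - move=> k x [Px Px']; split; rewrite /=; first exact: PJ.
    by rewrite !invgM invgK mulgA; exact: PJ.
move=> g [Pg _]; apply: DV; have := Pg (1, 1) D1.
by rewrite /P /= invg1 mul1g !mulg1.
Qed.

Lemma nbhs_coset (U : set G) (y : G) : nbhs 1 U -> nbhs y [set z | U (y^-1 * z)].
Proof.
move=> U1; have c : continuous (fun z : G => y^-1 * z).
  by apply: continuous_mulg; [exact: cst_continuous|move=> z; exact: cvg_id].
by apply: (c y U); rewrite mulVg.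
Qed.

Lemma coset_nbhs (V : set G) (y : G) : nbhs y V ->
  exists2 U, open_normal U & forall z, U (y^-1 * z) -> V z.
Proof.
move=> Vy; have [|U Un UV] := @open_normal_basis [set z | V (y * z)].
  have c : continuous (fun z : G => y * z).
    by apply: continuous_mulg; [exact: cst_continuous|move=> z; exact: cvg_id].
  by apply: (c 1 V); rewrite mulg1.
by exists U => // z /UV /=; rewrite mulVKg.
Qed.

Section Congruence.
Variable U : set G.
Hypothesis Un : open_normal U.

Definition eqmodg (x y : G) : Prop := U (x^-1 * y).

Lemma eqmodg_refl (x : G) : eqmodg x x.
Proof. by case: Un => U1 _ _ _; rewrite /eqmodg mulVg; exact: nbhs_singleton. Qed.

Lemma eqmodg_sym x y : eqmodg x y -> eqmodg y x.
Proof. by case: Un => _ _ UV _ /UV; rewrite /eqmodg invgM invgK. Qed.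

Lemma eqmodg_trans y x z : eqmodg x y -> eqmodg y z -> eqmodg x z.
Proof.
case: Un => _ UM _ _ xy yz; have := UM _ _ xy yz.
by rewrite /eqmodg -mulgA mulVKg.
Qed.

Lemma eqmodgM x y x' y' : eqmodg x y -> eqmodg x' y' -> eqmodg (x * x') (y * y').
Proof.
case: Un => _ UM _ UJ xy xy'; have := UM _ _ (UJ x'^-1 _ xy) xy'.
by rewrite /eqmodg invgK invgM !mulgA mulgK.
Qed.

Lemma eqmodgV x y : eqmodg x y -> eqmodg x^-1 y^-1.
Proof.
case: Un => _ _ UV UJ /UV /(UJ y); rewrite /eqmodg invgM !invgK.
by rewrite !mulgA mulgV mul1g.
Qed.

(** The powers of [x] accumulate somewhere by compactness, and two powers in the
    same coset of [U] differ by a power in [U]. *)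
Lemma open_normal_exponent (x : G) : exists m : nat, U (x ^+ m.+1).
Proof.
have [[cG _ _] _ _] := Gp; have [U1 UM UV _] := Un.
have [p [_ Fp]] := cG ((fun n => x ^+ n) @ \oo) _ filterT.
have key (N : nat) : exists2 n, (N <= n)%N & U (p^-1 * x ^+ n).
  have [|_ [[n Nn <-] Upn]] := Fp [set x ^+ n | n in [set n | (N <= n)%N]] _ _ (nbhs_coset p U1).
    by exists N => // n Nn; exists n.
  by exists n.
have [i _ Ui] := key 0%N; have [j ij Uj] := key i.+1.
exists (j - i).-1; rewrite prednK ?subn_gt0 //.
have := UM _ _ (UV _ Ui) Uj.
by rewrite invgM invgK -mulgA mulVKg -{1}(subnKC (ltnW ij)) expgnDr mulKg.
Qed.

Lemma eqmodg_expg (x : G) (m i j : nat) : U (x ^+ m.+1) -> i = j %[mod m.+1] ->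
  eqmodg (x ^+ i) (x ^+ j).
Proof.
move=> Um; wlog ij : i j / (i <= j)%N => [wl|] e.
  by have [/wl|/ltnW/wl H] := leqP i j; [exact|apply: eqmodg_sym; exact: H].
have /dvdnP[q jE] : (m.+1 %| j - i)%N by rewrite -eqn_mod_dvd //; apply/eqP.
rewrite -[j](subnKC ij) jE expgnDr /eqmodg mulKg mulnC expgnA.
have [U1 UM _ _] := Un.
by elim: q {jE} => [|q IH]; [exact: nbhs_singleton|rewrite expgS; exact: UM].
Qed.

End Congruence.

Lemma eqmodg_eq (x y : G) : (forall U, open_normal U -> eqmodg U x y) -> x = y.
Proof.
move=> H; apply: contrapT => /eqP /group_zero_dimensional[V [[oV _] Vx nVy]].
have [U Un UV] := coset_nbhs (open_nbhs_nbhs (conj oV Vx)).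
by apply: nVy; apply: UV; exact: H.
Qed.

End OpenNormal.

(** * Profinite integers as a space and as exponents *)

Section ZhatTopology.

Lemma Zhat_fun_near (a : Zhat) n : \forall b \near a, Zhat_fun b n = Zhat_fun a n.
Proof.
apply: (@locally_continuous Zhat 'I_n.+1 (fun a => Zhat_fun a n)) => b.
exact: (@continuous_comp Zhat (prod_topology (fun n => discrete_topology 'I_n.+1))
  (discrete_topology 'I_n.+1) set_val (fun f => f n) b
  (@set_val_continuous _ Zhat_set b) (@proj_continuousT _ _ n _)).
Qed.

Lemma continuous_Zhat (X : topologicalType) (f : X -> Zhat) :
  (forall n x, \forall y \near x, Zhat_fun (f y) n = Zhat_fun (f x) n) ->
  continuous f.
Proof.
move=> fl; apply: continuous_set_type; apply: continuous_prod => n.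
by apply: continuous_locally => x; exact: fl.
Qed.

Lemma Zhat_zero_dimensional : zero_dimensional Zhat.
Proof.
apply: (@zero_dimensional_inj _ _ (@set_val _ Zhat_set));
  last exact: prod_discrete_zero_dimensional.
  exact: set_val_continuous.
exact: val_inj.
Qed.

Lemma Zhat_compact : compact [set: Zhat].
Proof.
apply: set_type_compact.
have cT : compact [set: prod_topology (fun n => discrete_topology 'I_n.+1)].
  have := @tychonoff nat (fun n => discrete_topology 'I_n.+1) (fun=> setT).
  rewrite (_ : [set f | _] = setT); last by rewrite eqEsubset; split.
  by apply => n; apply: finite_compact; exact: finite_finset.
apply: subclosed_compact cT _ => //.
rewrite (_ : Zhat_set = \bigcap_m \bigcap_(n in [set n | (m.+1 %| n.+1)%N])
  [set x : prod_topology (fun n => discrete_topology 'I_n.+1) | x m = inZp (x n)]); last first.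
  by rewrite eqEsubset; split => [x xP m _ n mn|x xP m n mn]; [exact: xP|exact: (xP m)].
apply: closed_bigI => m _; apply: closed_bigI => n _.
rewrite -[X in closed X]setCK; apply: open_closedC; rewrite openE => x xmn.
have cx k : \forall y \near x, y k = x k.
  by apply: locally_continuous; exact: (@proj_continuousT nat (fun n => discrete_topology 'I_n.+1)).
near=> y; rewrite /= => e; apply: xmn => /=.
by rewrite -(near (cx m) y) // -(near (cx n) y).
Unshelve. all: by end_near. Qed.

Lemma Zhat_profinite : profinite_space Zhat.
Proof. exact: zero_dimensional_profinite Zhat_compact Zhat_zero_dimensional. Qed.

Lemma continuous_Zhat_add (X : topologicalType) (f g : X -> Zhat) :
  continuous f -> continuous g -> continuous (fun x => f x + g x).
Proof.
move=> fc gc; apply: continuous_Zhat => n x.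
have fn := fc x _ (Zhat_fun_near (f x) n); have gn := gc x _ (Zhat_fun_near (g x) n).
near=> y; rewrite /Zhat_fun /=; congr (_ + _).
  by near: y; exact: fn.
by near: y; exact: gn.
Unshelve. all: by end_near. Qed.

Lemma continuous_Zhat_opp (X : topologicalType) (f : X -> Zhat) :
  continuous f -> continuous (fun x => - f x).
Proof.
move=> fc; apply: continuous_Zhat => n x.
have fn := fc x _ (Zhat_fun_near (f x) n).
near=> y; rewrite /Zhat_fun /=; congr (- _).
by near: y; exact: fn.
Unshelve. all: by end_near. Qed.

Lemma profinite_quandle_Zhat : profinite_quandle Zhat.
Proof.
split; first exact: Zhat_profinite.
apply: (@continuous_Zhat_add (Zhat * Zhat)%type (fun p => p.1 *+ 2) (fun p => - p.2)).
  by apply: continuous_Zhat_add => p; exact: cvg_fst.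
by apply: continuous_Zhat_opp => p; exact: cvg_snd.
Qed.

Lemma Zhat_funD (a b : Zhat) n :
  Zhat_fun (a + b) n = ((Zhat_fun a n + Zhat_fun b n) %% n.+1)%N :> nat.
Proof. by []. Qed.

Lemma Zhat_torsion_free (a : Zhat) : a + a = 0 -> a = 0.
Proof.
move=> aa; apply: Zhat_eqP => n; apply: val_inj.
(* Doubling is injective from residues mod [n.+1] to residues mod [2 * n.+1]. *)
have dn : (n.+1 %| (n.*2.+1).+1)%N.
  by apply/dvdnP; exists 2%N; rewrite mul2n doubleS.
rewrite (Zhat_funP a dn) /=.
have /(congr1 (fun c => Zhat_fun c (n.*2.+1) : nat)) := aa.
rewrite Zhat_funD addnn /= => /eqP.
move: (nat_of_ord _) => k.
by rewrite -doubleS -!muln2 -muln_modl muln_eq0 orbF => /eqP.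
Qed.

End ZhatTopology.

Section ProfinitePower.
Variable G : topGroupType.
Hypothesis Gp : profinite_group G.
Local Open Scope group_scope.
Variable x : G.

(** The required [y] is an accumulation point of the powers of [x] with exponent
    congruent to [a] modulo [m.+1], as [m.+1] grows in the order of
    divisibility. *)
Lemma profinite_power_ex (a : Zhat) : exists y : G, forall U m, open_normal U ->
  U (x ^+ m.+1) -> eqmodg U (x ^+ Zhat_fun a m) y.
Proof.
pose S m : set G := [set x ^+ k | k in [set k | k = Zhat_fun a m %[mod m.+1]]].
have [[cG _ _] _ _] := Gp.
have SM m n : (m.+1 %| n.+1)%N -> S n `<=` S m.
  move=> mn _ [k kE <-]; exists k => //=.
  rewrite (Zhat_funP a mn) /= modn_mod -(modn_dvdm k mn) kE (modn_dvdm _ mn) //.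
pose F := filter_from setT S.
have FF : Filter F.
  apply: filter_fromT_filter; first by exists 0%N.
  move=> m n; exists (m.+1 * n.+1).-1; rewrite subsetI; split; apply: SM.
    by rewrite prednK // dvdn_mulr.
  by rewrite prednK // dvdn_mull.
have PF : ProperFilter F.
  by apply: filter_from_proper => m _; exists (x ^+ Zhat_fun a m); exists (Zhat_fun a m).
have [y [_ Fy]] := cG F PF filterT.
exists y => U m Un Um.
have [_ [[k kE <-] Uk]] := Fy (S m) _ (ex_intro2 _ _ m I (@subset_refl _ _)) (nbhs_coset Gp y
  (let: And4 U1 _ _ _ := Un in U1)).
apply: (eqmodg_trans Un (y := x ^+ k)).
  by apply: (eqmodg_expg Un Um); rewrite kE.
exact: eqmodg_sym.
Qed.

(** [x ^ a] for [a] in [Zhat]: the limit of the powers of [x] whose exponents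
    tend to [a]. *)
Definition profinite_power (a : Zhat) : G := projT1 (cid (profinite_power_ex a)).

Lemma profinite_powerE a U m : open_normal U -> U (x ^+ m.+1) ->
  eqmodg U (x ^+ Zhat_fun a m) (profinite_power a).
Proof. exact: (projT2 (cid (profinite_power_ex a))). Qed.

Lemma profinite_powerD a b :
  profinite_power (a + b)%R = profinite_power a * profinite_power b.
Proof.
apply: (eqmodg_eq Gp) => U Un; have [m Um] := open_normal_exponent Gp Un x.
apply: (eqmodg_trans Un _ (eqmodgM Un (profinite_powerE a Un Um) (profinite_powerE b Un Um))).
apply: (eqmodg_trans Un (eqmodg_sym Un (profinite_powerE (a + b)%R Un Um))).
by rewrite -expgnDr; apply: (eqmodg_expg Un Um); rewrite Zhat_funD modn_mod.
Qed.

Lemma profinite_power0 : profinite_power 0%R = 1.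
Proof.
have := profinite_powerD 0%R 0%R; rewrite addr0 => /(congr1 (fun y => (profinite_power 0%R)^-1 *
  y)).
by rewrite mulVg mulKg => <-.
Qed.

Lemma profinite_power_invert (s : G) a : s * x * s^-1 = x^-1 ->
  s * profinite_power a * s^-1 = profinite_power (- a)%R.
Proof.
move=> sx; have -> : profinite_power (- a)%R = (profinite_power a)^-1.
  apply: (mulgI (profinite_power a)).
  by rewrite -profinite_powerD subrr profinite_power0 mulgV.
apply: (eqmodg_eq Gp) => U Un; have [m Um] := open_normal_exponent Gp Un x.
have pa := profinite_powerE a Un Um.
apply: (eqmodg_trans Un _ (eqmodgV Un pa)).
have -> : (x ^+ Zhat_fun a m)^-1 = s * x ^+ Zhat_fun a m * s^-1.
  elim: (nat_of_ord (Zhat_fun a m)) => [|k IH]; first by rewrite mulg1 mulgV invg1.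
  by rewrite {1}expgSr invgM IH -sx expgS !mulgA mulgVK.
apply: (eqmodgM Un _ (eqmodg_refl Un _)); apply: (eqmodgM Un (eqmodg_refl Un _)).
exact: eqmodg_sym.
Qed.

Lemma continuous_profinite_power : continuous profinite_power.
Proof.
move=> a V /(coset_nbhs Gp)[U Un UV].
have [m Um] := open_normal_exponent Gp Un x.
apply: filterS (Zhat_fun_near a m) => b /= ba; apply: UV.
apply: (eqmodg_trans Un (eqmodg_sym Un (profinite_powerE a Un Um))).
by rewrite -ba; exact: profinite_powerE.
Qed.

End ProfinitePower.

(** * Isomorphisms of profinite quandles *)

Section QuandleIso.
Variables (Q Q' : topInvolutoryQuandleType) (f : Q -> Q') (g : Q' -> Q).
Hypotheses (fg : cancel f g) (gf : cancel g f).

Lemma quandle_morphism_inverse :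
  continuous g -> quandle_morphism f -> quandle_morphism g.
Proof. by move=> gc [_ fM]; split => // x y; rewrite -[RHS]fg fM !gf. Qed.

Lemma profinite_quandle_transport : quandle_morphism f -> continuous g ->
  profinite_quandle Q' -> profinite_quandle Q.
Proof.
move=> [fc fM] gc [[cQ hQ tQ] rQ]; split.
  apply: zero_dimensional_profinite.
    rewrite (_ : [set: Q] = g @` setT); last first.
      by rewrite eqEsubset; split => // x _; exists (f x).
    by apply: continuous_compact => //; exact: continuous_subspaceT.
  apply: (zero_dimensional_inj fc (can_inj fg)).
  exact: totally_disconnected_zero_dimensional.
have -> : (fun p : Q * Q => rhd p.1 p.2) =
    g \o (fun p : Q' * Q' => rhd p.1 p.2) \o (fun p => (f p.1, f p.2)).
  by apply/funext => p /=; rewrite -fM fg.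
move=> p; apply: continuous_comp; last by apply: continuous_comp; [exact: rQ|exact: gc].
by apply: continuous_pair => q; apply: continuous_comp; (try exact: fc);
  [exact: cvg_fst|exact: cvg_snd].
Qed.

Lemma profinite_quandle_iso_inverse : quandle_morphism f -> continuous g ->
  profinite_quandle Q' -> profinite_quandle_iso Q Q'.
Proof.
move=> fm gc pQ'; split => //; first exact: profinite_quandle_transport.
by exists f, g; split => //; exact: quandle_morphism_inverse.
Qed.

End QuandleIso.

Lemma profinite_quandle_prod (Q Q' : topInvolutoryQuandleType) :
  profinite_quandle Q -> profinite_quandle Q' ->
  profinite_quandle (Q * Q')%type.
Proof.
move=> [sQ rQ] [sQ' rQ']; split.
  apply: zero_dimensional_profinite.
    by rewrite -setXTT; apply: compact_setX; [case: sQ|case: sQ'].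
  by apply: prod_zero_dimensional; exact: totally_disconnected_zero_dimensional.
pose T := ((Q * Q') * (Q * Q'))%type.
have c11 : continuous (fun q : T => q.1.1).
  by move=> q; apply: (@continuous_comp _ _ _ fst fst); exact: cvg_fst.
have c12 : continuous (fun q : T => q.1.2).
  by move=> q; apply: (@continuous_comp _ _ _ fst snd); [exact: cvg_fst|exact: cvg_snd].
have c21 : continuous (fun q : T => q.2.1).
  by move=> q; apply: (@continuous_comp _ _ _ snd fst); [exact: cvg_snd|exact: cvg_fst].
have c22 : continuous (fun q : T => q.2.2).
  by move=> q; apply: (@continuous_comp _ _ _ snd snd); exact: cvg_snd.
apply: (@continuous_pair T Q Q' (fun p => rhd p.1.1 p.2.1) (fun p => rhd p.1.2 p.2.2)).
  move=> q; apply: (@continuous_comp _ _ _ (fun q : T => (q.1.1, q.2.1)) (fun p => rhd p.1 p.2)).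
    exact: continuous_pair.
  exact: rQ.
move=> q; apply: (@continuous_comp _ _ _ (fun q : T => (q.1.2, q.2.2)) (fun p => rhd p.1 p.2)).
  exact: continuous_pair.
exact: rQ'.
Qed.

Lemma profinite_quandle_iso_prod (A Q Q' : topInvolutoryQuandleType) :
  profinite_quandle A -> profinite_quandle_iso Q Q' ->
  profinite_quandle_iso (A * Q)%type (A * Q')%type.
Proof.
move=> pA [pQ pQ' [f [g [[fc fM] [gc gM] fg gf]]]].
split; [exact: profinite_quandle_prod|exact: profinite_quandle_prod|].
have c (X Y : topologicalType) (h : X -> Y) : continuous h ->
    continuous (fun p : A * X => (p.1, h p.2)).
  move=> hc; apply: continuous_pair => p; first exact: cvg_fst.
  by apply: (@continuous_comp _ _ _ snd h); [exact: cvg_snd|exact: hc].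
exists (fun p => (p.1, f p.2)), (fun p => (p.1, g p.2)); split.
- split; first exact: c.
  by move=> [a x] [b y]; congr pair; exact: fM.
- split; first exact: c.
  by move=> [a x] [b y]; congr pair; exact: gM.
- by move=> [a x] /=; rewrite fg.
- by move=> [a x] /=; rewrite gf.
Qed.

Lemma profinite_quandle_iso_sym (Q Q' : topInvolutoryQuandleType) :
  profinite_quandle_iso Q Q' -> profinite_quandle_iso Q' Q.
Proof.
by move=> [pQ pQ' [f [g [fm gm fg gf]]]]; split => //; exists g, f; split.
Qed.

Lemma profinite_quandle_iso_trans (Q Q' Q'' : topInvolutoryQuandleType) :
  profinite_quandle_iso Q Q' -> profinite_quandle_iso Q' Q'' ->
  profinite_quandle_iso Q Q''.
Proof.
move=> [pQ _ [f [g [[fc fM] [gc gM] fg gf]]]] [_ pQ'' [f' [g' [[fc' fM'] [gc' gM'] fg' gf']]]].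
split => //; exists (f' \o f), (g \o g'); split.
- by split=> [x|x y /=]; [apply: continuous_comp; [exact: fc|exact: fc']|rewrite fM fM'].
- by split=> [x|x y /=]; [apply: continuous_comp; [exact: gc'|exact: gc]|rewrite gM' gM].
- exact: can_comp.
- exact: can_comp.
Qed.

(** The semidirect product of [Zhat] by the group of order two acting by
    inversion, i.e. the profinite completion of the infinite dihedral group. *)
Definition dihedral : Type := (Zhat * bool)%type.
HB.instance Definition _ := Topological.on dihedral.

Section Dihedral.

Definition Zhat_sign (e : bool) (a : Zhat) : Zhat := if e then - a else a.

Definition dihedral_mul (x y : dihedral) : dihedral :=
  (x.1 + Zhat_sign x.2 y.1, x.2 (+) y.2).

Definition dihedral_one : dihedral := (0, false).

Definition dihedral_inv (x : dihedral) : dihedral := (- Zhat_sign x.2 x.1, x.2).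

Lemma dihedral_mulA : associative dihedral_mul.
Proof.
move=> [a e] [b f] [c g]; rewrite /dihedral_mul /= addbA; congr pair.
by case: e f => -[] /=; rewrite ?opprD ?opprK ?addrA.
Qed.

Lemma dihedral_mul1 : left_id dihedral_one dihedral_mul.
Proof. by move=> [a e]; rewrite /dihedral_mul /= add0r. Qed.

Lemma dihedral_mulr1 : right_id dihedral_one dihedral_mul.
Proof.
by move=> [a e]; rewrite /dihedral_mul /= addbF; case: e; rewrite /= ?oppr0 addr0.
Qed.

Lemma dihedral_mulV : left_inverse dihedral_one dihedral_inv dihedral_mul.
Proof.
by move=> [a e]; rewrite /dihedral_mul /= addbb; case: e; rewrite /= ?opprK ?addrN ?addNr.
Qed.

Lemma dihedral_mulrV : right_inverse dihedral_one dihedral_inv dihedral_mul.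
Proof.
by move=> [a e]; rewrite /dihedral_mul /= addbb; case: e; rewrite /= ?opprK ?addrN.
Qed.

HB.instance Definition _ :=
  isGroup.Build dihedral dihedral_mulA dihedral_mul1 dihedral_mulr1
    dihedral_mulV dihedral_mulrV.

Lemma dihedral_near_sign (x : dihedral) : \forall y \near x, y.2 = x.2.
Proof.
apply: (@cvg_snd _ _ (nbhs x.1) (nbhs x.2) _ [set e | e = x.2]).
by rewrite nbhs_principalE => e ->.
Qed.

Lemma dihedral_near_fun (x : dihedral) n :
  \forall y \near x, Zhat_fun y.1 n = Zhat_fun x.1 n.
Proof. exact: (@cvg_fst _ _ (nbhs x.1) (nbhs x.2) _ _ (Zhat_fun_near x.1 n)). Qed.

Lemma continuous_dihedral (X : topologicalType) (f : X -> dihedral) :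
  (forall x, \forall y \near x, (f y).2 = (f x).2) ->
  (forall n x, \forall y \near x, Zhat_fun (f y).1 n = Zhat_fun (f x).1 n) ->
  continuous f.
Proof.
move=> f2 f1; have -> : f = fun x => ((f x).1, (f x).2).
  by apply/funext => x; rewrite -surjective_pairing.
apply: continuous_pair; first by apply: continuous_Zhat => n x; exact: f1.
by apply: continuous_locally.
Qed.

Lemma dihedral_profinite : profinite_group dihedral.
Proof.
split.
- apply: zero_dimensional_profinite.
    by rewrite -setXTT; apply: compact_setX; [exact: Zhat_compact|exact: bool_compact].
  apply: prod_zero_dimensional; first exact: Zhat_zero_dimensional.
  exact: discrete_zero_dimension.
- have n2 (p : dihedral * dihedral) : \forall q \near p, q.1.2 = p.1.2 /\ q.2.2 = p.2.2.
    exists ([set x | x.2 = p.1.2], [set x | x.2 = p.2.2]).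
      by split; exact: dihedral_near_sign.
    by move=> q [].
  apply: continuous_dihedral => [p|n p].
    by apply: filterS (n2 p) => q [e1 e2]; rewrite /= e1 e2.
  have n1 : \forall q \near p, Zhat_fun q.1.1 n = Zhat_fun p.1.1 n /\ Zhat_fun q.2.1 n = Zhat_fun
    p.2.1 n.
    exists ([set x : dihedral | Zhat_fun x.1 n = Zhat_fun p.1.1 n], [set x : dihedral | Zhat_fun
      x.1 n = Zhat_fun p.2.1 n]).
      by split; exact: dihedral_near_fun.
    by move=> q [].
  apply: filterS2 (n2 p) n1 => q [e1 e2] [e3 e4].
  have ME (x y : dihedral) : (x * y)%g.1 = x.1 + Zhat_sign x.2 y.1 by [].
  have ZD (a b : Zhat) : Zhat_fun (a + b) n = Zhat_fun a n + Zhat_fun b n by [].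
  have ZN (a : Zhat) : Zhat_fun (- a) n = - Zhat_fun a n by [].
  by rewrite !ME e1 !ZD e3; case: (p.1.2); rewrite /= ?ZN e4.
- apply: continuous_dihedral => [x|n x]; first exact: dihedral_near_sign.
  apply: filterS2 (dihedral_near_sign x) (dihedral_near_fun x n) => y e1 e2.
  have ZN (a : Zhat) : Zhat_fun (- a) n = - Zhat_fun a n by [].
  have VE (z : dihedral) : z^-1%g.1 = - Zhat_sign z.2 z.1 by [].
  by rewrite !VE e1 !ZN; case: (x.2); rewrite /= ?ZN e2.
Qed.

End Dihedral.

Section FreeProduct.
Variables (P : topGroupType) (gen : bool -> P).
Hypothesis hP : is_free_profinite2 (S := bool) gen.
Local Open Scope group_scope.

Let Pp : profinite_group P. Proof. by case: hP. Qed.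

Let gen2 b : gen b * gen b = 1. Proof. by case: hP => _ _ /(_ b). Qed.

Let genV b : (gen b)^-1 = gen b. Proof. exact: mulg1_eq. Qed.

Let rot : P := gen true * gen false.

Let rotV : gen false * rot * (gen false)^-1 = rot^-1.
Proof. by rewrite /rot !mulgA mulgK invgM !genV. Qed.

Let pw := profinite_power Pp rot.

(** The reflection [(0, true)] is sent to the generator [gen false] and the
    translation by one to the product of both generators. *)
Definition of_dihedral (x : dihedral) : P := pw x.1 * gen false ^+ x.2.

Lemma of_dihedralM (x y : dihedral) : of_dihedral (x * y) = of_dihedral x * of_dihedral y.
Proof.
case: x y => [a e] [b f]; rewrite /of_dihedral /= /pw profinite_powerD -!mulgA; congr (_ * _).
case: e => /=; last by rewrite expg0 mul1g.
rewrite -(profinite_power_invert _ _ rotV) -!mulgA; congr (_ * _); congr (_ * _).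
by rewrite genV; case: f; rewrite /= ?expg0 ?expg1 ?mulg1 ?gen2.
Qed.

Lemma continuous_of_dihedral : continuous of_dihedral.
Proof.
apply: (continuous_mulg Pp).
  move=> x; apply: (@continuous_comp _ _ _ fst pw); first exact: cvg_fst.
  exact: continuous_profinite_power.
by apply: continuous_locally => x; apply: filterS (dihedral_near_sign x) => y ->.
Qed.

Definition Zhat_one_fun (n : nat) : 'I_n.+1 := inZp 1.

Lemma Zhat_one_subproof : Zhat_set Zhat_one_fun.
Proof. by move=> m n mn; apply: val_inj; rewrite /= modn_dvdm. Qed.

Definition Zhat_one : Zhat := Zhat_of Zhat_one_subproof.

Lemma profinite_power1 : pw Zhat_one = rot.
Proof.
apply: (eqmodg_eq Pp) => U Un; have [m Um] := open_normal_exponent Pp Un rot.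
apply: (eqmodg_trans Un (eqmodg_sym Un (profinite_powerE Pp _ Un Um))).
rewrite -[X in eqmodg _ _ X]expg1; apply: (eqmodg_expg Un Um).
by rewrite /= modn_mod.
Qed.

Definition dihedral_gen (b : bool) : dihedral := (if b then Zhat_one else 0%R, true).

Lemma to_dihedral_ex : exists phi : P -> dihedral,
  [/\ continuous phi, {morph phi : x y / x * y} & forall b, phi (gen b) = dihedral_gen b].
Proof.
have [_ _ _ U] := hP.
have [||phi [phiP _]] := U _ dihedral_profinite dihedral_gen.
- by apply: continuous_locally => b; apply: (@filterS _ (nbhs b) _ [set b]);
  [move=> _ ->|exact: discrete_set1].
- by move=> b; congr pair; exact: addrN.
by exists phi.
Qed.

Let to_dihedral : P -> dihedral := projT1 (cid to_dihedral_ex).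

Let to_dihedralP : [/\ continuous to_dihedral, {morph to_dihedral : x y / x * y} & forall b,
  to_dihedral (gen b) = dihedral_gen b].
Proof. exact: (projT2 (cid to_dihedral_ex)). Qed.

Lemma of_dihedral_gen b : of_dihedral (dihedral_gen b) = gen b.
Proof.
rewrite /of_dihedral /=; case: b; rewrite expg1.
  by rewrite profinite_power1 -mulgA gen2 mulg1.
by rewrite /pw profinite_power0 mul1g.
Qed.

(** By uniqueness in the universal property: the composite is an endomorphism
    fixing the generators. *)
Lemma to_dihedralK : cancel to_dihedral of_dihedral.
Proof.
have [_ _ _ U] := hP; have [phic phiM phig] := to_dihedralP.
have [||psi [psiP psiU]] := U _ Pp gen.
- by case: hP.
- exact: gen2.
have e1 : psi = of_dihedral \o to_dihedral.
  apply: psiU; split.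
  - by move=> x; apply: continuous_comp; [exact: phic|exact: continuous_of_dihedral].
  - by move=> x y /=; rewrite phiM of_dihedralM.
  - by move=> b /=; rewrite phig of_dihedral_gen.
have e2 : psi = id by apply: psiU; split => // x; exact: cvg_id.
by move=> x; rewrite -[LHS]/((of_dihedral \o to_dihedral) x) -e1 e2.
Qed.

Lemma to_dihedral1 : to_dihedral 1 = 1.
Proof.
have [_ phiM _] := to_dihedralP; have := phiM 1 1; rewrite mulg1.
by move=> /(congr1 (fun y => (to_dihedral 1)^-1 * y)); rewrite mulVg mulKg.
Qed.

(** Both sides agree on the powers of [rot] with exponents in the natural
    numbers, hence modulo each of the open normal subgroups pulled back from
    the congruence subgroups of [dihedral]. *)
Lemma to_dihedral_power (a : Zhat) : to_dihedral (pw a) = (a, false).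
Proof.
have [phic phiM phig] := to_dihedralP.
have phiV x : to_dihedral x^-1 = (to_dihedral x)^-1.
  by apply: (mulgI (to_dihedral x)); rewrite -phiM !mulgV to_dihedral1.
have phi_rot : to_dihedral rot = (Zhat_one, false).
  by rewrite /rot phiM !phig /dihedral_gen; congr pair; rewrite /= oppr0 addr0.
have phi_rotX k : (to_dihedral (rot ^+ k)).2 = false /\ forall n,
    Zhat_fun (to_dihedral (rot ^+ k)).1 n = (k %% n.+1)%N :> nat.
  elim: k => [|k [IH2 IH1]]; first by rewrite to_dihedral1; split => // n; rewrite mod0n.
  rewrite expgS phiM phi_rot; split; first by rewrite /= IH2.
  by move=> n; rewrite Zhat_funD /= IH1 modnDm.
pose D n : set dihedral := [set x | x.2 = false /\ Zhat_fun x.1 n = 0%R].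
have Dn n : open_normal (to_dihedral @^-1` D n).
  have ZD (b c : Zhat) : Zhat_fun (b + c)%R n = (Zhat_fun b n + Zhat_fun c n)%R by [].
  have ZN (b : Zhat) : Zhat_fun (- b)%R n = (- Zhat_fun b n)%R by [].
  have ME (x y : dihedral) : x * y = (x.1 + Zhat_sign x.2 y.1, x.2 (+) y.2)%R by [].
  have VE (z : dihedral) : z^-1 = (- Zhat_sign z.2 z.1, z.2)%R by [].
  split.
  - apply: phic; rewrite to_dihedral1.
    exact: filterI (dihedral_near_sign 1) (dihedral_near_fun 1 n).
  - move=> x y [x2 x1] [y2 y1]; rewrite /D /= phiM ME x2 /= y2 ZD x1 y1; split => //.
    by rewrite addr0.
  - by move=> x [x2 x1]; rewrite /D /= phiV VE x2 /= ZN x1 oppr0.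
  - move=> h x [x2 x1]; rewrite /D /= !phiM phiV !ME VE x2 /= addbF addbb; split => //.
    rewrite !ZD; case: (to_dihedral h).2; rewrite /= ?opprK !ZN ?x1 ?oppr0 addr0.
      by rewrite addrN.
    by rewrite addrN.
have key n : eqmodg (to_dihedral @^-1` D n) (rot ^+ Zhat_fun a n) (pw a).
  apply: profinite_powerE => //; have [e2 e1] := phi_rotX n.+1; split => //.
  by apply: val_inj; rewrite /= e1 modnn.
have phia2 : (to_dihedral (pw a)).2 = false.
  have [] := key 0%N; have [e2 _] := phi_rotX (Zhat_fun a 0%N).
  by rewrite phiM phiV /= e2 addFb.
rewrite [LHS]surjective_pairing phia2; congr pair; apply: Zhat_eqP => n.
have [_] := key n; have [e2 e1] := phi_rotX (Zhat_fun a n).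
rewrite phiM phiV.
have ME (x y : dihedral) : x * y = (x.1 + Zhat_sign x.2 y.1, x.2 (+) y.2)%R by [].
have VE (z : dihedral) : z^-1 = (- Zhat_sign z.2 z.1, z.2)%R by [].
rewrite ME VE /= e2 /= => /(congr1 (+%R (Zhat_fun (to_dihedral (rot ^+ Zhat_fun a n)).1 n))).
have ZD (b c : Zhat) : Zhat_fun (b + c)%R n = (Zhat_fun b n + Zhat_fun c n)%R by [].
have ZN (b : Zhat) : Zhat_fun (- b)%R n = (- Zhat_fun b n)%R by [].
rewrite ZD ZN addr0 addNKr => ->; apply: val_inj; rewrite /= e1.
by rewrite modn_small.
Qed.

Lemma of_dihedralK : cancel of_dihedral to_dihedral.
Proof.
have [_ phiM phig] := to_dihedralP.
move=> [a e]; rewrite /of_dihedral phiM to_dihedral_power; case: e => /=.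
  by rewrite expg1 phig; congr pair; rewrite /= addr0.
by rewrite expg0 to_dihedral1 mulg1.
Qed.

Lemma reflection_subproof a : Invol_set (of_dihedral (a, true)).
Proof.
have o1 : of_dihedral 1 = 1 by rewrite -to_dihedral1 to_dihedralK.
split; first by rewrite -of_dihedralM -o1; congr of_dihedral; congr pair; exact: addrN.
by move=> /(congr1 to_dihedral); rewrite of_dihedralK to_dihedral1.
Qed.

Definition reflection (a : Zhat) : Invol P := SigSub (mem_set (reflection_subproof a)).

Definition reflection_angle (s : Invol P) : Zhat := (to_dihedral (set_val s)).1.

(** An involution of [dihedral] that is not a reflection would be an element of
    order two of [Zhat]. *)
Lemma to_dihedral_invol (s : Invol P) : to_dihedral (set_val s) = (reflection_angle s, true).
Proof.
have ss : set_val s * set_val s = 1 by case: (set_valP s).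
have s1 : set_val s <> 1 by case: (set_valP s).
have [_ phiM _] := to_dihedralP.
have := congr1 to_dihedral ss; rewrite phiM to_dihedral1 /reflection_angle.
case e : (to_dihedral (set_val s)) => [a []] //= /(congr1 fst) /Zhat_torsion_free a0.
by case: s1; rewrite -[LHS]to_dihedralK e [a]a0 -[RHS]to_dihedralK to_dihedral1.
Qed.

Lemma reflection_angleK : cancel reflection_angle reflection.
Proof. by move=> s; apply: val_inj; rewrite /= -to_dihedral_invol to_dihedralK. Qed.

Lemma reflectionK : cancel reflection reflection_angle.
Proof. by move=> a; rewrite /reflection_angle /= of_dihedralK. Qed.

Lemma Invol_free_iso : profinite_quandle_iso (Invol P) Zhat.
Proof.
have [phic phiM _] := to_dihedralP.
apply: (profinite_quandle_iso_inverse reflection_angleK reflectionK).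
- split.
    move=> s; apply: (@continuous_comp _ dihedral _ (to_dihedral \o set_val) fst);
      last exact: cvg_fst.
    by apply: (@continuous_comp _ P _ set_val to_dihedral); [exact: set_val_continuous|exact: phic].
  move=> s t; rewrite {1}/reflection_angle /=.
  have sV : (set_val s)^-1 = set_val s by apply: mulg1_eq; case: (set_valP s).
  have -> : set_val (rhd s t) = set_val s * set_val t * (set_val s)^-1 by [].
  rewrite sV !phiM !to_dihedral_invol /=.
  by rewrite -[RHS]/(reflection_angle s *+ 2 - reflection_angle t)%R mulr2n addrAC.
- apply: continuous_set_type => a.
  apply: (@continuous_comp _ dihedral _ (fun a => (a, true)) of_dihedral);
    last exact: continuous_of_dihedral.
  by apply: continuous_pair => b; [exact: cvg_id|exact: cst_continuous].
- exact: profinite_quandle_Zhat.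
Qed.

End FreeProduct.

(** * Coefficients of Laurent series *)

Section LaurentCoef.
Variable F : fieldType.
Implicit Types (f g : laurent F) (c d : F) (k l n : int).

Lemma lcoef0 n : lcoef (0 : laurent F) n = 0. Proof. by []. Qed.
Lemma lcoef1 n : lcoef (1 : laurent F) n = (n == 0)%:R. Proof. by []. Qed.
Lemma lcoefD f g n : lcoef (f + g) n = lcoef f n + lcoef g n. Proof. by []. Qed.
Lemma lcoefB f g n : lcoef (f - g) n = lcoef f n - lcoef g n. Proof. by []. Qed.

Lemma lcoefM f g : lcoef (f * g) = cauchy_prod (lcoef f) (lcoef g).
Proof. by []. Qed.

Lemma lcoef_sum (I : Type) (r : seq I) (P : pred I) (G : I -> laurent F) n :
  lcoef (\sum_(i <- r | P i) G i) n = \sum_(i <- r | P i) lcoef (G i) n.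
Proof. by elim/big_rec2: _ => [|i x y _ <-]. Qed.

Lemma lcoef_of (h : int -> F) (hP : laurent_set h) n : lcoef (laurent_of hP) n = h n.
Proof. by []. Qed.

Lemma lcoefM_sum f g a b (k : nat) : supp_from a (lcoef f) -> supp_from b (lcoef g) ->
  lcoef (f * g) (a + b + k%:Z) =
    \sum_(i < k.+1) lcoef f (a + i%:Z) * lcoef g (b + (k - i)%:Z).
Proof.
move=> fa gb; rewrite lcoefM (@cauchy_prodE _ a b _ _ k.+1) // coefM.
apply: eq_bigr => i _; rewrite !coef_poly ltn_ord.
by rewrite ifT // ltnS leq_subr.
Qed.

Lemma supp_fromM f g a b : supp_from a (lcoef f) -> supp_from b (lcoef g) ->
  supp_from (a + b) (lcoef (f * g)).
Proof. by move=> fa gb; rewrite lcoefM; exact: cauchy_prod_from. Qed.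

Lemma supp_from_sum (I : Type) (r : seq I) (P : pred I) (G : I -> laurent F) a :
  (forall i, P i -> supp_from a (lcoef (G i))) ->
  supp_from a (lcoef (\sum_(i <- r | P i) G i)).
Proof. by move=> H n na; rewrite lcoef_sum big1 // => i Pi; exact: H. Qed.

Lemma supp_from0 a : supp_from a (lcoef (0 : laurent F)).
Proof. by []. Qed.

Lemma supp_from1 : supp_from 0 (lcoef (1 : laurent F)).
Proof. exact: laurent1_from. Qed.

Lemma supp_fromX f (m : nat) a : supp_from a (lcoef f) -> supp_from (a *+ m) (lcoef (f ^+ m)).
Proof.
move=> fa; elim: m => [|m IH]; first exact: supp_from1.
by rewrite exprS mulrS; exact: supp_fromM.
Qed.

Lemma lcoefM_low f g a b : supp_from a (lcoef f) -> supp_from b (lcoef g) ->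
  lcoef (f * g) (a + b) = lcoef f a * lcoef g b.
Proof.
move=> fa gb; rewrite -[a + b]addr0 (@lcoefM_sum _ _ _ _ 0) //.
by rewrite big_ord1 subn0 !addr0.
Qed.

Lemma lcoefX_low f (m : nat) a : supp_from a (lcoef f) ->
  lcoef (f ^+ m) (a *+ m) = lcoef f a ^+ m.
Proof.
move=> fa; elim: m => [|m IH]; first by rewrite expr0 lcoef1.
by rewrite exprS mulrS lcoefM_low ?IH ?exprS //; exact: supp_fromX.
Qed.

Lemma laurent_leadP f : f != 0 -> exists2 a, supp_from a (lcoef f) & lcoef f a != 0.
Proof.
move=> f0; apply: laurent_lead; apply/not_existsP => H; case/eqP: f0.
by apply: laurent_eqP => n; apply/eqP/negPn/negP/H.
Qed.

Lemma mono_subproof (k : int) (c : F) : laurent_set (fun n => if n == k then c else 0).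
Proof. by exists k => n nk; rewrite ifF // lt_eqF. Qed.

(** The monomial [c t ^ k]. *)
Definition mono (k : int) (c : F) : laurent F := laurent_of (mono_subproof k c).

Lemma lcoef_mono k c n : lcoef (mono k c) n = if n == k then c else 0.
Proof. by []. Qed.

Lemma lcoef_monoM k c f n : lcoef (mono k c * f) n = c * lcoef f (n - k).
Proof.
rewrite lcoefM /cauchy_prod -(@fsbig_widen _ _ _ _ [set k]) //; last first.
  by move=> i [_ /eqP ik] /=; rewrite lcoef_mono (negPf ik) mul0r.
by rewrite fsbig_set1 lcoef_mono eqxx.
Qed.

Lemma monoM k l c d : mono k c * mono l d = mono (k + l) (c * d).
Proof.
apply: laurent_eqP => n; rewrite lcoef_monoM !lcoef_mono.
have -> : (n - k == l) = (n == k + l) by apply/eqP/eqP; lia.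
by case: eqP; rewrite ?mulr0.
Qed.

Lemma monoD k c d : mono k (c + d) = mono k c + mono k d.
Proof.
by apply: laurent_eqP => n; rewrite lcoefD !lcoef_mono; case: eqP; rewrite ?addr0.
Qed.

Lemma mono01 : mono 0 1 = 1.
Proof. by apply: laurent_eqP => n; rewrite lcoef_mono lcoef1; case: eqP. Qed.

Lemma mono_neq0 k c : c != 0 -> mono k c != 0.
Proof. by apply: contra_neq => /(congr1 (fun f => lcoef f k)); rewrite lcoef_mono eqxx. Qed.

Lemma monoX k c (m : nat) : mono k c ^+ m = mono (k *+ m) (c ^+ m).
Proof.
elim: m => [|m IH]; first by rewrite !expr0 mulr0n mono01.
by rewrite !exprS IH monoM mulrS.
Qed.

End LaurentCoef.

Section LaurentMap.
Variables (F E : fieldType) (s : {rmorphism F -> E}).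

Lemma ltwist_subproof (chi : int -> E) (f : laurent F) :
  laurent_set (fun n => s (lcoef f n) * chi n).
Proof. by have [a fa] := lcoef_from f; exists a => n na; rewrite fa // rmorph0 mul0r. Qed.

(** The map [sum f_n t ^ n |-> sum s(f_n) chi(n) t ^ n]. *)
Definition ltwist chi f : laurent E := laurent_of (ltwist_subproof chi f).

Lemma lcoef_twist chi f n : lcoef (ltwist chi f) n = s (lcoef f n) * chi n.
Proof. by []. Qed.

Lemma supp_from_twist chi f a : supp_from a (lcoef f) -> supp_from a (lcoef (ltwist chi f)).
Proof. by move=> fa n na; rewrite lcoef_twist fa // rmorph0 mul0r. Qed.

Lemma ltwistM chi : {morph chi : m n / m + n >-> m * n} ->
  {morph ltwist chi : f g / f * g}.
Proof.
move=> chiM f g; have [a fa] := lcoef_from f; have [b gb] := lcoef_from g.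
apply: laurent_eqP; apply: (@supp_from_eq _ (a + b)).
- exact: supp_from_twist (supp_fromM fa gb).
- by apply: supp_fromM; exact: supp_from_twist.
move=> k; rewrite lcoef_twist (lcoefM_sum _ fa gb) lcoefM_sum; try exact: supp_from_twist.
rewrite rmorph_sum mulr_suml; apply: eq_bigr => i _.
rewrite !lcoef_twist rmorphM mulrACA -chiM; congr (_ * chi _).
by have := ltn_ord i; lia.
Qed.

Lemma ltwist1 chi : chi 0 = 1 -> ltwist chi 1 = 1.
Proof.
move=> chi0; apply: laurent_eqP => n; rewrite lcoef_twist !lcoef1.
by case: eqP => [->|_]; rewrite ?rmorph1 ?chi0 ?mulr1 // rmorph0 mul0r.
Qed.

Definition lmap := ltwist (fun=> 1).

Lemma lcoef_lmap f n : lcoef (lmap f) n = s (lcoef f n).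
Proof. by rewrite lcoef_twist mulr1. Qed.

Lemma lmap_additive : zmod_morphism lmap.
Proof.
move=> f g; apply: laurent_eqP => n.
by rewrite lcoefB !lcoef_lmap rmorphB.
Qed.

Lemma lmap_multiplicative : monoid_morphism lmap.
Proof.
split; first exact: ltwist1.
by apply: ltwistM => m n; rewrite mulr1.
Qed.

HB.instance Definition _ := GRing.isZmodMorphism.Build _ _ lmap lmap_additive.
HB.instance Definition _ := GRing.isMonoidMorphism.Build _ _ lmap lmap_multiplicative.

End LaurentMap.

Section Dilation.
Variables (F : fieldType) (m : nat).

Definition dil_coef (f : int -> F) (n : int) : F :=
  if (m.+1%:Z %| n)%Z then f (n %/ m.+1%:Z)%Z else 0.

Lemma dil_subproof (f : laurent F) : laurent_set (dil_coef (lcoef f)).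
Proof.
have [a fa] := lcoef_from f; exists (a * m.+1%:Z) => n na.
rewrite /dil_coef; case: ifP => // /dvdzP[q nq].
by rewrite nq mulzK // fa //; move: na; rewrite nq; nia.
Qed.

(** The substitution [t |-> t ^ m.+1]. *)
Definition dil (f : laurent F) : laurent F := laurent_of (dil_subproof f).

Lemma lcoef_dil f n : lcoef (dil f) (n * m.+1%:Z) = lcoef f n.
Proof. by rewrite /dil lcoef_of /dil_coef dvdz_mull // mulzK. Qed.

Lemma lcoef_dil_const f : lcoef (dil f) 0 = lcoef f 0.
Proof. by rewrite -[RHS]lcoef_dil mul0r. Qed.

Lemma lcoef_dil0 f n : ~~ (m.+1%:Z %| n)%Z -> lcoef (dil f) n = 0.
Proof. by rewrite /dil lcoef_of /dil_coef => /negPf ->. Qed.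

Lemma dil_eqP (f g : laurent F) :
  (forall n, lcoef g (n * m.+1%:Z) = lcoef f n) ->
  (forall n, ~~ (m.+1%:Z %| n)%Z -> lcoef g n = 0) -> g = dil f.
Proof.
move=> g1 g0; apply: laurent_eqP => n; have [/dvdzP[q ->]|nn] := boolP (m.+1%:Z %| n)%Z.
  by rewrite g1 lcoef_dil.
by rewrite g0 // lcoef_dil0.
Qed.

Lemma dil_additive : zmod_morphism dil.
Proof.
move=> f g; apply/esym/dil_eqP => n; first by rewrite !lcoefB !lcoef_dil.
by move=> nn; rewrite lcoefB !lcoef_dil0 // subrr.
Qed.

Lemma dil_multiplicative : monoid_morphism dil.
Proof.
split.
  apply/esym/dil_eqP => n; first by rewrite !lcoef1 mulf_eq0 orbF.
  by rewrite lcoef1; case: eqP => // ->; rewrite dvdz0.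
move=> f g; apply/esym/dil_eqP => n.
  rewrite !lcoefM /cauchy_prod.
  pose h (i : int) := i * m.+1%:Z.
  rewrite -(@fsbig_widen _ _ _ _ (h @` setT)) //; last first.
    move=> i [_ hi] /=; rewrite lcoef_dil0 ?mul0r //; apply/negP => /dvdzP[q iq].
    by apply: hi; exists q.
  rewrite fsbig_image; last by move=> i j _ _; exact: mulIf.
  by apply: eq_fsbigr => i _; rewrite /h -mulrBl !lcoef_dil.
move=> nn; rewrite lcoefM /cauchy_prod fsbig1 // => i _.
have [im|im] := boolP (m.+1%:Z %| i)%Z; last by rewrite lcoef_dil0 // mul0r.
by rewrite [X in _ * X]lcoef_dil0 ?mulr0 //; apply: contra nn => nim; rewrite -(subrK i n) rpredD.
Qed.

HB.instance Definition _ := GRing.isZmodMorphism.Build _ _ dil dil_additive.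
HB.instance Definition _ := GRing.isMonoidMorphism.Build _ _ dil dil_multiplicative.

Lemma supp_from_dil f a : supp_from a (lcoef f) -> supp_from (a * m.+1%:Z) (lcoef (dil f)).
Proof.
move=> fa n na; have [/dvdzP[q nq]|nn] := boolP (m.+1%:Z %| n)%Z; last exact: lcoef_dil0.
by rewrite nq lcoef_dil fa //; move: na; rewrite nq; nia.
Qed.

Lemma supp_from_dil0 f : supp_from 0 (lcoef f) -> supp_from 0 (lcoef (dil f)).
Proof. by move=> /supp_from_dil; rewrite mul0r. Qed.

End Dilation.

Lemma dil_comp (F : fieldType) m m' (f : laurent F) :
  dil m (dil m' f) = dil (m.+1 * m'.+1).-1 f.
Proof.
have e : (m.+1 * m'.+1).-1.+1%:Z = m'.+1%:Z * m.+1%:Z by rewrite prednK //; lia.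
apply: dil_eqP => n; first by rewrite e mulrA !lcoef_dil.
rewrite e => nn; have [/dvdzP[q nq]|?] := boolP (m.+1%:Z %| n)%Z; last exact: lcoef_dil0.
rewrite nq lcoef_dil lcoef_dil0 //; apply: contra nn => /dvdzP[q' q'E].
by rewrite nq q'E -mulrA dvdz_mull.
Qed.

Lemma dil_mono (F : fieldType) m k (c : F) : dil m (mono k c) = mono (k * m.+1%:Z) c.
Proof.
apply/esym/dil_eqP => j; rewrite !lcoef_mono.
  by congr (if _ then _ else _); apply/eqP/eqP => [/mulIf ->|->].
by case: eqP => // ->; rewrite dvdz_mull.
Qed.

Lemma lmap_mono (F E : fieldType) (s : {rmorphism F -> E}) k c :
  lmap s (mono k c) = mono k (s c).
Proof.
by apply: laurent_eqP => n; rewrite lcoef_lmap !lcoef_mono; case: eqP; rewrite ?rmorph0.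
Qed.

Section LaurentConstants.
Variable F : fieldType.

Definition lconst (c : F) : laurent F := mono 0 c.

Lemma lconst_additive : zmod_morphism lconst.
Proof. by move=> c d; apply: (addIr (lconst d)); rewrite /lconst -monoD !subrK. Qed.

Lemma lconst_multiplicative : monoid_morphism lconst.
Proof. by split=> [|c d]; rewrite /lconst ?mono01 // monoM. Qed.

HB.instance Definition _ := GRing.isZmodMorphism.Build _ _ lconst lconst_additive.
HB.instance Definition _ := GRing.isMonoidMorphism.Build _ _ lconst lconst_multiplicative.

End LaurentConstants.

(** * Hensel's lemma *)

Section HenselCoefs.
Variables (E : fieldType) (f : nat -> {poly E}) (d r : nat) (g0 h0 u v : {poly E}).
Hypotheses (fs : forall n, (size (f n) <= d.+1)%N) (f0 : f 0%N = g0 * h0).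
Hypotheses (g0m : g0 \is monic) (g0s : size g0 = r.+1) (rd : (r <= d)%N).
Hypotheses (h0s : (size h0 <= (d - r).+1)%N) (uv : u * g0 + v * h0 = 1).

(** A solution of [g0 * b + a * h0 = R] with [a] reduced modulo [g0], so that the
    degrees stay bounded. *)
Definition bezout_solve (R : {poly E}) : {poly E} * {poly E} :=
  ((v * R) %% g0, u * R + h0 * ((v * R) %/ g0)).

Lemma bezout_solveP R : g0 * (bezout_solve R).2 + (bezout_solve R).1 * h0 = R.
Proof.
rewrite /= -[RHS]mul1r -uv mulrDl -[v * h0 * R]mulrA [h0 * R]mulrC mulrA.
rewrite {3}(divp_eq (v * R) g0).
set q := _ %/ _; set m := _ %% _; ring.
Qed.

Lemma bezout_solve_size (R : {poly E}) : (size R <= d.+1)%N ->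
  (size (bezout_solve R).1 <= r)%N /\ (size (bezout_solve R).2 <= (d - r).+1)%N.
Proof.
move=> Rs; have s1 : (size (bezout_solve R).1 <= r)%N.
  by rewrite -ltnS -g0s ltn_modp monic_neq0.
split => //; have [->|z0] := eqVneq (bezout_solve R).2 0; first by rewrite size_poly0.
have : (size (g0 * (bezout_solve R).2)%R <= d.+1)%N.
  have -> : g0 * (bezout_solve R).2 = R - (bezout_solve R).1 * h0.
    by rewrite -[X in _ = X - _]bezout_solveP addrK.
  rewrite (leq_trans (size_polyD _ _)) // size_polyN geq_max Rs andTb.
  apply: leq_trans (size_polyMleq _ _) _; rewrite -subn1 leq_subLR.
  by apply: leq_trans (leq_add s1 h0s) _; rewrite addnS subnKC // leqW.
by rewrite size_monicM // g0s addSn /= -leq_subRL ?subSn // (leq_trans rd).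
Qed.

(** The coefficients of [t ^ i], for [i < n], of the two lifted factors: in the
    equation for the coefficient of [t ^ n] of the product, the unknown ones
    occur only multiplied by [g0] and [h0]. *)
Fixpoint hensel_seq (n : nat) : seq ({poly E} * {poly E}) :=
  if n is m.+1 then
    let s := hensel_seq m in
    rcons s (if m is m'.+1 then bezout_solve (f m - \sum_(i < m')
      (nth (0, 0) s i.+1).1 * (nth (0, 0) s (m' - i)).2) else (g0, h0))
  else [::].

Lemma size_hensel_seq n : size (hensel_seq n) = n.
Proof. by elim: n => //= n IH; rewrite size_rcons IH. Qed.

Definition hensel_coef n := nth (0, 0) (hensel_seq n.+1) n.

Lemma hensel_seq_nth n i : (i < n)%N -> nth (0, 0) (hensel_seq n) i = hensel_coef i.
Proof.
elim: n => // n IH; rewrite ltnS leq_eqVlt => /orP[/eqP->//|i_n] /=.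
by rewrite nth_rcons size_hensel_seq i_n IH.
Qed.

Lemma hensel_coef0 : hensel_coef 0 = (g0, h0). Proof. by []. Qed.

Definition hensel_rest n : {poly E} := f n.+1 -
  \sum_(i < n) (hensel_coef i.+1).1 * (hensel_coef (n - i)).2.

Lemma hensel_coefS n : hensel_coef n.+1 = bezout_solve (hensel_rest n).
Proof.
rewrite /hensel_coef [hensel_seq n.+2]/= nth_rcons size_rcons size_hensel_seq ltnn eqxx.
congr bezout_solve; congr (_ - _); apply: eq_bigr => i _; have := ltn_ord i => ik.
rewrite !(@hensel_seq_nth n.+1) //; lia.
Qed.

Lemma hensel_coef_sum n :
  \sum_(i < n.+1) (hensel_coef i).1 * (hensel_coef (n - i)).2 = f n.
Proof.
case: n => [|n]; first by rewrite big_ord1 f0.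
rewrite big_ord_recl big_ord_recr /= subn0 subnn !hensel_coef0 /=.
rewrite hensel_coefS addrCA bezout_solveP /hensel_rest addrC -[RHS](subrK (\sum_(i < n)
      (hensel_coef i.+1).1 * (hensel_coef (n - i)).2)).
by congr (_ + _); apply: eq_bigr => i _.
Qed.

Lemma hensel_coef_size n :
  (size (hensel_coef n).1 <= r.+1)%N /\ (size (hensel_coef n).2 <= (d - r).+1)%N.
Proof.
elim/ltn_ind: n => -[_|n IH]; first by rewrite hensel_coef0 /= g0s.
rewrite hensel_coefS; have [|s1 s2] := bezout_solve_size (R := hensel_rest n); last first.
  by split => //; exact: leqW.
rewrite (leq_trans (size_polyD _ _)) // size_polyN geq_max fs /=.
apply: (leq_trans (size_sum _ _ _)); apply/bigmax_leqP => i _.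
have ik := ltn_ord i.
have [|s1 _] := IH i.+1; first by lia.
have [|_ s2] := IH (n - i)%N; first by lia.
apply: leq_trans (size_polyMleq _ _) _; rewrite -subn1 leq_subLR.
by apply: leq_trans (leq_add s1 s2) _; rewrite addSn addnS subnKC.
Qed.

(** All corrections to the first factor have degree below [r], so this factor
    keeps the degree of [g0]. *)
Lemma hensel_coef_lead n : ((hensel_coef n).1)`_r = (n == 0%N)%:R.
Proof.
case: n => [|n]; first by rewrite hensel_coef0 /= -(monicP g0m) lead_coefE g0s.
rewrite hensel_coefS nth_default //.
have := hensel_coef_size n.+1; rewrite hensel_coefS => _.
by rewrite -ltnS -g0s ltn_modp monic_neq0.
Qed.

End HenselCoefs.

Lemma power_series_subproof (E : fieldType) (c : nat -> E) :
  laurent_set (fun n : int => if n is Posz k then c k else 0).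
Proof. by exists 0 => -[]. Qed.

Definition power_series (E : fieldType) (c : nat -> E) : laurent E :=
  laurent_of (power_series_subproof c).

Lemma supp_from_power_series (E : fieldType) (c : nat -> E) : supp_from 0 (lcoef (power_series c)).
Proof. by move=> []. Qed.

Definition integral_coefs (E : fieldType) (q : {poly laurent E}) : Prop :=
  forall i, supp_from 0 (lcoef q`_i).

(** Coprimality of the reductions makes it possible to solve for the coefficients
    of [t ^ n] of both factors one [n] at a time. *)
Lemma hensel (E : fieldType) (q : {poly laurent E}) (d r : nat) (g0 h0 : {poly E}) :
  (size q <= d.+1)%N -> integral_coefs q ->
  g0 \is monic -> size g0 = r.+1 -> (r <= d)%N -> (size h0 <= (d - r).+1)%N ->
  coprimep g0 h0 -> (forall i, lcoef q`_i 0 = (g0 * h0)`_i) ->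
  exists g h, q = g * h /\ size g = r.+1.
Proof.
move=> qs qi g0m g0s rd h0s /Bezout_eq1_coprimepP[[u v] /= uv] q0.
pose f (n : nat) := \poly_(i < d.+1) lcoef q`_i n%:Z.
have fs n : (size (f n) <= d.+1)%N by exact: size_poly.
have fE n i : (f n)`_i = lcoef q`_i n%:Z.
  rewrite coef_poly; case: ltnP => // di.
  by rewrite nth_default // (leq_trans qs).
have f0 : f 0%N = g0 * h0 by apply/polyP => i; rewrite fE q0.
pose G := hensel_coef f g0 h0 u v.
pose g : {poly laurent E} := \poly_(i < r.+1) power_series (fun n => (G n).1`_i).
pose h : {poly laurent E} := \poly_(i < (d - r).+1) power_series (fun n => (G n).2`_i).
have Gs n : (size (G n).1 <= r.+1)%N /\ (size (G n).2 <= (d - r).+1)%N.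
  exact: (hensel_coef_size fs).
have gE i (n : nat) : lcoef g`_i n = (G n).1`_i.
  rewrite coef_poly; case: ltnP => // ri; rewrite nth_default //.
  by have [s1 _] := Gs n; exact: leq_trans s1 ri.
have hE i (n : nat) : lcoef h`_i n = (G n).2`_i.
  rewrite coef_poly; case: ltnP => // ri; rewrite nth_default //.
  by have [_ s1] := Gs n; exact: leq_trans s1 ri.
have gi i : supp_from 0 (lcoef g`_i).
  by rewrite coef_poly; case: ifP => _; [exact: supp_from_power_series|exact: supp_from0].
have hi i : supp_from 0 (lcoef h`_i).
  by rewrite coef_poly; case: ifP => _; [exact: supp_from_power_series|exact: supp_from0].
exists g, h; split; last first.
  apply: size_poly_eq; apply/eqP => /(congr1 (fun f => lcoef f 0)).
  rewrite [LHS](hensel_coef_lead fs g0m g0s rd h0s uv 0) => /eqP.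
  by rewrite lcoef0 oner_eq0.
apply/polyP => i; apply: laurent_eqP; apply: (@supp_from_eq _ 0); first exact: qi.
  rewrite coefM; apply: supp_from_sum => j _; rewrite -[0]addr0; exact: supp_fromM.
move=> k; rewrite add0r -fE -(hensel_coef_sum f0 g0m g0s rd h0s uv k).
rewrite coef_sum coefM lcoef_sum.
under eq_bigr do rewrite coefM.
rewrite exchange_big; apply: eq_bigr => j _ /=.
have := lcoefM_sum k (gi j) (hi (i - j)%N); rewrite !add0r => ->.
by apply: eq_bigr => l _; rewrite !add0r gE hE.
Qed.

(** * The Newton-Puiseux theorem *)

Lemma coef_comp_shift (R : comNzRingType) (p : {poly R}) (c : R) i :
  (p \Po ('X + c%:P))`_i = p^`N(i).[c].
Proof.
rewrite [p \Po _]/comp_poly addrC nderiv_taylor; last exact: mulrC.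
rewrite size_map_polyC; under eq_bigr do rewrite nderivn_map horner_map /= mul_polyC.
rewrite -(poly_def (size p) (fun j => p^`N(j).[c])) coef_poly; case: ltnP => // pi.
by rewrite nderivn_poly0 ?horner0.
Qed.

Lemma coef_comp_shift_low (R : comNzRingType) (p : {poly R}) (c : R) d :
  (size p <= d.+2)%N -> (p \Po ('X + c%:P))`_d = p`_d + p`_d.+1 * c *+ d.+1.
Proof.
move=> ps; rewrite coef_comp_shift (@horner_coef_wide _ 2); last first.
  by apply/leq_sizeP => j j2; rewrite coef_nderivn nth_default ?mul0rn // (leq_trans ps) //
    -addn2 leq_add2l.
rewrite !big_ord_recr big_ord0 /= add0r !coef_nderivn addn0 addn1 binn mulr1n expr0 mulr1 expr1.
by rewrite binSn mulrnAl.
Qed.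

Lemma coef_comp_shift_lead (R : comNzRingType) (p : {poly R}) (c : R) d :
  (size p <= d.+1)%N -> (p \Po ('X + c%:P))`_d = p`_d.
Proof.
move=> ps; rewrite coef_comp_shift_low; last exact: leqW.
by rewrite [p`_d.+1]nth_default // mul0r mul0rn addr0.
Qed.

Lemma rmorphism_pchar0 (k E : fieldType) (i : {rmorphism k -> E}) :
  [pchar k] =i pred0 <-> [pchar E] =i pred0.
Proof.
have e n : (n%:R == 0 :> E) = (n%:R == 0 :> k) by rewrite -(rmorph_nat i) fmorph_eq0.
by split => /pcharf0P H; apply/pcharf0P => n; rewrite -H e.
Qed.

Lemma laurent_pchar0 (K : fieldType) : [pchar K] =i pred0 -> [pchar (laurent K)] =i pred0.
Proof. by move/(rmorphism_pchar0 (@lconst K)). Qed.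

(** The [t]-adic valuation, with the junk value [0] at [0]. *)
Definition lval (K : fieldType) (f : laurent K) : int :=
  if pselect (exists a, supp_from a (lcoef f) /\ lcoef f a != 0) is left h
  then projT1 (cid h) else 0.

Lemma lvalP (K : fieldType) (f : laurent K) : f != 0 ->
  supp_from (lval f) (lcoef f) /\ lcoef f (lval f) != 0.
Proof.
move=> f0; rewrite /lval; case: pselect => [h|]; first exact: (projT2 (cid h)).
by case; have [a fa fa0] := laurent_leadP f0; exists a.
Qed.

Fact mulr_shuffle (R : comPzRingType) (a m n b : R) : a * (m * n * b) = m * (n * a * b).
Proof. by rewrite -(mulrA m) (mulrCA a) (mulrCA a) -mulrA. Qed.

Section NewtonPuiseux.
Variable K : fieldType.
Hypotheses (Kc : algebraically_closed K) (K0 : [pchar K] =i pred0).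

(** The least valuation of a root of [p] is a rational number [k / m], read off
    the last side of the Newton polygon.  Replacing [t] by [t ^ m] and then [x]
    by [t ^ k x] gives, up to a power of [t], an integral monic polynomial whose
    reduction [qb] is not a power of ['X].  The vanishing subleading coefficient
    prevents [qb] from being a power of any other ['X - a] in characteristic
    zero.  Hence [qb] splits into coprime factors, and Hensel's lemma yields a
    factor [g] of smaller degree.  The morphism [s] stands for the dilations
    that follow in the induction. *)
Lemma newton_step (p : {poly laurent K}) d : size p = d.+2 -> p \is monic ->
  p`_d = 0 -> (exists i, (i <= d)%N && (p`_i != 0)) ->
  exists (m : nat) (g : {poly laurent K}), (1 < size g < d.+2)%N /\
    forall (s : {rmorphism laurent K -> laurent K}) x, root (map_poly s g) x ->
      exists y, root (map_poly s (map_poly (dil m) p)) y.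
Proof.
move=> ps pm pd [i1 /andP[i1d pi1]].
pose ratio (i : 'I_d.+1) : rat := (lval p`_i)%:Q / (d.+1 - i)%:R.
(* The point of index [i] of the Newton polygon is joined to the last one,
     [(d.+1, 0)], by a segment of slope [- ratio i]; the largest slope is that
     of the last side. *)
have [i0 pi0 i0min] : exists2 i0 : 'I_d.+1, p`_i0 != 0 &
    forall i : 'I_d.+1, p`_i != 0 -> ratio i0 <= ratio i.
  have lt1 : (i1 < d.+1)%N by [].
  pose j1 := Ordinal lt1.
  by case: (@arg_minP _ _ _ j1 (fun i => p`_i != 0) ratio pi1) => i Pi H; exists i.
pose m := (d.+1 - i0)%N; pose k := lval p`_i0.
have m0 : (0 < m)%N by rewrite subn_gt0.
have mE : m.-1.+1 = m by rewrite prednK.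
have [sk nk] := lvalP pi0; rewrite -/k in sk nk.
pose q : {poly laurent K} := \poly_(i < d.+2) (mono (- (k * (d.+1 - i)%:Z)) 1 * dil m.-1 p`_i).
have qE i : (i < d.+2)%N -> q`_i = mono (- (k * (d.+1 - i)%:Z)) 1 * dil m.-1 p`_i.
  by move=> id2; rewrite coef_poly id2.
have qcoef i (n : int) : (i < d.+2)%N ->
    lcoef q`_i n = lcoef (dil m.-1 p`_i) (n + k * (d.+1 - i)%:Z).
  by move=> id2; rewrite qE // lcoef_monoM mul1r opprK.
have plead : p`_d.+1 = 1 by rewrite -(monicP pm) lead_coefE ps.
have qlead : q`_d.+1 = 1.
  by rewrite qE // plead rmorph1 subnn mulr0 oppr0 mono01 mulr1.
have qi : integral_coefs q.
  move=> i; have [id2|id2] := ltnP i d.+2; last by rewrite nth_default // (leq_trans (size_poly _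
    _)).
  move: (id2); rewrite ltnS leq_eqVlt => /orP[/eqP->|id1]; first by rewrite qlead;
    exact: supp_from1.
  have [pi|pi] := eqVneq p`_i 0; first by rewrite qE // pi rmorph0 mulr0.
  move=> n n0; rewrite qcoef //; have [si _] := lvalP pi.
  apply: (supp_from_dil si); rewrite mE.
  have := i0min (Ordinal id1) pi; rewrite /ratio /= -/k -/m.
  rewrite ler_pdivrMr ?ltr0n // mulrAC ler_pdivlMr ?ltr0n ?subn_gt0 //.
  rewrite !pmulrn -!intrM ler_int => H.
  by rewrite -[X in _ < X]add0r; apply: ltr_leD.
pose qb := \poly_(i < d.+2) lcoef q`_i 0.
have qbE i : (i < d.+2)%N -> qb`_i = lcoef q`_i 0 by move=> id2; rewrite coef_poly id2.
have qblead : qb`_d.+1 = 1 by rewrite qbE // qlead.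
have qbs : size qb = d.+2 by apply: size_poly_eq; rewrite qlead oner_eq0.
have qbm : qb \is monic by rewrite monicE lead_coefE qbs qblead.
have qbd : qb`_d = 0 by rewrite qbE // qcoef // pd rmorph0.
have qbi0 : qb`_i0 != 0.
  rewrite qbE ?qcoef ?(leq_trans (ltn_ord i0)) // add0r -/m -mE lcoef_dil //.
have [|a qa] := Kc (p := qb); first by rewrite qbs.
have [r [h0 h0a qbh]] := multiplicity_XsubC qb a.
rewrite monic_neq0 //= in h0a.
have r0 : (0 < r)%N.
  by rewrite lt0n; apply: contraTneq qa => r0; rewrite qbh r0 expr0 mulr1.
have Xs : size (('X - a%:P) ^+ r) = r.+1 by rewrite size_exp_XsubC.
have h00 : h0 != 0 by apply: contra_neq (monic_neq0 qbm) => h00; rewrite qbh h00 mul0r.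
have h0m : h0 \is monic by move: qbm; rewrite qbh monicMr // monic_exp ?monicXsubC.
have sz : (size h0 + r = d.+2)%N.
  by rewrite -qbs qbh size_monicM ?monic_exp ?monicXsubC ?expf_neq0 ?polyXsubC_eq0 // Xs addnS.
have rd : (r < d.+1)%N.
  rewrite ltn_neqAle; apply/andP; split; last first.
    by rewrite -ltnS -sz -[r.+1]add1n leq_add2r size_poly_gt0.
  apply/eqP => rd.
  have h01 : h0 = 1.
    have /size_poly1P[c c0 h0c] : size h0 == 1%N by apply/eqP/(@addIn r); rewrite sz rd add1n.
    by move: h0m; rewrite h0c monicE lead_coefC => /eqP ->.
  have qbX : qb = 'X^(d.+1) \Po ('X + (- a)%:P).
    by rewrite comp_Xn_poly qbh h01 mul1r rd polyCN.
  have a0 : a = 0.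
    have := coef_comp_shift_low (p := 'X^(d.+1)) (- a) (d := d).
    rewrite size_polyXn => /(_ (leqnn _)); rewrite -qbX qbd !coefXn eqxx ltn_eqF // add0r mul1r.
    move/esym/eqP; rewrite -mulr_natr mulf_eq0 oppr_eq0; move/pcharf0P : K0 => ->.
    by rewrite orbF => /eqP.
  move: qbi0; rewrite qbX a0 oppr0 addr0 comp_polyXr coefXn ltn_eqF ?eqxx //.
have [||||||||g [h [qgh gs]]] := @hensel K q d.+1 r (('X - a%:P) ^+ r) h0.
- exact: size_poly.
- exact: qi.
- by rewrite monic_exp ?monicXsubC.
- exact: Xs.
- exact: ltnW.
- by rewrite -(subSn (ltnW rd)) -sz addnK.
- by rewrite coprimep_expl // coprimep_sym coprimep_XsubC.
- move=> i; rewrite mulrC -qbh; have [id2|id2] := ltnP i d.+2; first by rewrite qbE.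
  by rewrite !nth_default ?qbs // (leq_trans (size_poly _ _)).
exists m.-1, g; split; first by rewrite gs !ltnS r0.
move=> s x gx; exists (s (mono k 1) * x).
have : root (map_poly s q) x by rewrite qgh rmorphM rootM gx.
rewrite !rootE => /eqP qx.
have qs : (size (map_poly s q) <= d.+2)%N by rewrite size_map_poly size_poly.
have ps' : (size (map_poly s (map_poly (dil m.-1) p)) <= d.+2)%N by rewrite !size_map_poly ps.
rewrite (horner_coef_wide _ qs) in qx; rewrite (horner_coef_wide _ ps').
suff -> : \sum_(i < d.+2) (map_poly s (map_poly (dil m.-1) p))`_i * (s (mono k 1) * x) ^+ i =
    s (mono (k * d.+1%:Z) 1) * \sum_(i < d.+2) (map_poly s q)`_i * x ^+ i.
  by rewrite qx mulr0.
rewrite mulr_sumr; apply: eq_bigr => i _; rewrite !coef_map /= qE // exprMn -rmorphXn monoX expr1n.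
have -> : mono (k *+ i) 1 = mono (k * d.+1%:Z) 1 * mono (- (k * (d.+1 - i)%:Z)) 1 :> laurent K.
  rewrite monoM mulr1 -mulrBr -mulr_natr natz; congr (mono (_ * _) _).
  by rewrite subzn ?leq_subr // subKn // -ltnS.
rewrite !(rmorphM s); exact: mulr_shuffle.
Qed.

(** By induction on the degree: a translation kills the subleading coefficient,
    and [newton_step] then lowers the degree unless a power of ['X] is left. *)
Theorem newton_puiseux (p : {poly laurent K}) : (1 < size p)%N ->
  exists (m : nat) x, root (map_poly (dil m) p) x.
Proof.
elim/ltn_ind: {p}(size p) {-2}p (erefl (size p)) => n IH p pn; rewrite pn => n1.
case: n => [|[|d]] // in IH pn n1 *.
wlog pm : p pn / p \is monic => [wl|].
  have l0 : lead_coef p != 0 by rewrite lead_coef_eq0 -size_poly_eq0 pn.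
  have [||m [x px]] := wl ((lead_coef p)^-1 *: p).
  - by rewrite size_scale ?invr_eq0.
  - by rewrite monicE lead_coefZ mulVf.
  exists m, x; move: px; rewrite map_polyZ rootZ // fmorph_eq0 invr_eq0 //.
have plead : p`_d.+1 = 1 by rewrite -(monicP pm) lead_coefE pn.
have d0 : d.+1%:R != 0 :> laurent K.
  by have /pcharf0P -> := laurent_pchar0 K0.
pose c := - p`_d / d.+1%:R.
pose p1 : {poly laurent K} := p \Po ('X + c%:P).
have p1s : size p1 = d.+2 by rewrite size_comp_poly2 ?size_XaddC.
have p1lead : p1`_d.+1 = 1 by rewrite coef_comp_shift_lead ?pn.
have p1m : p1 \is monic by rewrite monicE lead_coefE p1s p1lead.
have p1d : p1`_d = 0.
  by rewrite coef_comp_shift_low ?pn // plead mul1r -mulr_natr mulfVK // addrN.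
have back m y : root (map_poly (dil m) p1) y -> exists x, root (map_poly (dil m) p) x.
  rewrite map_comp_poly rmorphD /= map_polyX map_polyC rootE horner_comp => py.
  by exists (('X + (dil m c)%:P).[y]); rewrite rootE.
have [ex|nex] := pselect (exists i, (i <= d)%N && (p1`_i != 0)); last first.
  exists 0%N; apply: (back _ 0); rewrite rootE horner_coef0 coef_map /=.
  by apply/eqP; rewrite (_ : p1`_0 = 0) ?rmorph0 //; apply: contrapT => /eqP H; apply: nex;
    exists 0%N.
have [m [g [/andP[g1 g2] gr]]] := newton_step p1s p1m p1d ex.
have [m' [x gx]] := IH _ g2 g erefl g1.
have [y] := gr (dil m') x gx.
rewrite -map_poly_comp (eq_map_poly (dil_comp m' m)) => py.
by exists (m'.+1 * m.+1).-1; exact: back py.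
Qed.

End NewtonPuiseux.

(** * Integrality of roots over the power series *)

(** If the root had a pole, the leading term of [y ^ d] could not be cancelled by
    the terms of lower degree in [y]. *)
Lemma integral_coefs_root (E : fieldType) (p : {poly laurent E}) (y : laurent E) :
  p \is monic -> integral_coefs p -> root p y -> supp_from 0 (lcoef y).
Proof.
move=> pm pi py; have [->|y0] := eqVneq y 0; first exact: supp_from0.
have [a ya ya0] := laurent_leadP y0.
have [a0|a0] := leP 0 a; first exact: supp_from_le ya.
have p0 : (0 < size p)%N by rewrite size_poly_gt0 monic_neq0.
case e : (size p) p0 => [//|d] _.
move: py; rewrite rootE horner_coef e big_ord_recr /=.
have -> : p`_d = 1 by rewrite -(monicP pm) lead_coefE e.
rewrite mul1r => /eqP /(congr1 (fun f => lcoef f (a *+ d))).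
rewrite lcoefD lcoefX_low // lcoef_sum big1 => [|i _]; last first.
  have /(_ (a *+ d)) := supp_fromM (pi i) (@supp_fromX _ y i _ ya); apply.
  by rewrite add0r ltr_nMn2l.
by rewrite add0r lcoef0 => /eqP; rewrite expf_eq0 (negPf ya0) andbF.
Qed.

(** Suppose that [p] is not integral, and scale it to an integral polynomial with
    nonzero reduction; the degree [r] of the reduction is less than that of [p].
    Hensel's lemma then splits off a factor of degree [r], carrying the
    integral roots.  Irreducibility forces [r = 0], and no root is integral. *)
Lemma irreducible_integral (F E : fieldType) (s : {rmorphism F -> E}) (N : nat)
    (p : {poly laurent F}) (y : laurent E) :
  p \is monic -> irreducible_poly p -> supp_from 0 (lcoef y) ->
  root (map_poly (dil N) (map_poly (lmap s) p)) y -> integral_coefs p.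
Proof.
move=> pm [p1 pirr] yi py; apply: contrapT => npi.
case ps : (size p) p1 => [|[|d]] // _.
have plead : p`_d.+1 = 1 by rewrite -(monicP pm) lead_coefE ps.
have p0 : p != 0 by rewrite monic_neq0.
have [i0 pi0 i0min] : exists2 i0 : 'I_d.+2, p`_i0 != 0 &
    forall i : 'I_d.+2, p`_i != 0 -> lval p`_i0 <= lval p`_i.
  have pd : p`_(@ord_max d.+1) != 0 by rewrite plead oner_eq0.
  by case: (@arg_minP _ _ _ ord_max (fun i : 'I_d.+2 => p`_i != 0) (fun i => lval p`_i) pd) => i
    Pi H; exists i.
pose w := lval p`_i0.
have wmin i : supp_from w (lcoef p`_i).
  have [id2|id2] := ltnP i d.+2; last by rewrite nth_default ?ps.
  have [->|pi] := eqVneq p`_i 0; first by [].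
  have [si _] := lvalP pi; apply: supp_from_le si.
  exact: (i0min (Ordinal id2)).
have w0 : w < 0.
  rewrite ltNge; apply/negP => w0; apply: npi => i.
  exact: supp_from_le (wmin i).
pose q : {poly laurent F} := mono (- w) 1 *: p.
have c0 : mono (- w) 1 != 0 :> laurent F by rewrite mono_neq0 ?oner_eq0.
have qcoef i n : lcoef q`_i n = lcoef p`_i (n + w) by rewrite coefZ lcoef_monoM mul1r opprK.
have qi : integral_coefs q by move=> i n n0; rewrite qcoef wmin // gtrDr.
have qs : size q = d.+2 by rewrite size_scale.
pose qb := \poly_(i < d.+1) lcoef q`_i 0.
have qbE i : qb`_i = lcoef q`_i 0.
  rewrite coef_poly; case: ltnP => //; rewrite leq_eqVlt => /orP[/eqP<-|di].
    by rewrite qcoef plead lcoef1 add0r lt_eqF.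
  by rewrite nth_default ?qs.
have qb0 : qb != 0.
  apply: contra_neq (proj2 (lvalP pi0)) => qb0; have := qbE i0; rewrite qb0 coef0 qcoef add0r.
  by move=> <-.
have lqb : lead_coef qb != 0 by rewrite lead_coef_eq0.
case qbs : (size qb) => [|r]; first by move/eqP : qbs; rewrite size_poly_eq0 (negPf qb0).
have rd : (r <= d)%N by rewrite -ltnS -qbs size_poly.
have [r0|r0] := posnP r.
  have : root (map_poly (dil N) (map_poly (lmap s) q)) y.
    by rewrite !map_polyZ rootZ // !fmorph_eq0.
  rewrite rootE (@horner_coef_wide _ d.+2) ?size_map_poly ?qs // big_ord_recl => /eqP.
  move/(congr1 (fun f => lcoef f 0)); rewrite lcoefD lcoef_sum big1 => [|i _].
    rewrite addr0 expr0 mulr1 !coef_map /= lcoef_dil_const lcoef_lmap -qbE.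
    move=> /eqP; rewrite lcoef0 fmorph_eq0 => /eqP qb00; move/eqP: lqb; apply.
    by rewrite lead_coefE qbs r0.
  have ti : supp_from 0 (lcoef (dil N (lmap s q`_i.+1))).
    by apply: supp_from_dil0; apply: supp_from_twist.
  rewrite lift0 !coef_map.
  have yXi : supp_from 0 (lcoef (y ^+ i.+1)) by have := supp_fromX (m := i.+1) yi; rewrite mul0rn.
  have := lcoefM_low ti yXi; rewrite addr0 => ->.
  rewrite lcoef_dil_const lcoef_lmap -qbE nth_default ?rmorph0 ?mul0r //.
  by rewrite qbs r0.
have [||||||||g [h [qgh gs]]] := @hensel F q d.+1 r ((lead_coef qb)^-1 *: qb) (lead_coef qb)%:P.
- by rewrite qs.
- exact: qi.
- by rewrite monicE lead_coefZ mulVf.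
- by rewrite size_scale ?invr_eq0.
- exact: leqW.
- by rewrite size_polyC lqb.
- by rewrite -alg_polyC coprimepZr // coprimep1.
- by move=> i; rewrite mulrC mul_polyC scalerA mulfV // scale1r qbE.
have : g %= p.
  apply: pirr; first by rewrite gs; move: r0; case: (r).
  by rewrite -(@dvdpZr _ (mono (- w) 1)) // -/q qgh dvdp_mulr.
move/eqp_size; rewrite gs ps; move: rd; lia.
Qed.

(** * The field of Puiseux series *)

Section PuiseuxSeries.
Variable K : fieldType.
Implicit Types (n m : nat) (g h : laurent K) (q : rat).

(** The series [g(t ^ (1 / n.+1))], as a function of the exponent. *)
Definition spread n g (q : rat) : K :=
  let x := q * n.+1%:R in if denq x == 1 then lcoef g (numq x) else 0.

Lemma spread_frac n g (k : int) : spread n g (k%:~R / n.+1%:R) = lcoef g k.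
Proof. by rewrite /spread mulfVK ?pnatr_eq0 // denq_int eqxx numq_int. Qed.

Variant frac_spec n q : Prop :=
  | IsFrac k of q = k%:~R / n.+1%:R
  | NotFrac of (forall g, spread n g q = 0) & (forall k : int, q * n.+1%:R <> k%:~R).

Lemma fracP n q : frac_spec n q.
Proof.
have [e|e] := boolP (denq (q * n.+1%:R) == 1).
  apply: (@IsFrac _ _ (numq (q * n.+1%:R))).
  by apply: (@mulIf _ n.+1%:R); rewrite ?pnatr_eq0 // mulfVK ?pnatr_eq0 // [RHS]numqE (eqP e) mulr1.
apply: NotFrac => [g|k]; first by rewrite /spread (negPf e).
by move=> qk; rewrite qk denq_int eqxx in e.
Qed.

Lemma spread_inj n : injective (spread n).
Proof.
move=> g h e; apply: laurent_eqP => k.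
by have := congr1 (fun f => f (k%:~R / n.+1%:R)) e; rewrite !spread_frac.
Qed.

Lemma spread_dil n m g : spread n g = spread (n.+1 * m.+1).-1 (dil m g).
Proof.
apply/funext => q; have e : (n.+1 * m.+1).-1.+1 = (n.+1 * m.+1)%N by rewrite prednK.
have [k qk|qn nk] := fracP n q.
  have -> : q = (k * m.+1%:Z)%:~R / (n.+1 * m.+1).-1.+1%:R.
    by rewrite e natrM qk intrM invfM mulrACA divff ?mulr1 ?pnatr_eq0.
  rewrite spread_frac lcoef_dil -(spread_frac n g); congr spread.
  by rewrite e natrM intrM invfM mulrACA divff ?mulr1 ?pnatr_eq0.
rewrite qn; have [k qk|-> //] := fracP (n.+1 * m.+1).-1 q.
rewrite qk spread_frac lcoef_dil0 //; apply/negP => /dvdzP[j jk].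
apply: (nk j); rewrite qk jk e natrM intrM invfM mulrACA divff ?pnatr_eq0 // mulr1.
by rewrite mulfVK ?pnatr_eq0.
Qed.

Definition puiseux_set : set (rat -> K) := [set f | exists n g, f = spread n g].

(** Puiseux series with coefficients in [K]: the union over [n] of the fields
    of Laurent series in [t ^ (1 / n.+1)]. *)
Definition puiseux : Type := set_type puiseux_set.

HB.instance Definition _ := Choice.on puiseux.

Definition pcoef (f : puiseux) : rat -> K := set_val f.

Lemma puiseux_eqP (f g : puiseux) : pcoef f =1 pcoef g -> f = g.
Proof. by move=> fg; apply: val_inj; exact/funext. Qed.

Lemma pz_subproof n g : puiseux_set (spread n g). Proof. by exists n, g. Qed.

Definition pz n g : puiseux := SigSub (mem_set (pz_subproof n g)).

Lemma pcoef_pz n g : pcoef (pz n g) = spread n g. Proof. by []. Qed.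

Lemma pzP (f : puiseux) : exists n g, f = pz n g.
Proof. by have [n [g fE]] := set_valP f; exists n, g; exact: val_inj. Qed.

Lemma pz_inj n : injective (pz n).
Proof. by move=> g h /(congr1 pcoef); exact: spread_inj. Qed.

Lemma pz_dil n m g : pz n g = pz (n.+1 * m.+1).-1 (dil m g).
Proof. by apply: val_inj; exact: spread_dil. Qed.

Lemma pz_dil' n m g : pz n g = pz (m.+1 * n.+1).-1 (dil m g).
Proof. by rewrite mulnC -pz_dil. Qed.

Lemma pzP2 (f1 f2 : puiseux) : exists n g1 g2, f1 = pz n g1 /\ f2 = pz n g2.
Proof.
have [n1 [g1 ->]] := pzP f1; have [n2 [g2 ->]] := pzP f2.
by exists (n1.+1 * n2.+1).-1, (dil n2 g1), (dil n1 g2); rewrite -pz_dil -pz_dil'.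
Qed.

Lemma pzP3 (f1 f2 f3 : puiseux) :
  exists n g1 g2 g3, [/\ f1 = pz n g1, f2 = pz n g2 & f3 = pz n g3].
Proof.
have [n [g1 [g2 [-> ->]]]] := pzP2 f1 f2; have [m [g3 ->]] := pzP f3.
exists (n.+1 * m.+1).-1, (dil m g1), (dil m g2), (dil n g3).
by rewrite -!pz_dil -pz_dil'.
Qed.

(** Operations are computed in [t ^ (1 / n.+1)] for a common denominator [n.+1];
    as they commute with dilations, the result does not depend on it. *)
Definition puiseux_lift2 (op : laurent K -> laurent K -> laurent K) (f1 f2 : puiseux) : puiseux :=
  let n := projT1 (cid (pzP2 f1 f2)) in
  let g1 := projT1 (cid (projT2 (cid (pzP2 f1 f2)))) in
  let g2 := projT1 (cid (projT2 (cid (projT2 (cid (pzP2 f1 f2)))))) in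
  pz n (op g1 g2).

Lemma puiseux_lift2E op n g1 g2 : (forall m, {morph dil m : x y / op x y}) ->
  puiseux_lift2 op (pz n g1) (pz n g2) = pz n (op g1 g2).
Proof.
move=> opM; rewrite /puiseux_lift2; case: cid => m /= ?; case: cid => h1 /= ?.
case: cid => h2 /= [e1 e2].
rewrite (pz_dil' m n) (pz_dil n m) !opM; congr (pz _ (op _ _)).
  by apply: (@pz_inj (n.+1 * m.+1).-1); rewrite -pz_dil -pz_dil'.
by apply: (@pz_inj (n.+1 * m.+1).-1); rewrite -pz_dil -pz_dil'.
Qed.

Definition puiseux_add := puiseux_lift2 +%R.
Definition puiseux_mul := puiseux_lift2 *%R.
Definition puiseux_zero := pz 0 0.
Definition puiseux_one := pz 0 1.
Definition puiseux_opp (f : puiseux) : puiseux :=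
  let n := projT1 (cid (pzP f)) in pz n (- projT1 (cid (projT2 (cid (pzP f))))).
Definition puiseux_inv (f : puiseux) : puiseux :=
  let n := projT1 (cid (pzP f)) in pz n (projT1 (cid (projT2 (cid (pzP f)))))^-1.

Lemma puiseux_addE n g1 g2 : puiseux_add (pz n g1) (pz n g2) = pz n (g1 + g2).
Proof. by apply: puiseux_lift2E => m x y; rewrite rmorphD. Qed.

Lemma puiseux_mulE n g1 g2 : puiseux_mul (pz n g1) (pz n g2) = pz n (g1 * g2).
Proof. by apply: puiseux_lift2E => m x y; rewrite rmorphM. Qed.

Lemma puiseux_zeroE n : puiseux_zero = pz n 0.
Proof. by rewrite /puiseux_zero (pz_dil 0 n) rmorph0 mul1n. Qed.

Lemma puiseux_oneE n : puiseux_one = pz n 1.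
Proof. by rewrite /puiseux_one (pz_dil 0 n) rmorph1 mul1n. Qed.

Lemma puiseux_addA : associative puiseux_add.
Proof.
move=> f1 f2 f3; have [n [g1 [g2 [g3 [-> -> ->]]]]] := pzP3 f1 f2 f3.
by rewrite !puiseux_addE addrA.
Qed.

Lemma puiseux_addC : commutative puiseux_add.
Proof.
move=> f1 f2; have [n [g1 [g2 [-> ->]]]] := pzP2 f1 f2.
by rewrite !puiseux_addE addrC.
Qed.

Lemma puiseux_add0 : left_id puiseux_zero puiseux_add.
Proof.
by move=> f; have [n [g ->]] := pzP f; rewrite (puiseux_zeroE n) puiseux_addE add0r.
Qed.

Lemma puiseux_addN : left_inverse puiseux_zero puiseux_opp puiseux_add.
Proof.
move=> f; rewrite /puiseux_opp; case: cid => n /= ?; case: cid => g /= fE.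
by rewrite fE puiseux_addE addNr (puiseux_zeroE n).
Qed.

HB.instance Definition _ := GRing.isZmodule.Build puiseux
  puiseux_addA puiseux_addC puiseux_add0 puiseux_addN.

Lemma puiseux_mulA : associative puiseux_mul.
Proof.
move=> f1 f2 f3; have [n [g1 [g2 [g3 [-> -> ->]]]]] := pzP3 f1 f2 f3.
by rewrite !puiseux_mulE mulrA.
Qed.

Lemma puiseux_mulC : commutative puiseux_mul.
Proof.
move=> f1 f2; have [n [g1 [g2 [-> ->]]]] := pzP2 f1 f2.
by rewrite !puiseux_mulE mulrC.
Qed.

Lemma puiseux_mul1 : left_id puiseux_one puiseux_mul.
Proof.
by move=> f; have [n [g ->]] := pzP f; rewrite (puiseux_oneE n) puiseux_mulE mul1r.
Qed.

Lemma puiseux_mulDl : left_distributive puiseux_mul +%R.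
Proof.
move=> f1 f2 f3; have [n [g1 [g2 [g3 [-> -> ->]]]]] := pzP3 f1 f2 f3.
rewrite -![_ + _]/(puiseux_add _ _).
by rewrite !puiseux_addE !puiseux_mulE puiseux_addE mulrDl.
Qed.

Lemma puiseux_oner_neq0 : puiseux_one != 0.
Proof. by apply/eqP => /pz_inj /eqP; rewrite oner_eq0. Qed.

HB.instance Definition _ := GRing.Zmodule_isComNzRing.Build puiseux
  puiseux_mulA puiseux_mulC puiseux_mul1 puiseux_mulDl puiseux_oner_neq0.

Lemma puiseux_mulV (f : puiseux) : f != 0 -> puiseux_inv f * f = 1.
Proof.
rewrite /puiseux_inv; case: cid => n /= ?; case: cid => g /= fE f0.
have g0 : g != 0 by apply: contra_neq f0 => g0; rewrite fE g0 -puiseux_zeroE.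
by rewrite [X in _ * X]fE [LHS]puiseux_mulE mulVf // -puiseux_oneE.
Qed.

Lemma puiseux_inv0 : puiseux_inv 0 = 0.
Proof.
rewrite /puiseux_inv; case: cid => n /= ?; case: cid => g /= fE.
have -> : g = 0 by apply: (@pz_inj n); rewrite -fE -puiseux_zeroE.
by rewrite invr0 -puiseux_zeroE.
Qed.

HB.instance Definition _ :=
  GRing.ComNzRing_isField.Build puiseux puiseux_mulV puiseux_inv0.

Lemma pz_additive n : zmod_morphism (pz n).
Proof.
move=> g h; apply: (addIr (pz n h)); rewrite subrK.
by rewrite [LHS]puiseux_addE subrK.
Qed.

Lemma pz_multiplicative n : monoid_morphism (pz n).
Proof. by split=> [|g h]; [exact/esym/puiseux_oneE|exact/esym/puiseux_mulE]. Qed.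

HB.instance Definition _ n := GRing.isZmodMorphism.Build _ _ (pz n) (pz_additive n).
HB.instance Definition _ n := GRing.isMonoidMorphism.Build _ _ (pz n) (pz_multiplicative n).

Lemma pcoef_frac n g (k : int) : pcoef (pz n g) (k%:~R / n.+1%:R) = lcoef g k.
Proof. exact: spread_frac. Qed.

Lemma pcoefD (f g : puiseux) q : pcoef (f + g) q = pcoef f q + pcoef g q.
Proof.
have [n [a [b [-> ->]]]] := pzP2 f g; rewrite -rmorphD !pcoef_pz.
by rewrite /spread; case: ifP => // _; rewrite addr0.
Qed.

Lemma pcoef0 q : pcoef 0 q = 0.
Proof. by rewrite -[0]/(pz 0 0) pcoef_pz /spread; case: ifP. Qed.

Lemma pcoefN (f : puiseux) q : pcoef (- f) q = - pcoef f q.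
Proof. by apply: (addIr (pcoef f q)); rewrite -pcoefD !addNr pcoef0. Qed.

Lemma pcoefB (f g : puiseux) q : pcoef (f - g) q = pcoef f q - pcoef g q.
Proof. by rewrite pcoefD pcoefN. Qed.

Lemma pcoef_monoM n k c (f : puiseux) q :
  pcoef (pz n (mono k c) * f) q = c * pcoef f (q - k%:~R / n.+1%:R).
Proof.
have [m [g ->]] := pzP f.
have e : (n.+1 * m.+1).-1.+1 = (n.+1 * m.+1)%N by rewrite prednK.
rewrite (pz_dil n m) (pz_dil' m n) -rmorphM dil_mono.
have kE : k%:~R / n.+1%:R = (k * m.+1%:Z)%:~R / (n.+1 * m.+1).-1.+1%:R :> rat.
  by rewrite e natrM intrM invfM mulrACA divff ?mulr1 ?pnatr_eq0.
rewrite !pcoef_pz kE; set N := (n.+1 * m.+1).-1; set k' := k * _.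
have [j ->|qn nj] := fracP N q.
  by rewrite -mulrBl -intrB !spread_frac lcoef_monoM.
rewrite qn; have [j qj|-> //] := fracP N (q - k'%:~R / N.+1%:R); last by rewrite mulr0.
case: (nj (j + k')); move/eqP: qj; rewrite subr_eq => /eqP ->.
by rewrite -mulrDl mulfVK ?pnatr_eq0 // intrD.
Qed.

Definition pconst (c : K) : puiseux := pz 0 (mono 0 c).

Lemma pconst_additive : zmod_morphism pconst.
Proof.
move=> c d; rewrite /pconst -rmorphB; congr pz.
by apply: (addIr (mono 0 d)); rewrite -monoD !subrK.
Qed.

Lemma pconst_multiplicative : monoid_morphism pconst.
Proof. by split=> [|c d]; rewrite /pconst ?mono01 ?rmorph1 // -rmorphM monoM. Qed.

HB.instance Definition _ := GRing.isZmodMorphism.Build _ _ pconst pconst_additive.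
HB.instance Definition _ := GRing.isMonoidMorphism.Build _ _ pconst pconst_multiplicative.

Lemma pconstE n c : pconst c = pz n (mono 0 c).
Proof.
apply: puiseux_eqP => q; rewrite -[pz n _]mulr1 -[pconst c]mulr1 /pconst !pcoef_monoM.
by rewrite !mul0r.
Qed.

Lemma pz_poly (p : {poly puiseux}) : exists n P, p = map_poly (pz n) P.
Proof.
elim/poly_ind: p => [|p c [n [P ->]]]; first by exists 0%N, 0; rewrite map_poly0.
have [m [g ->]] := pzP c.
exists (n.+1 * m.+1).-1, (map_poly (dil m) P * 'X + (dil n g)%:P).
rewrite rmorphD rmorphM /= map_polyX map_polyC /= -pz_dil' -map_poly_comp.
by congr (_ * _ + _); apply: eq_map_poly => h; exact: pz_dil.
Qed.

Lemma puiseux_algebraically_closed :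
  algebraically_closed K -> [pchar K] =i pred0 -> algebraically_closed puiseux.
Proof.
move=> Kc K0 p; have [n [P ->]] := pz_poly p.
rewrite size_map_poly => /(newton_puiseux Kc K0)[m [x Px]].
exists (pz (n.+1 * m.+1).-1 x).
have -> : map_poly (pz n) P = map_poly (pz (n.+1 * m.+1).-1) (map_poly (dil m) P).
  by rewrite -map_poly_comp; apply: eq_map_poly => h; exact: pz_dil.
exact: rmorph_root.
Qed.

Section Twist.
Variables (s : {rmorphism K -> K}) (chi : rat -> K).
Hypotheses (chi0 : chi 0 = 1) (chiD : {morph chi : q r / q + r >-> q * r}).

Lemma ptwist_subproof (f : puiseux) : puiseux_set (fun q => s (pcoef f q) * chi q).
Proof.
have [n [g ->]] := pzP f; exists n, (ltwist s (fun k => chi (k%:~R / n.+1%:R)) g).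
apply/funext => q; rewrite pcoef_pz; have [k ->|qn _] := fracP n q.
  by rewrite !spread_frac lcoef_twist.
by rewrite !qn rmorph0 mul0r.
Qed.

Definition ptwist (f : puiseux) : puiseux := SigSub (mem_set (ptwist_subproof f)).

Lemma pcoef_twist f q : pcoef (ptwist f) q = s (pcoef f q) * chi q.
Proof. by []. Qed.

Lemma ptwist_pz n g : ptwist (pz n g) = pz n (ltwist s (fun k => chi (k%:~R / n.+1%:R)) g).
Proof.
apply: puiseux_eqP => q; rewrite pcoef_twist !pcoef_pz.
have [k ->|qn _] := fracP n q; first by rewrite !spread_frac lcoef_twist.
by rewrite !qn rmorph0 mul0r.
Qed.

Lemma ptwist_additive : zmod_morphism ptwist.
Proof.
move=> f g; apply: puiseux_eqP => q; rewrite pcoefB !pcoef_twist pcoefB rmorphB.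
by rewrite mulrBl.
Qed.

Lemma ptwist_multiplicative : monoid_morphism ptwist.
Proof.
split=> [|f g].
  by rewrite -(rmorph1 (pz 0)) ptwist_pz ltwist1.
have [n [a [b [-> ->]]]] := pzP2 f g.
rewrite -rmorphM !ptwist_pz ltwistM ?rmorphM // => k l.
by rewrite intrD mulrDl chiD.
Qed.

Lemma ptwist_rmorphism : exists T : {rmorphism puiseux -> puiseux}, T =1 ptwist.
Proof.
pose A := GRing.isZmodMorphism.Build _ _ ptwist ptwist_additive.
pose M := GRing.isMonoidMorphism.Build _ _ ptwist ptwist_multiplicative.
pose T : {rmorphism puiseux -> puiseux} := HB.pack ptwist A M.
by exists T.
Qed.

End Twist.
End PuiseuxSeries.

(** * Embeddings of algebraic extensions *)

Lemma ptws_near (X : choiceType) (Y : choiceType)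
    (f : {ptws X -> discrete_topology Y}) (x : X) :
  \forall g \near f, (g : X -> Y) x = f x.
Proof.
apply: (@locally_continuous {ptws X -> discrete_topology Y} Y (fun g => g x)).
exact: (@proj_continuousT X (fun=> discrete_topology Y)).
Qed.

Lemma ptws_near3 (X : choiceType) (Y : choiceType)
    (f : {ptws X -> discrete_topology Y}) (x y z : X) :
  nbhs f [set g : X -> Y | [/\ g x = f x, g y = f y & g z = f z]].
Proof.
by apply: (@filterS3 {ptws X -> discrete_topology Y} (nbhs f) _ _ _ _ _ _
  (ptws_near f x) (ptws_near f y) (ptws_near f z)).
Qed.

Lemma finite_roots (K : fieldType) (p : {poly K}) : p != 0 ->
  exists rs : seq K, forall x, root p x -> x \in rs.
Proof.
elim/ltn_ind: {p}(size p) {-2}p (erefl (size p)) => n IH p pn p0.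
have [[x px]|nx] := pselect (exists x, root p x); last first.
  by exists [::] => x px; case: nx; exists x.
have /factor_theorem[q pq] := px.
have q0 : q != 0 by apply: contra_neq p0 => q0; rewrite pq q0 mul0r.
have [|rs rsP] := IH (size q) _ q erefl q0.
  by rewrite -pn pq size_Mmonic ?monicXsubC // size_XsubC addn2.
exists (x :: rs) => y; rewrite pq rootM root_XsubC inE orbC => /orP[->//|/rsP ->].
by rewrite orbT.
Qed.

(** In characteristic zero, dividing [p] by its gcd with [p^`()] leaves a
    separable nonconstant polynomial. *)
Lemma separably_closed_pchar0 (K : fieldType) : [pchar K] =i pred0 ->
  separably_closed K -> algebraically_closed K.
Proof.
move=> /pcharf0P K0 Kc p p1; have p0 : p != 0 by rewrite -size_poly_gt0 ltnW.
have pd : p %/ gcdp p p^`() * gcdp p p^`() = p by rewrite divpK // dvdp_gcdl.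
have [||x] := Kc (p %/ gcdp p p^`()); last first.
- by move=> px; exists x; rewrite -pd rootM px.
- rewrite ltnNge; apply/negP => q1.
  have dp0 : p^`() != 0.
    apply/eqP => /(congr1 (fun q : {poly K} => q`_(size p).-2)); rewrite coef_deriv coef0.
    case e : (size p) p1 => [|[|n]] // _ /eqP; rewrite -mulr_natr mulf_eq0 K0 orbF.
    by apply/negP; have := p0; rewrite -lead_coef_eq0 lead_coefE e.
  have : (size p <= size p^`())%N.
    rewrite -{1}pd; apply: leq_trans (size_polyMleq _ _) _.
    apply: leq_trans (_ : size (gcdp p p^`()) <= _)%N; last by rewrite dvdp_leq ?dvdp_gcdr.
    by rewrite -subn1 leq_subLR leq_add2r.
  by rewrite leqNgt lt_size_deriv.
- exact: make_separable.
Qed.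

Section FieldEmbedding.
Variables (k E W : fieldType) (i : {rmorphism k -> E}) (j : {rmorphism k -> W}).
Hypotheses (k0 : [pchar k] =i pred0) (Wc : algebraically_closed W).
Hypothesis Ealg : forall x : E, exists p : {poly k}, irreducible_poly p /\ root (map_poly i p) x.

Lemma irreducible_dvdp (p q : {poly k}) (x : E) : irreducible_poly p ->
  root (map_poly i p) x -> root (map_poly i q) x -> p %| q.
Proof.
move=> pirr px qx; apply/contraT; rewrite -(irreducible_poly_coprime _ pirr).
rewrite -(coprimep_map i) => /coprimep_root /(_ px); by rewrite (eqP qx) eqxx.
Qed.

Let mp x : {poly k} := projT1 (cid (Ealg x)).
Let mp_irr x : irreducible_poly (mp x). Proof. by have [] := projT2 (cid (Ealg x)). Qed.
Let mp_root x : root (map_poly i (mp x)) x. Proof. by have [] := projT2 (cid (Ealg x)). Qed.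
Let mp0 x : mp x != 0.
Proof. by have [s1 _] := mp_irr x; rewrite -size_poly_gt0 ltnW. Qed.
Let mpj0 x : map_poly j (mp x) != 0. Proof. by rewrite map_poly_eq0. Qed.
Let R x : seq W := projT1 (cid (finite_roots (mpj0 x))).
Let RP x y : root (map_poly j (mp x)) y -> y \in R x.
Proof. exact: (projT2 (cid (finite_roots (mpj0 x)))). Qed.

(** The maps that restrict to an embedding of [k(e)]. *)
Let C (e : E) : set {ptws E -> discrete_topology W} :=
  [set f : E -> W | (forall x, f x \in R x) /\
    forall p : {poly k}, f ((map_poly i p).[e]) = (map_poly j p).[f e]].

Let C_nonempty e : C e !=set0.
Proof.
have [|w mw] := Wc (p := map_poly j (mp e)); first by rewrite size_map_poly; case: (mp_irr e).
have wd (p q : {poly k}) : (map_poly i p).[e] = (map_poly i q).[e] ->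
    (map_poly j p).[w] = (map_poly j q).[w].
  move=> pq; have /dvdpP[r pqr] : mp e %| p - q.
    apply: (irreducible_dvdp (mp_irr e) (mp_root e)).
    by rewrite rmorphB rootE hornerD hornerN pq subrr.
  apply/eqP; rewrite -subr_eq0 -hornerN -hornerD -rmorphB pqr rmorphM hornerM.
  by rewrite (eqP mw) mulr0.
have rt x : exists y, y \in R x.
  have [|y my] := Wc (p := map_poly j (mp x)); first by rewrite size_map_poly; case: (mp_irr x).
  by exists y; exact: RP.
pose f x := if pselect (exists p : {poly k}, (map_poly i p).[e] = x) is left h
  then (map_poly j (projT1 (cid h))).[w] else projT1 (cid (rt x)).
have fE p : f (map_poly i p).[e] = (map_poly j p).[w].
  rewrite /f; case: pselect => [h|[]]; last by exists p.
  by apply: wd; exact: (projT2 (cid h)).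
have fe : f e = w by have := fE 'X; rewrite !map_polyX !hornerX.
exists f; split => [x|p]; last by rewrite fE fe.
rewrite /f; case: pselect => [h|_]; last exact: (projT2 (cid (rt x))).
apply: RP; case: cid => p /= px; rewrite rootE -horner_comp -map_comp_poly.
rewrite -[X in _ == X](horner0 w) -[X in _ == X.[w]](map_poly0 j); apply/eqP/wd.
rewrite map_comp_poly horner_comp px map_poly0 horner0; apply/eqP.
by rewrite -rootE mp_root.
Qed.

Let C_directed e e' : exists z, C z `<=` C e `&` C e'.
Proof.
have [n [[p pe] [q qe]]] := pchar0_PET (mp0 e) (mp_root e) (mp0 e') (mp_root e') k0.
set z := _ - _ in pe qe.
have sub u r : (map_poly i r).[z] = u -> C z `<=` C u.
  move=> ru f [fR fz]; split => // s.
  by rewrite -ru -horner_comp -map_comp_poly !fz map_comp_poly horner_comp.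
by exists z => f Cf; split; [exact: sub pe f Cf|exact: sub qe f Cf].
Qed.

(** By the primitive element theorem any two elements of [E] lie in a common
    [k(z)], so the nonempty sets [C z] are directed.  A common limit point exists
    by compactness of the space of maps sending each [x] to a conjugate, and it
    is a morphism because this can be tested on two elements at a time. *)
Theorem field_embedding : exists f : {rmorphism E -> W}, forall a, f (i a) = j a.
Proof.
have Xc := @pointwise_finite_compact E W R.
pose F := filter_from setT C.
have FF : Filter F.
  apply: filter_fromT_filter; first by exists 0.
  by move=> e e'; exact: C_directed.
have PF : ProperFilter F by apply: filter_from_proper => e _; exact: C_nonempty.
have [|f [_ Ff]] := Xc F PF; first by exists 0 => // g [].
have Cf e (p : {poly k}) : f (map_poly i p).[e] = (map_poly j p).[f e].
  have [|g [[_ gC] [g1 g2 _]]] := Ff (C e) _ _ (@ptws_near3 E W f (map_poly i p).[e] e e).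
    by exists e.
  by rewrite -g1 gC g2.
have common x y : exists z (p q : {poly k}), (map_poly i p).[z] = x /\ (map_poly i q).[z] = y.
  have [n [[p pe] [q qe]]] := pchar0_PET (mp0 x) (mp_root x) (mp0 y) (mp_root y) k0.
  by eexists; exists p, q; split; [exact: pe|exact: qe].
have fB : zmod_morphism f.
  move=> x y; have [z [p [q [<- <-]]]] := common x y.
  by rewrite -hornerN -hornerD -rmorphB !Cf rmorphB hornerD hornerN.
have f1 : f 1 = 1.
  by have := Cf 0 1; rewrite !rmorph1 !hornerC.
have fM : monoid_morphism f.
  split => // x y; have [z [p [q [<- <-]]]] := common x y.
  by rewrite -hornerM -rmorphM !Cf rmorphM hornerM.
pose A := GRing.isZmodMorphism.Build E W (f : E -> W) fB.
pose M := GRing.isMonoidMorphism.Build E W (f : E -> W) fM.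
pose T : {rmorphism E -> W} := HB.pack (f : E -> W) A M.
exists T => a; have := Cf 0 a%:P.
by rewrite !map_polyC !hornerC.
Qed.

End FieldEmbedding.

(** * The topology of Galois groups and of their involutions *)

Section GalProfinite.
Variables (F K : fieldType) (iota : {rmorphism F -> K}).
Hypothesis hK : is_separable_closure iota.

Lemma Gal_additive (s : Gal iota) : zmod_morphism (Gal_fun s).
Proof.
have [_ sD _ _] := Gal_funP s.
by move=> x y; apply: (addIr (Gal_fun s y)); rewrite -sD !subrK.
Qed.

Lemma Gal_multiplicative (s : Gal iota) : monoid_morphism (Gal_fun s).
Proof.
have [_ _ sM sF] := Gal_funP s; split => //.
by rewrite -(rmorph1 iota) sF.
Qed.

HB.instance Definition _ (s : Gal iota) :=
  GRing.isZmodMorphism.Build _ _ (Gal_fun s) (Gal_additive s).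
HB.instance Definition _ (s : Gal iota) :=
  GRing.isMonoidMorphism.Build _ _ (Gal_fun s) (Gal_multiplicative s).

Lemma Gal_fun_base (s : Gal iota) a : Gal_fun s (iota a) = iota a.
Proof. by have [_ _ _ ->] := Gal_funP s. Qed.

Lemma Gal_root (s : Gal iota) (p : {poly F}) x :
  root (map_poly iota p) x -> root (map_poly iota p) (Gal_fun s x).
Proof.
move=> px; have -> : map_poly iota p = map_poly (Gal_fun s) (map_poly iota p).
  by rewrite -map_poly_comp; apply: eq_map_poly => a /=; rewrite Gal_fun_base.
exact: rmorph_root.
Qed.

Lemma Gal_near (s : Gal iota) x : \forall t \near s, Gal_fun t x = Gal_fun s x.
Proof.
exact: (@set_val_continuous _ (Gal_set iota) s _ (ptws_near (Gal_fun s) x)).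
Qed.

Lemma continuous_Gal (X : topologicalType) (f : X -> Gal iota) :
  (forall y x, \forall x' \near x, Gal_fun (f x') y = Gal_fun (f x) y) -> continuous f.
Proof.
move=> fl; apply: continuous_set_type.
apply: (@continuous_prod X K (fun=> discrete_topology K)) => y.
by apply: continuous_locally => x; exact: fl.
Qed.

Lemma Gal_zero_dimensional : zero_dimensional (Gal iota).
Proof.
apply: (@zero_dimensional_inj _ _ (@set_val _ (Gal_set iota))).
- exact: set_val_continuous.
- exact: val_inj.
- exact: (@prod_discrete_zero_dimensional K (fun=> K)).
Qed.

Let mp (x : K) := projT1 (cid (sepclosure_separable hK x)).
Let mp0 x : map_poly iota (mp x) != 0.
Proof.
by have [pm _ _ _] := projT2 (cid (sepclosure_separable hK x)); rewrite map_poly_eq0 monic_neq0.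
Qed.
Let mp_root x : root (map_poly iota (mp x)) x.
Proof. by have [] := projT2 (cid (sepclosure_separable hK x)). Qed.
Let R x : seq K := projT1 (cid (finite_roots (mp0 x))).
Let RP x y : root (map_poly iota (mp x)) y -> y \in R x.
Proof. exact: (projT2 (cid (finite_roots (mp0 x)))). Qed.

(** A limit of automorphisms is a morphism; it is surjective since it permutes
    the finite set of conjugates of each element. *)
Lemma Gal_compact : compact [set: Gal iota].
Proof.
apply: set_type_compact.
apply: subclosed_compact (@pointwise_finite_compact K K R) _; last first.
  move=> s sG x; apply: RP.
  exact: (Gal_root (Gal_of sG) (mp_root x)).
move=> s clG.
have near2 x y z : exists t : Gal iota, [/\ Gal_fun t x = s x, Gal_fun t y = s y & Gal_fun t z =
  s z].
  have [] := clG [set t | [/\ t x = s x, t y = s y & t z = s z]].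
    exact: (@ptws_near3 K K s x y z).
  by move=> t [tG tE]; exists (Gal_of tG).
have sD : {morph s : x y / x + y}.
  by move=> x y; have [t [<- <- <-]] := near2 x y (x + y); rewrite rmorphD.
have sM : {morph s : x y / x * y}.
  by move=> x y; have [t [<- <- <-]] := near2 x y (x * y); rewrite rmorphM.
have si : injective s.
  move=> x y; have [t [<- <- _]] := near2 x y x.
  exact: fmorph_inj.
have sF a : s (iota a) = iota a.
  by have [t [<- _ _]] := near2 (iota a) (iota a) (iota a); exact: Gal_fun_base.
split => //.
have sur y : exists x, s x = y.
  pose rs := undup [seq z <- R y | root (map_poly iota (mp y)) z].
  have rsP z : (z \in rs) = root (map_poly iota (mp y)) z.
    rewrite mem_undup mem_filter andb_idr //; exact: RP.
  have ursP : uniq rs by exact: undup_uniq.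
  have sub : {subset map s rs <= rs}.
    move=> w /mapP[z zr ->]; move: zr; rewrite !rsP => zr.
    by have [t [<- _ _]] := near2 z z z; exact: Gal_root.
  have [||_ e] := @uniq_min_size _ (map s rs) rs _ sub; rewrite ?map_inj_uniq ?size_map //.
  have : y \in rs by rewrite rsP.
  by rewrite -e => /mapP[z _ ->]; exists z.
pose g y := projT1 (cid (sur y)).
have sg : cancel g s by move=> y; exact: (projT2 (cid (sur y))).
by exists g => // x; apply: si; rewrite sg.
Qed.

Lemma AS_involutive (s : AS iota) : involutive (Gal_fun (set_val s)).
Proof.
have [ss _] := set_valP s => x.
exact: (congr1 (fun t : Gal iota => Gal_fun t x) ss).
Qed.

Lemma AS_nontrivial (s : AS iota) : ~ (Gal_fun (set_val s) =1 id).
Proof. by have [_ s1] := set_valP s => sid; apply: s1; apply: Gal_eqP. Qed.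

Lemma AS_inv (s : AS iota) : ((set_val s)^-1)%g = set_val s.
Proof. by have [ss _] := set_valP s; exact: mulg1_eq. Qed.

Lemma AS_rhd (s t : AS iota) x :
  Gal_fun (set_val (rhd s t)) x =
    Gal_fun (set_val s) (Gal_fun (set_val t) (Gal_fun (set_val s) x)).
Proof.
have -> : set_val (rhd s t) = (set_val s * set_val t * (set_val s)^-1)%g by [].
by rewrite AS_inv.
Qed.

Lemma AS_eqP (s t : AS iota) : Gal_fun (set_val s) =1 Gal_fun (set_val t) -> s = t.
Proof. by move=> st; apply: val_inj; exact: Gal_eqP. Qed.

Lemma AS_near (s : AS iota) x :
  \forall t \near s, Gal_fun (set_val t) x = Gal_fun (set_val s) x.
Proof. exact: (@set_val_continuous _ (@Invol_set (Gal iota)) s _ (Gal_near (set_val s) x)). Qed.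

Lemma continuous_AS (X : topologicalType) (f : X -> AS iota) :
  (forall y x, \forall x' \near x,
    Gal_fun (set_val (f x')) y = Gal_fun (set_val (f x)) y) -> continuous f.
Proof. by move=> fl; apply: continuous_set_type; exact: continuous_Gal. Qed.

Lemma sepclosure_separably_closed : separably_closed K.
Proof. by move=> p; exact: (sepclosure_closed hK). Qed.

Lemma AS_pchar0 (s : AS iota) : [pchar K] =i pred0.
Proof.
exact: (involution_pchar0 sepclosure_separably_closed (AS_involutive s) (@AS_nontrivial s)).
Qed.

(** The involutions form a closed subset of the Galois group: they all move a
    square root of [-1], so the identity is not a limit of involutions. *)
Lemma AS_compact : compact [set: AS iota].
Proof.
have [[s0 _]|nAS] := pselect (exists s : AS iota, True); last first.
  rewrite (_ : [set: AS iota] = set0); first exact: compact0.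
  by rewrite eqEsubset; split => // s _; case: nAS; exists s.
have Kc := sepclosure_separably_closed.
have [i i2] := sqrt_exists Kc (AS_involutive s0) (@AS_nontrivial s0) (-1).
have ASi (s : AS iota) : Gal_fun (set_val s) i = - i.
  exact: (involution_sqrtN1 (s := Gal_fun (set_val s)) Kc (AS_involutive s) (@AS_nontrivial s) i2).
have ii : - i <> i.
  by rewrite -(ASi s0); apply/eqP; exact: (involution_moves_sqrtN1 (s := Gal_fun (set_val s0)) Kc
    (AS_involutive s0) (@AS_nontrivial s0) i2).
apply: set_type_compact; apply: subclosed_compact Gal_compact _ => //.
move=> g clg.
have near2 x y : exists t : AS iota, Gal_fun (set_val t) x = Gal_fun g x /\ Gal_fun (set_val t) y
  = Gal_fun g y.
  have [t [tI [tx ty]]] := clg _ (filterI (Gal_near g x) (Gal_near g y)).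
  by exists (SigSub (mem_set tI)).
split.
  apply: Gal_eqP => x; have [t [tx ty]] := near2 x (Gal_fun g x).
  by apply: etrans (esym ty) _; rewrite -tx; exact: AS_involutive.
move=> g1; have [t [ti _]] := near2 i i.
by apply: ii; rewrite -(ASi t) ti g1.
Qed.

Lemma AS_profinite : profinite_quandle (AS iota).
Proof.
split.
  apply: (zero_dimensional_profinite AS_compact).
  apply: (@zero_dimensional_inj _ _ (@set_val _ (@Invol_set (Gal iota)))).
  - exact: set_val_continuous.
  - exact: val_inj.
  - exact: Gal_zero_dimensional.
apply: continuous_AS => y [s t] /=.
have ns x : \forall p \near (s, t), Gal_fun (set_val p.1) x = Gal_fun (set_val s) x.
  exact: (@cvg_fst _ _ (nbhs s) (nbhs t) _ _ (AS_near s x)).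
have nt x : \forall p \near (s, t), Gal_fun (set_val p.2) x = Gal_fun (set_val t) x.
  exact: (@cvg_snd _ _ (nbhs s) (nbhs t) _ _ (AS_near t x)).
apply: filterS2 (ns y) (filterI (nt (Gal_fun (set_val s) y))
  (ns (Gal_fun (set_val t) (Gal_fun (set_val s) y)))).
by move=> p e1 [e2 e3]; rewrite !AS_rhd e1 e2 e3.
Qed.

End GalProfinite.

(** * Compatible systems of roots of unity *)

Lemma algebraically_closed_split (W : fieldType) (p : {poly W}) :
  algebraically_closed W -> exists rs, p = lead_coef p *: \prod_(x <- rs) ('X - x%:P).
Proof.
move=> Wc; elim/ltn_ind: {p}(size p) {-2}p (erefl (size p)) => n IH p pn.
have [p1|p1] := leqP (size p) 1.
  by exists [::]; rewrite big_nil alg_polyC (size1_polyC p1) lead_coefC.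
have [x /factor_theorem[q pq]] := Wc p p1; rewrite ltnNge in p1.
have q0 : q != 0 by apply: contraNneq p1 => q0; rewrite pq q0 mul0r size_poly0.
have [|rs qrs] := IH (size q) _ q erefl.
  by rewrite -pn pq size_Mmonic ?monicXsubC // size_XsubC addn2.
exists (x :: rs); rewrite {1}pq {1}qrs big_cons mulrC -scalerAr.
by rewrite pq lead_coef_Mmonic ?monicXsubC.
Qed.

Section RootsOfUnity.
Variable K : fieldType.
Hypotheses (Kc : algebraically_closed K) (K0 : [pchar K] =i pred0).

Lemma prim_root_exists (n : nat) : (0 < n)%N -> exists z : K, n.-primitive_root z.
Proof.
move=> n0; have [rs] := @algebraically_closed_split K ('X^n - 1) Kc.
rewrite lead_coefDl ?size_polyXn ?size_polyN ?size_poly1 // lead_coefXn scale1r => pE.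
have nn : n%:R != 0 :> K by move/pcharf0P : K0 => ->; rewrite -lt0n.
have urs : uniq rs by rewrite -separable_prod_XsubC -pE separable_Xn_sub_1.
have srs : size rs = n.
  by apply: succn_inj; rewrite -(size_prod_XsubC rs id) -pE size_Xn_sub_1.
have /hasP[z _ zn] : has n.-primitive_root rs.
  apply: has_prim_root => //; last by rewrite srs.
  apply/allP => z; rewrite -root_prod_XsubC -pE => zr.
  exact: zr.
by exists z.
Qed.

(** The units modulo [k.+1`!] surject onto the units modulo [k`!]: at most one
    prime, namely [k.+1], is new, and it cannot divide both [j] and
    [j + k`!]. *)
Lemma coprime_factS (k j : nat) : coprime j k`! ->
  coprime j k.+1`! \/ coprime (j + k`!) k.+1`!.
Proof.
move=> jk; rewrite factS !coprimeMr jk /=.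
have jk' : coprime (j + k`!) k`! by rewrite -coprime_modl modnDr coprime_modl.
rewrite jk' !andbT; have [pk|npk] := boolP (prime k.+1).
  rewrite ![coprime _ k.+1]coprime_sym !prime_coprime //.
  have [kj|] := boolP (k.+1 %| j)%N; [right|by left].
  rewrite dvdn_addr //; apply/negP => kf.
  have : (k.+1 %| gcdn j k`!)%N by rewrite dvdn_gcd kj.
  by rewrite (eqP jk) dvdn1 => /eqP k1; rewrite k1 in pk.
left; apply: contraT => ncop; set g := gcdn j k.+1.
have g1 : (1 < g)%N by rewrite ltn_neqAle eq_sym ncop gcdn_gt0 orbT.
have pg := pdiv_prime g1; set q := pdiv g in pg.
have qg : (q %| g)%N by exact: pdiv_dvd.
have qj : (q %| j)%N by exact: dvdn_trans qg (dvdn_gcdl _ _).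
have qk : (q %| k.+1)%N by exact: dvdn_trans qg (dvdn_gcdr _ _).
have qlek : (q <= k)%N.
  rewrite -ltnS ltn_neqAle dvdn_leq // andbT.
  by apply: contra npk => /eqP <-.
have : (q %| gcdn j k`!)%N by rewrite dvdn_gcd qj dvdn_fact // prime_gt0.
by rewrite (eqP jk) dvdn1 => /eqP q1; rewrite q1 in pg.
Qed.

Lemma prim_root_lift (k : nat) (u : K) : (k`!).-primitive_root u ->
  exists v, (k.+1`!).-primitive_root v /\ v ^+ k.+1 = u.
Proof.
move=> uk; have [w wk] := prim_root_exists (fact_gt0 k.+1).
have wk1 : (k`!).-primitive_root (w ^+ k.+1).
  have := dvdn_prim_root wk (dvdn_mull k.+1 (dvdnn k`!)).
  by rewrite factS mulnK ?fact_gt0.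
have [j uE] := prim_rootP wk1 (prim_expr_order uk).
have : coprime j k`! by rewrite -(prim_root_exp_coprime _ wk1) -uE.
case/coprime_factS => cop.
  exists (w ^+ j); rewrite prim_root_exp_coprime //; split => //.
  by rewrite uE -!exprM mulnC.
exists (w ^+ (j + k`!)); rewrite prim_root_exp_coprime //; split => //.
by rewrite -exprM mulnDl exprD (mulnC k`!) -factS (prim_expr_order wk) mulr1 uE -exprM mulnC.
Qed.

Let lift_root (k : nat) (u : K) : K :=
  if pselect (exists v, (k.+1`!).-primitive_root v /\ v ^+ k.+1 = u) is left h
  then projT1 (cid h) else 0.

Let fact_root := fix w (k : nat) : K := if k is k'.+1 then lift_root k' (w k') else 1.

Let lift_rootP k u : (k`!).-primitive_root u ->
  (k.+1`!).-primitive_root (lift_root k u) /\ lift_root k u ^+ k.+1 = u.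
Proof.
move=> uk; rewrite /lift_root; case: pselect => [h|[]]; last exact: prim_root_lift.
exact: projT2 (cid h).
Qed.

Let fact_rootP k : (k`!).-primitive_root (fact_root k).
Proof.
elim: k => [|k IH]; last by have [] := lift_rootP IH.
by apply/andP; split => //; apply/forallP => i; rewrite ord1 unity_rootE expr1 eqxx.
Qed.

Let fact_rootX k : fact_root k.+1 ^+ k.+1 = fact_root k.
Proof. by have [] := lift_rootP (fact_rootP k). Qed.

(** Along the factorials the roots can be chosen one after the other by
    [prim_root_lift]; every order [n.+1] divides [n.+1`!]. *)
Lemma compatible_roots : exists z : nat -> K,
  (forall n, (n.+1).-primitive_root (z n)) /\
  (forall n d, z (n.+1 * d.+1).-1 ^+ d.+1 = z n).
Proof.
have [w [wP wX]] : exists w : nat -> K,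
    (forall k, (k`!).-primitive_root (w k)) /\ forall k, w k.+1 ^+ k.+1 = w k.
  by exists fact_root; split; [exact: fact_rootP|exact: fact_rootX].
exists (fun n => w n.+1 ^+ (n.+1`! %/ n.+1)); split => [n|n d].
  have dn : (n.+1 %| n.+1`!)%N by rewrite dvdn_fact /=.
  have H := dvdn_prim_root (wP n.+1) dn.
  exact: H.
have stable k : (n < k)%N -> w k ^+ (k`! %/ n.+1) = w n.+1 ^+ (n.+1`! %/ n.+1).
  elim: k => // k IH; rewrite ltnS leq_eqVlt => /orP[/eqP->//|nk].
  by rewrite factS -muln_divA ?dvdn_fact // exprM wX IH.
rewrite -(stable (n.+1 * d.+1).-1.+1) ?prednK ?leq_pmulr //.
rewrite -exprM; congr (_ ^+ _).
have /dvdnP[q qE] : (n.+1 * d.+1 %| (n.+1 * d.+1)`!)%N by rewrite dvdn_fact //= muln_gt0.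
by rewrite qE mulnK // [(n.+1 * _)%N]mulnC mulnA mulnK.
Qed.
End RootsOfUnity.

(** * Galois involutions of a field of Laurent series *)

Lemma rat_frac (q : rat) : exists (k : int) n, q = k%:~R / n.+1%:R.
Proof.
have := divq_num_den q; have := denq_gt0 q; case: (denq q) => [[|n]|] // _ qE.
by exists (numq q), n; rewrite -[LHS]qE.
Qed.

(** A compatible system of roots [w n] of order [n.+1] of [w 0] is the same as
    an extension of the powers of [w 0] to rational exponents. *)
Lemma rational_power (K : fieldType) (w : nat -> K) :
    (forall n, w n != 0) -> (forall n d, w (n.+1 * d.+1).-1 ^+ d.+1 = w n) ->
  exists chi : rat -> K, (forall k n, chi (k%:~R / n.+1%:R) = w n ^ k) /\
    {morph chi : q r / q + r >-> q * r}.
Proof.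
move=> w0 wX; pose chi (q : rat) := w (`|denq q|%N).-1 ^ numq q.
have chiE k n : chi (k%:~R / n.+1%:R) = w n ^ k.
  rewrite /chi -[n.+1%:R]/((n.+1%:Z)%:~R).
  move eN: n.+1%:Z => N; case: divqP eN => [_|m x m0] //.
  have := denq_gt0 x; case: (denq x) => [[|d]|] // _.
  case: m m0 => [[|m]|m] //= _; rewrite -?PoszM // => -[nE].
  have -> : n = (d.+1 * m.+1).-1 by rewrite mulnC nE.
  by rewrite -(wX d m) exprnP -exprz_exp.
exists chi; split => // q r.
have [k [n ->]] := rat_frac q; have [l [m ->]] := rat_frac r.
have e : k%:~R / n.+1%:R + l%:~R / m.+1%:R = (k * m.+1%:Z + l * n.+1%:Z)%:~R / (n.+1 *
  m.+1).-1.+1%:R :> rat.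
  by rewrite prednK // natrM intrD !intrM addf_div ?pnatr_eq0.
rewrite e !chiE -(wX n m) -(wX m n) (mulnC m.+1) expfzDr // !exprnP -!exprz_exp.
by congr (_ * _); exact: exprzAC.
Qed.

Section LaurentGalois.
Variables (F K L : fieldType).
Variables (iF : {rmorphism F -> K}) (iL : {rmorphism laurent F -> L}).
Hypotheses (hF : is_separable_closure iF) (hL : is_separable_closure iL).
Hypothesis K0 : [pchar K] =i pred0.

Let P := puiseux K.
Let j : {rmorphism laurent F -> P} := (@pz K 0 \o lmap iF)%FUN.

Let jE n a : j a = pz n (dil n (lmap iF a)).
Proof. by rewrite /j /= (pz_dil 0 n) mul1n. Qed.

Let Kc : algebraically_closed K.
Proof. exact: separably_closed_pchar0 K0 (sepclosure_separably_closed hF). Qed.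

Let lF0 : [pchar (laurent F)] =i pred0.
Proof. by apply: laurent_pchar0; apply/(rmorphism_pchar0 iF). Qed.

Let L0 : [pchar L] =i pred0. Proof. exact/(rmorphism_pchar0 iL). Qed.

Let Lc : algebraically_closed L.
Proof. exact: separably_closed_pchar0 L0 (sepclosure_separably_closed hL). Qed.

Let Lalg (x : L) : exists p : {poly laurent F}, irreducible_poly p /\ root (map_poly iL p) x.
Proof. by have [p [_ pi _ px]] := sepclosure_separable hL x; exists p. Qed.

(* [L] is viewed inside the Puiseux series; the choice of embedding is
   immaterial. *)
Let theta_ex : exists f : {rmorphism L -> P}, forall a, f (iL a) = j a.
Proof. exact: field_embedding lF0 (puiseux_algebraically_closed Kc K0) Lalg. Qed.

Let theta : {rmorphism L -> P} := projT1 (cid theta_ex).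

Let thetaE a : theta (iL a) = j a. Proof. exact: (projT2 (cid theta_ex)). Qed.

Let theta_poly (p : {poly laurent F}) : map_poly theta (map_poly iL p) = map_poly j p.
Proof. by rewrite -map_poly_comp; apply: eq_map_poly => a /=; exact: thetaE. Qed.

Let theta_root (p : {poly laurent F}) x :
  root (map_poly iL p) x -> root (map_poly j p) (theta x).
Proof. by move=> /(rmorph_root theta); rewrite theta_poly. Qed.

Let theta_image (p : {poly laurent F}) y : p != 0 -> root (map_poly j p) y ->
  exists x, theta x = y.
Proof.
move=> p0; have [rs pE] := algebraically_closed_split (map_poly iL p) Lc.
rewrite -theta_poly pE map_polyZ rmorph_prod rootZ; last first.
  by rewrite fmorph_eq0 lead_coef_eq0 map_poly_eq0.
under eq_bigr do rewrite rmorphB /= map_polyX map_polyC /=.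
rewrite -(big_map theta xpredT (fun x => 'X - x%:P)) root_prod_XsubC.
by move=> /mapP[x _ ->]; exists x.
Qed.

Let alg_const (c : K) : exists x, theta x = pconst c.
Proof.
have [p [pm _ _ pc]] := sepclosure_separable hF c.
apply: (@theta_image (map_poly (@lconst F) p)); first by rewrite map_poly_eq0 monic_neq0.
have -> : map_poly j (map_poly (@lconst F) p) = map_poly (@pconst K) (map_poly iF p).
  by rewrite -!map_poly_comp; apply: eq_map_poly => a; rewrite /= lmap_mono.
exact: rmorph_root.
Qed.

Let kappa_ex : exists f : {rmorphism K -> L}, forall c, theta (f c) = pconst c.
Proof.
pose f c := projT1 (cid (alg_const c)).
have fE c : theta (f c) = pconst c by exact: (projT2 (cid (alg_const c))).
have fB : zmod_morphism f.
  by move=> c d; apply: (fmorph_inj theta); rewrite rmorphB !fE rmorphB.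
have fM : monoid_morphism f.
  split=> [|c d]; apply: (fmorph_inj theta); first by rewrite fE !rmorph1.
  by rewrite rmorphM !fE rmorphM.
pose A := GRing.isZmodMorphism.Build K L f fB.
pose M := GRing.isMonoidMorphism.Build K L f fM.
pose T : {rmorphism K -> L} := HB.pack f A M.
by exists T.
Qed.

Let kappa : {rmorphism K -> L} := projT1 (cid kappa_ex).

Let theta_kappa c : theta (kappa c) = pconst c.
Proof. exact: (projT2 (cid kappa_ex)). Qed.

Let kappa_base a : kappa (iF a) = iL (lconst a).
Proof.
apply: (fmorph_inj theta); by rewrite theta_kappa thetaE /= lmap_mono.
Qed.

Let alg_root_t n : exists x, theta x = pz n (mono 1 1).
Proof.
have p0 : 'X^(n.+1) - (mono 1 1)%:P != 0 :> {poly laurent F}.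
  by rewrite -size_poly_gt0 size_XnsubC.
apply: (theta_image p0).
rewrite rmorphB /= map_polyXn map_polyC rootE !hornerE /= subr_eq0 -rmorphXn monoX expr1n.
by rewrite (pz_dil 0 n) lmap_mono dil_mono rmorph1 mul1r -mulr_natl mulr1 natz mul1n.
Qed.

Let tau n : L := projT1 (cid (alg_root_t n)).

Let theta_tau n : theta (tau n) = pz n (mono 1 1).
Proof. exact: (projT2 (cid (alg_root_t n))). Qed.

Let tau_neq0 n : tau n != 0.
Proof. by rewrite -(fmorph_eq0 theta) theta_tau fmorph_eq0 mono_neq0 ?oner_eq0. Qed.

Let tauX n d : tau (n.+1 * d.+1).-1 ^+ d.+1 = tau n.
Proof.
apply: (fmorph_inj theta); rewrite rmorphXn !theta_tau -rmorphXn monoX expr1n.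
by rewrite (pz_dil n d) dil_mono mul1r -mulr_natl mulr1 natz.
Qed.

Let tau0 : tau 0 = iL (mono 1 1).
Proof.
by apply: (fmorph_inj theta); rewrite theta_tau thetaE /= lmap_mono rmorph1.
Qed.

Let tau_base n : tau n ^+ n.+1 = iL (mono 1 1).
Proof. by rewrite -tau0 -(tauX 0 n) mul1n. Qed.

Let zeta_ex := compatible_roots Kc K0.
Let zeta : nat -> K := projT1 (cid zeta_ex).
Let zeta_prim n : (n.+1).-primitive_root (zeta n).
Proof. by case: (projT2 (cid zeta_ex)). Qed.
Let zetaX n d : zeta (n.+1 * d.+1).-1 ^+ d.+1 = zeta n.
Proof. by case: (projT2 (cid zeta_ex)) => _; apply. Qed.

Let zeta_neq0 n : zeta n != 0.
Proof.
by apply: contra_eq_neq (prim_expr_order (zeta_prim n)) => ->; rewrite expr0n eq_sym oner_eq0.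
Qed.

Section Automorphism.
Variable g : Gal iL.

(* The elements of [L] without pole are those which are integral over the power
   series, a property that depends only on the minimal polynomial. *)
Let g_integral (x : L) : (forall q, q < 0 -> pcoef (theta x) q = 0) ->
  forall q, q < 0 -> pcoef (theta (Gal_fun g x)) q = 0.
Proof.
move=> xi; have [p [pm pirr _ px]] := sepclosure_separable hL x.
have key y n h : root (map_poly iL p) y -> theta y = pz n h ->
    root (map_poly (dil n) (map_poly (lmap iF) p)) h.
  move=> /theta_root + yE; rewrite yE.
  have -> : map_poly j p = map_poly (@pz K n) (map_poly (dil n) (map_poly (lmap iF) p)).
    by rewrite -!map_poly_comp; apply: eq_map_poly => a; exact: jE.
  by rewrite fmorph_root.
have [n [h xh]] := pzP (theta x).
have hi : supp_from 0 (lcoef h).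
  move=> k k0; rewrite -(pcoef_frac n) -xh xi //.
  by rewrite pmulr_llt0 ?invr_gt0 ?ltr0n // ltrz0.
have pint := irreducible_integral pm pirr hi (key _ _ _ px xh).
have [m [f gf]] := pzP (theta (Gal_fun g x)).
have fi : supp_from 0 (lcoef f).
  pose pK : {poly laurent K} := map_poly (dil m) (map_poly (lmap iF) p).
  have pKm : pK \is monic by rewrite !map_monic.
  have pKi : integral_coefs pK.
    by move=> i; rewrite !coef_map; apply: supp_from_dil0; exact: supp_from_twist.
  exact: integral_coefs_root pKm pKi (key _ _ _ (Gal_root g px) gf).
move=> q q0; rewrite gf pcoef_pz; have [k qk|qn _] := fracP K m q; last exact: qn.
rewrite qk spread_frac fi //; move: q0; rewrite qk pmulr_llt0 ?invr_gt0 ?ltr0n //.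
by rewrite ltrz0.
Qed.

Hypotheses (g_kappa : forall c, Gal_fun g (kappa c) = kappa c).
Hypothesis g_tau : forall n, Gal_fun g (tau n) = tau n.

Let mono_fixed n k c : exists w, Gal_fun g w = w /\ theta w = pz n (mono k c).
Proof.
case: k => k.
  exists (kappa c * tau n ^+ k); split; first by rewrite rmorphM rmorphXn /= g_kappa g_tau.
  rewrite rmorphM rmorphXn theta_kappa theta_tau (pconstE n) -rmorphXn -rmorphM.
  by rewrite monoX expr1n monoM mulr1 add0r -mulr_natl mulr1 natz.
exists (kappa c * (tau n ^+ k.+1)^-1); split.
  by rewrite rmorphM fmorphV rmorphXn /= g_kappa g_tau.
rewrite rmorphM fmorphV rmorphXn theta_kappa theta_tau (pconstE n) -rmorphXn.
have u : pz n (mono k.+1 1) != 0 :> P by rewrite fmorph_eq0 mono_neq0 ?oner_eq0.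
apply: (mulIf u); rewrite monoX expr1n -mulr_natl mulr1 natz mulfVK //.
by rewrite -rmorphM monoM mulr1 NegzE addNr.
Qed.

Let truncation n (a : int) (h : laurent K) (m : nat) : supp_from a (lcoef h) ->
  exists w h', [/\ Gal_fun g w = w, supp_from (a + m%:Z) (lcoef h') &
    theta w = pz n (h - h')].
Proof.
move=> ha; elim: m => [|m [w [h' [gw h'a wE]]]].
  by exists 0, h; rewrite !rmorph0 subrr addr0 rmorph0.
have [v [gv vE]] := mono_fixed n (a + m%:Z) (lcoef h' (a + m%:Z)).
exists (w + v), (h' - mono (a + m%:Z) (lcoef h' (a + m%:Z))); split.
- by rewrite rmorphD /= gw gv.
- move=> k km; rewrite lcoefB lcoef_mono; case: eqP => [->|/eqP kn]; first by rewrite subrr.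
  rewrite subr0 h'a // lt_neqAle kn /=; move: km; rewrite intS addrCA addrC.
  by rewrite ltzD1.
- by rewrite rmorphD wE vE -rmorphD opprB addrCA addrC.
Qed.

(** Every [x] is congruent, modulo any power [t ^ M], to a finite sum [w] of
    monomials fixed by [g]; as [g] preserves integrality, [g x - x] is divisible
    by [t ^ M] for every [M]. *)
Lemma Gal_trivial : g = 1%g.
Proof.
apply: Gal_eqP => x; apply: (fmorph_inj theta); rewrite [in RHS]/Gal_fun /=.
apply/eqP; rewrite -subr_eq0; apply/eqP/puiseux_eqP => q; rewrite pcoef0.
have [n [h xh]] := pzP (theta x); have [a ha] := lcoef_from h.
(* The coefficient at [q] is not affected by multiples of [t ^ M]. *)
pose M : int := Num.floor q + 1.
have qM : q < M%:~R by exact: floorD1_gt.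
have [w [h' [gw h'm wE]]] := @truncation n a h (absz (M * n.+1%:Z - a)%R) ha.
have h'M : supp_from (M * n.+1%:Z) (lcoef h').
  apply: supp_from_le h'm; by rewrite -lerBlDl abszE ler_norm.
pose u := iL (mono M 1).
have u0 : u != 0 by rewrite fmorph_eq0 mono_neq0 ?oner_eq0.
have uE : theta u = pz n (mono (M * n.+1%:Z) 1).
  by rewrite thetaE (jE n) lmap_mono dil_mono rmorph1.
have key y : (forall q, q < 0 -> pcoef (theta y) q = 0) -> pcoef (theta (u * y)) q = 0.
  move=> yi; rewrite rmorphM uE pcoef_monoM yi ?mulr0 //.
  by rewrite intrM mulfK ?intr_eq0 // subr_lt0.
pose y := (x - w) / u.
have xE : x = w + u * y by rewrite /y mulrC divfK // addrC subrK.
have yi q' : q' < 0 -> pcoef (theta y) q' = 0.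
  move=> q'0; have -> : theta y = pz n (mono (- (M * n.+1%:Z)) 1) * pz n h'.
    have uu : theta u != 0 by rewrite fmorph_eq0.
    apply: (mulfI uu); rewrite -rmorphM {1}/y mulrC divfK //.
    rewrite rmorphB xh wE -rmorphB opprB addrC subrK uE mulrA -rmorphM monoM.
    by rewrite subrr mulr1 mono01 rmorph1 mul1r.
  rewrite pcoef_monoM mul1r pcoef_pz; have [k qk|qn _] := fracP K n (q' - (- (M * n.+1%:Z))%:~R /
    n.+1%:R); last exact: qn.
  rewrite qk spread_frac h'M // -(ltr_int rat) intrM -ltr_pdivrMr ?ltr0n // -qk.
  by rewrite mulrNz mulNr opprK intrM mulfK ?pnatr_eq0 // gtrDr.
have gu : Gal_fun g u = u by exact: Gal_fun_base.
rewrite xE !rmorphD !rmorphM /= gw gu -!rmorphM opprD addrACA subrr add0r pcoefB.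
by rewrite !key ?subrr //; exact: g_integral.
Qed.

End Automorphism.

Section Restriction.
Variable s : AS iL.
Let S : L -> L := Gal_fun (set_val s).

Let S_unity (z : K) n : z ^+ n.+1 = 1 -> S (kappa z) = kappa z^-1.
Proof.
move=> zn; rewrite fmorphV; apply: (involution_unity (s := Gal_fun (set_val s))
  (sepclosure_separably_closed hL) (AS_involutive s) (@AS_nontrivial _ _ _ s) (ltn0Sn n)).
by rewrite -rmorphXn zn rmorph1.
Qed.

Let restriction_ex c : exists d, kappa d = S (kappa c).
Proof.
have [p [pm _ _ pc]] := sepclosure_separable hF c.
have pE : map_poly iL (map_poly (@lconst F) p) = map_poly kappa (map_poly iF p).
  by rewrite -!map_poly_comp; apply: eq_map_poly => a /=; rewrite kappa_base.
have : root (map_poly iL (map_poly (@lconst F) p)) (S (kappa c)).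
  by apply: Gal_root; rewrite pE fmorph_root.
rewrite pE; have [rs ->] := algebraically_closed_split (map_poly iF p) Kc.
rewrite lead_coef_map (monicP pm) rmorph1 scale1r rmorph_prod.
under eq_bigr do rewrite rmorphB /= map_polyX map_polyC /=.
rewrite -(big_map kappa xpredT (fun x => 'X - x%:P)) root_prod_XsubC.
by move=> /mapP[d _ ->]; exists d.
Qed.

Definition restriction_fun (c : K) : K := projT1 (cid (restriction_ex c)).

Lemma kappa_restriction c : kappa (restriction_fun c) = Gal_fun (set_val s) (kappa c).
Proof. exact: (projT2 (cid (restriction_ex c))). Qed.

Let restriction_involutive : involutive restriction_fun.
Proof.
by move=> c; apply: (fmorph_inj kappa); rewrite !kappa_restriction AS_involutive.
Qed.

Let restriction_Gal : Gal_set iF restriction_fun.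
Proof.
split.
- exact: inv_bij restriction_involutive.
- by move=> c d; apply: (fmorph_inj kappa); rewrite rmorphD !kappa_restriction rmorphD /= rmorphD.
- by move=> c d; apply: (fmorph_inj kappa); rewrite rmorphM !kappa_restriction rmorphM /= rmorphM.
- by move=> a; apply: (fmorph_inj kappa); rewrite kappa_restriction kappa_base Gal_fun_base.
Qed.

Let restriction_Invol : Invol_set (Gal_of restriction_Gal).
Proof.
split; first by apply: Gal_eqP => c; exact: restriction_involutive.
move=> r1; have r1' c : restriction_fun c = c.
  exact: (congr1 (fun t : Gal iF => Gal_fun t c) r1).
(* A square root of [-1] is a constant and is moved by every involution. *)
have [|i ir] := Kc (p := 'X^2 + 1); first by rewrite size_polyDl ?size_polyXn ?size_poly1.
have i2 : kappa i ^+ 2 = -1.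
  move: ir; rewrite rootE !hornerE addr_eq0 => /eqP i2.
  by rewrite -rmorphXn i2 rmorphN rmorph1.
have := involution_moves_sqrtN1 (s := Gal_fun (set_val s))
  (sepclosure_separably_closed hL) (AS_involutive s) (@AS_nontrivial _ _ _ s) i2.
have ie : Gal_fun (set_val s) (kappa i) = kappa i by rewrite -kappa_restriction r1'.
by move=> /eqP; apply.
Qed.

Definition restriction : AS iF := SigSub (mem_set restriction_Invol).

Lemma restrictionE c : kappa (Gal_fun (set_val restriction) c) = Gal_fun (set_val s) (kappa c).
Proof. exact: kappa_restriction. Qed.

Let angle_ex n : exists k : 'I_n.+1, S (tau n) = kappa (zeta n ^+ k) * tau n.
Proof.
have u1 : (S (tau n) / tau n) ^+ n.+1 = 1.
  rewrite expr_div_n -rmorphXn /= tau_base Gal_fun_base divff //.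
  by rewrite fmorph_eq0 mono_neq0 ?oner_eq0.
have zp : n.+1.-primitive_root (kappa (zeta n)) by rewrite fmorph_primitive_root.
have [k uE] := prim_rootP zp u1.
by exists k; rewrite rmorphXn -uE divfK.
Qed.

Definition angle_fun n : 'I_n.+1 := projT1 (cid (angle_ex n)).

Lemma angle_funE n :
  Gal_fun (set_val s) (tau n) = kappa (zeta n ^+ angle_fun n) * tau n.
Proof. exact: (projT2 (cid (angle_ex n))). Qed.

Lemma angle_fun_uniq n k : Gal_fun (set_val s) (tau n) = kappa (zeta n ^+ k) * tau n ->
  angle_fun n = (k %% n.+1)%N :> nat.
Proof.
rewrite angle_funE => /(mulIf (tau_neq0 n)) /fmorph_inj /eqP.
by rewrite (eq_prim_root_expr (zeta_prim n)) modn_small // => /eqP.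
Qed.

Let angle_subproof : Zhat_set angle_fun.
Proof.
move=> m n /dvdnP[[|d]]; first by rewrite mul0n.
rewrite mulnC => nE; have {}nE : n = (m.+1 * d.+1).-1 by rewrite -nE.
apply: val_inj => /=; apply: angle_fun_uniq.
have := congr1 (fun y => y ^+ d.+1) (angle_funE n).
rewrite /= -rmorphXn /= exprMn -rmorphXn.
have -> : tau n ^+ d.+1 = tau m by rewrite nE tauX.
by have <- : zeta n ^+ d.+1 = zeta m; [rewrite nE zetaX | rewrite exprAC].
Qed.

(** The Kummer cocycle of [t], evaluated at [s]. *)
Definition angle : Zhat := Zhat_of angle_subproof.

Lemma angleE n : Gal_fun (set_val s) (tau n) = kappa (zeta n ^+ Zhat_fun angle n) * tau n.
Proof. exact: angle_funE. Qed.

Lemma angle_uniq n k : Gal_fun (set_val s) (tau n) = kappa (zeta n ^+ k) * tau n ->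
  Zhat_fun angle n = (k %% n.+1)%N :> nat.
Proof. exact: angle_fun_uniq. Qed.

Lemma AS_zeta n k : Gal_fun (set_val s) (kappa (zeta n ^+ k)) = kappa (zeta n ^- k).
Proof. by apply: (@S_unity _ n); rewrite exprAC (prim_expr_order (zeta_prim n)) expr1n. Qed.

End Restriction.

Lemma restriction_morph (s t : AS iL) :
  restriction (rhd s t) = rhd (restriction s) (restriction t).
Proof.
apply: AS_eqP => c; apply: (fmorph_inj kappa).
by rewrite restrictionE !AS_rhd !restrictionE.
Qed.

(** Involutions invert [z = zeta n].  If [s] and [t] multiply [tau n] by [z ^ a]
    and [z ^ b], then the successive images of [tau n] under [s], [t], [s] are
    its multiples by [z ^ a], [z ^ (b - a)] and [z ^ (a - (b - a))]. *)
Lemma angle_morph (s t : AS iL) : angle (rhd s t) = rhd (angle s) (angle t).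
Proof.
have -> : rhd (angle s) (angle t) = angle s + angle s - angle t by rewrite -mulr2n.
apply: (addIr (angle t)); rewrite subrK; apply: Zhat_eqP => n; apply: val_inj.
rewrite [LHS]Zhat_funD [RHS]Zhat_funD.
have := angleE (rhd s t) n; rewrite AS_rhd angleE.
rewrite !rmorphM /= !AS_zeta angleE rmorphM /= angleE AS_zeta fmorphV fmorphV /= AS_zeta.
rewrite -fmorphV invrK !mulrA -!rmorphM => /(mulIf (tau_neq0 n)) /fmorph_inj /eqP.
move: (Zhat_fun (angle s) n : nat) (Zhat_fun (angle t) n : nat)
  (Zhat_fun (angle (rhd s t)) n : nat) => a b c.
have zb : zeta n ^+ b != 0 by rewrite expf_neq0 ?zeta_neq0.
rewrite -(inj_eq (mulIf zb)) mulrAC divfK // -!exprD.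
by rewrite (eq_prim_root_expr (zeta_prim n)) eq_sym => /eqP.
Qed.

Lemma restriction_near (s : AS iL) c : \forall s' \near s,
  Gal_fun (set_val (restriction s')) c = Gal_fun (set_val (restriction s)) c.
Proof.
apply: filterS (AS_near s (kappa c)) => s' e.
by apply: (fmorph_inj kappa); rewrite !restrictionE.
Qed.

Lemma angle_near (s : AS iL) n : \forall s' \near s,
  Zhat_fun (angle s') n = Zhat_fun (angle s) n.
Proof.
apply: filterS (AS_near s (tau n)) => s' e; apply: val_inj => /=.
by rewrite (@angle_uniq s' n (Zhat_fun (angle s) n)) ?modn_small // e angleE.
Qed.

Lemma restriction_angle_inj (s s' : AS iL) :
  restriction s = restriction s' -> angle s = angle s' -> s = s'.
Proof.
move=> rE aE; suff e : (set_val s * set_val s')%g = 1%g.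
  by apply: val_inj; exact: etrans (esym (AS_inv s)) (mulg1_eq e).
apply: Gal_trivial => [c|n].
  have -> : Gal_fun (set_val s * set_val s')%g (kappa c) =
    Gal_fun (set_val s) (Gal_fun (set_val s') (kappa c)) by [].
  by rewrite -restrictionE -rE restrictionE AS_involutive.
have -> : Gal_fun (set_val s * set_val s')%g (tau n) =
  Gal_fun (set_val s) (Gal_fun (set_val s') (tau n)) by [].
have -> : Gal_fun (set_val s') (tau n) = Gal_fun (set_val s) (tau n) by rewrite !angleE aE.
exact: AS_involutive.
Qed.

Section Lift.
Variables (s0 : AS iF) (a : Zhat).

Let w n := zeta n ^+ Zhat_fun a n.

Let w_neq0 n : w n != 0. Proof. by rewrite expf_neq0 ?zeta_neq0. Qed.

Let w_unity n : w n ^+ n.+1 = 1.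
Proof. by rewrite exprAC (prim_expr_order (zeta_prim n)) expr1n. Qed.

Let wX n d : w (n.+1 * d.+1).-1 ^+ d.+1 = w n.
Proof.
rewrite /w exprAC zetaX.
have dvd : (n.+1 %| (n.+1 * d.+1).-1.+1)%N by rewrite prednK // dvdn_mulr.
by rewrite (Zhat_funP a dvd) /= (prim_expr_mod (zeta_prim n)).
Qed.

Let chi := projT1 (cid (rational_power w_neq0 wX)).

Let chiE k n : chi (k%:~R / n.+1%:R) = w n ^ k.
Proof. by case: (projT2 (cid (rational_power w_neq0 wX))). Qed.

Let chiD : {morph chi : q r / q + r >-> q * r}.
Proof. by case: (projT2 (cid (rational_power w_neq0 wX))). Qed.

Let chi0 : chi 0 = 1.
Proof. by have := chiE 0 0; rewrite mul0r expr0z. Qed.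

Let s0_chi q : Gal_fun (set_val s0) (chi q) = (chi q)^-1.
Proof.
have [k [n ->]] := rat_frac q; rewrite chiE.
apply: (involution_unity (s := Gal_fun (set_val s0))
  (sepclosure_separably_closed hF) (AS_involutive s0) (@AS_nontrivial _ _ _ s0) (ltn0Sn n)).
by rewrite exprnP exprzAC -exprnP w_unity exp1rz.
Qed.

Let T_ex := ptwist_rmorphism (Gal_fun (set_val s0)) chi0 chiD.

Let T : {rmorphism P -> P} := projT1 (cid T_ex).

Let pcoefT f q : pcoef (T f) q = Gal_fun (set_val s0) (pcoef f q) * chi q.
Proof. by rewrite (projT2 (cid T_ex)). Qed.

Let T_base b : T (j b) = j b.
Proof.
apply: puiseux_eqP => q; rewrite -[j b]/(pz 0 (lmap iF b)) pcoefT !pcoef_pz.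
have [k ->|qn _] := fracP K 0 q; last by rewrite !qn rmorph0 mul0r.
rewrite spread_frac lcoef_lmap Gal_fun_base chiE.
by have := w_unity 0; rewrite expr1 => ->; rewrite exp1rz mulr1.
Qed.

(* Applying [T] twice multiplies [t ^ q] by [s0 (chi q) * chi q], which is [1]
   because [chi q] is a root of unity. *)
Let T_involutive : involutive T.
Proof.
move=> f; apply: puiseux_eqP => q; rewrite !pcoefT rmorphM /= s0_chi AS_involutive.
have [k [n qE]] := rat_frac q.
by rewrite divfK // qE chiE expfz_neq0.
Qed.

Let lift_ex x : exists y, theta y = T (theta x).
Proof.
have [p [pm _ _ px]] := sepclosure_separable hL x.
apply: (theta_image (monic_neq0 pm)).
have -> : map_poly j p = map_poly T (map_poly j p).
  by rewrite -map_poly_comp; apply: eq_map_poly => b /=; rewrite T_base.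
exact/rmorph_root/theta_root.
Qed.

Let lift_fun x : L := projT1 (cid (lift_ex x)).

Let theta_lift x : theta (lift_fun x) = T (theta x).
Proof. exact: (projT2 (cid (lift_ex x))). Qed.

Let lift_involutive : involutive lift_fun.
Proof. by move=> x; apply: (fmorph_inj theta); rewrite !theta_lift T_involutive. Qed.

Let lift_Gal : Gal_set iL lift_fun.
Proof.
split.
- exact: inv_bij lift_involutive.
- by move=> x y; apply: (fmorph_inj theta); rewrite rmorphD !theta_lift !rmorphD.
- by move=> x y; apply: (fmorph_inj theta); rewrite rmorphM !theta_lift !rmorphM.
- by move=> b; apply: (fmorph_inj theta); rewrite theta_lift thetaE T_base.
Qed.

Let lift_kappa c : lift_fun (kappa c) = kappa (Gal_fun (set_val s0) c).
Proof.
apply: (fmorph_inj theta); rewrite theta_lift !theta_kappa.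
apply: puiseux_eqP => q; rewrite pcoefT /pconst !pcoef_pz.
have [k ->|qn _] := fracP K 0 q; last by rewrite !qn rmorph0 mul0r.
rewrite !spread_frac !lcoef_mono; case: eqP => [->|_]; last by rewrite rmorph0 mul0r.
by rewrite chiE expr0z mulr1.
Qed.

Let lift_tau n : lift_fun (tau n) = kappa (w n) * tau n.
Proof.
apply: (fmorph_inj theta); rewrite theta_lift rmorphM theta_kappa theta_tau.
rewrite (pconstE n) -rmorphM monoM add0r mulr1.
apply: puiseux_eqP => q; rewrite pcoefT !pcoef_pz.
have [k ->|qn _] := fracP K n q; last by rewrite !qn rmorph0 mul0r.
rewrite !spread_frac !lcoef_mono; case: eqP => [->|_]; last by rewrite rmorph0 mul0r.
by rewrite chiE expr1z rmorph1 mul1r.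
Qed.

Let lift_Invol : Invol_set (Gal_of lift_Gal).
Proof.
split; first by apply: Gal_eqP => x; exact: lift_involutive.
move=> l1; apply: (@AS_nontrivial _ _ _ s0) => c; apply: (fmorph_inj kappa).
rewrite -lift_kappa.
exact: (congr1 (fun g : Gal iL => Gal_fun g (kappa c)) l1).
Qed.

Let lift : AS iL := SigSub (mem_set lift_Invol).

Lemma restriction_angle_surj : exists s : AS iL, restriction s = s0 /\ angle s = a.
Proof.
exists lift; split.
  apply: AS_eqP => c; apply: (fmorph_inj kappa).
  by rewrite restrictionE; exact: lift_kappa.
apply: Zhat_eqP => n; apply: val_inj => /=.
by rewrite (@angle_uniq lift n (Zhat_fun a n) (lift_tau n)) modn_small.
Qed.

End Lift.

Lemma AS_laurent_iso_char0 : profinite_quandle_iso (AS iL) (AS iF * Zhat)%type.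
Proof.
have pF := AS_profinite hF; have pQ := profinite_quandle_prod pF profinite_quandle_Zhat.
pose f (s : AS iL) : AS iF * Zhat := (restriction s, angle s).
have fsurj y : exists s, f s = y.
  by case: y => s0 a; have [s [sr sa]] := restriction_angle_surj s0 a; exists s; rewrite /f sr sa.
pose g y := projT1 (cid (fsurj y)).
have gf : cancel g f by move=> y; exact: (projT2 (cid (fsurj y))).
have fg : cancel f g.
  move=> s; have e := gf (f s); apply: restriction_angle_inj.
    exact: (congr1 (fun y : AS iF * Zhat => y.1) e).
  exact: (congr1 (fun y : AS iF * Zhat => y.2) e).
have fc : continuous f.
  apply: continuous_pair.
    by apply: continuous_AS => c s; exact: restriction_near.
  by apply: continuous_Zhat => s n; exact: angle_near.
have [[_ hQ _] _] := pQ.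
have gc : continuous g := compact_inverse_continuous (AS_compact hL) hQ fc fg gf.
apply: (profinite_quandle_iso_inverse fg gf) => //.
by split => // s t; rewrite /f restriction_morph angle_morph.
Qed.

End LaurentGalois.

(** An involution in the Galois group of [F] or of [laurent F] forces
    characteristic zero; otherwise both quandles are empty. *)
Lemma AS_laurent_iso (F Fsep Lsep : fieldType)
    (iF : {rmorphism F -> Fsep}) (iL : {rmorphism laurent F -> Lsep}) :
  is_separable_closure iF -> is_separable_closure iL ->
  profinite_quandle_iso (AS iL) (AS iF * Zhat)%type.
Proof.
move=> hF hL.
have [[s _]|nF] := pselect (exists s : AS iF, True).
  exact: AS_laurent_iso_char0 hF hL (AS_pchar0 hF s).
have [[s _]|nL] := pselect (exists s : AS iL, True).
  apply: (AS_laurent_iso_char0 hF hL); apply/(rmorphism_pchar0 iF).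
  apply/(rmorphism_pchar0 (@lconst F)); apply/(rmorphism_pchar0 iL).
  exact: AS_pchar0 hL s.
have noL (s : AS iL) : False by apply: nL; exists s.
have noF (y : AS iF * Zhat) : False by apply: nF; exists y.1.
have pF := AS_profinite hF; have pQ := profinite_quandle_prod pF profinite_quandle_Zhat.
split; [exact: AS_profinite | exact: pQ|].
exists (fun s => False_rect _ (noL s)), (fun y => False_rect _ (noF y)).
by split=> [|| s | y]; [split=> s; case: (noL s) | split=> y; case: (noF y)
  | case: (noL s) | case: (noF y)].
Qed.

Theorem theorem1p2 (F Fsep Lsep : fieldType)
    (iF : {rmorphism F -> Fsep}) (iL : {rmorphism laurent F -> Lsep})
    (hF : is_separable_closure iF) (hL : is_separable_closure iL)
    (F2 : topGroupType) (gen : bool -> F2) (hF2 : is_free_profinite2 (S := bool) gen) :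
  [/\ profinite_quandle_iso (AS iL) (AS iF * Invol F2)%type,
      profinite_quandle_iso (AS iF * Invol F2)%type (AS iF * Zhat)%type &
      profinite_quandle_iso (Invol F2) Zhat].
Proof.
have iso2 := Invol_free_iso hF2.
have iso1 := profinite_quandle_iso_prod (AS_profinite hF) iso2.
split=> //; apply: profinite_quandle_iso_trans (AS_laurent_iso hF hL) _.
exact: profinite_quandle_iso_sym.
Qed.
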